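(* Let $\mathbf X$ be a stationary process satisfying either the AR($p$) condition or the ARCH($p$) condition stated in the context, and assume that the estimators $\widehat\theta=\widehat\theta_n(X_{1-p},\dots,X_n)$ satisfy $\widehat\theta\to\overline\theta$ in probability for some $\overline\theta\in\Theta$. Assume further that the density $f_e=F_e'$ of $e_t=w(\mathbb X_{t-1},X_t,\overline\theta)$ is bounded. Then, for every compact set $K\subset\mathbb R^p$, $$\sup_{x\in K}d\big(P^{X_t^*\mid\mathbb X^*_{t-1}=x},\,P_{\overline\theta}^{X_t\mid\mathbb X_{t-1}=x}\big)\xrightarrow{P}0\qquad(n\to\infty).$$
   Context: Notation: $\mathbb X_{t-1}=(X_{t-1},\dots,X_{t-p})'$ (likewise $\mathbb X^*_{t-1}$); $I(\cdot)$ is the indicator. Observations are $X_{1-p},\dots,X_n$. AR($p$) condition: $X_t=\theta'\mathbb X_{t-1}+\varepsilon_t$, with $(\varepsilon_t)$ i.i.d., $E\varepsilon_t=0$, $0<E\varepsilon_t^2=\sigma^2$, $E\varepsilon_t^4<\infty$, and $\theta\in\Theta=\{\theta\in\mathbb R^p: 1-\theta_1z-\cdots-\theta_pz^p\ne0\text{ for all }z\in\mathbb C,|z|\le1\}$. Here $G(z,\theta,\varepsilon)=\theta'z+\varepsilon$, $w(z,y,\theta)=y-\theta'z$. ARCH($p$) condition: $\mathbf X$ is stationary and $X_t=\sqrt{\theta_0+\theta_1X_{t-1}^2+\cdots+\theta_pX_{t-p}^2}\,\varepsilon_t$, with $(\varepsilon_t)$ i.i.d., $E\varepsilon_t=0$,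 $E\varepsilon_t^2=1$, $E\varepsilon_t^8<\infty$, and $\theta\in\Theta=\{\theta\in\mathbb R^{p+1}:\theta_0>0,\theta_i\ge0\ (i=1,\dots,p),\sum_{i=1}^p\theta_i<1\}$. Here $G(z,\theta,\varepsilon)=\sqrt{\theta_0+\sum_{i=1}^p\theta_iz_i^2}\,\varepsilon$, $w(z,y,\theta)=y/\sqrt{\theta_0+\sum_{i=1}^p\theta_iz_i^2}$. The limit $\overline\theta$ need not equal the parameter $\theta$. $F_e$ is the distribution function of $e_t$. Bootstrap: let $\widetilde\varepsilon_t=w(\mathbb X_{t-1},X_t,\widehat\theta)$ and $\check\varepsilon_t=\widetilde\varepsilon_t-n^{-1}\sum_{s=1}^n\widetilde\varepsilon_s$. Put $\widehat\varepsilon_t=\check\varepsilon_t$ in the AR($p$) case and $\widehat\varepsilon_t=\check\varepsilon_t/\sqrt{n^{-1}\sum_{s=1}^n\check\varepsilon_s^2}$ in the ARCH($p$) case; let $\widehat F_\varepsilon(y)=n^{-1}\sum_{t=1}^nI(\widehat\varepsilon_t\le y)$. Conditionally on the data, $(\varepsilon_t^* )$ is i.i.d. with distribution function $\widehat F_\varepsilon$ and $X_t^*=G(\mathbb X^*_{t-1},\widehat\theta,\varepsilon_t^* )$. Thus $P^{X_t^*\mid\mathbb X^*_{t-1}=x}$ is the (data-dependent) law of $G(x,\widehat\theta,\varepsilon^* )$ with $\varepsilon^*\sim\widehat F_\varepsilon$, and $P_{\overline\theta}^{X_t\mid\mathbb X_{t-1}=x}$ is the law of $G(x,\overline\theta,e)$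 with $e\sim F_e$. Metric: for probability distributions $P,Q$ on $\mathbb R^m$, $d(P,Q)=\inf E[\|X-Y\|\wedge1]$, the infimum over all pairs $(X,Y)$ with $X\sim P$ and $Y\sim Q$, where $\|\cdot\|$ is any norm on $\mathbb R^m$.
   Formalization: In the ARCH(p) case it is additionally assumed that E e_t² = 1 (the claim is false otherwise, since bootstrap residuals are rescaled to variance 1), and θ̂ is taken with θ̂_0 > 0, θ̂_i ≥ 0 so that the square roots in G and w are defined. *)

(* Defs.v *)
From HB Require Import structures.
From mathcomp Require Import all_boot all_order all_algebra.
From mathcomp Require Import all_classical all_reals all_analysis complex.

Set Implicit Arguments.
Unset Strict Implicit.
Unset Printing Implicit Defensive.

Import Order.TTheory GRing.Theory Num.Theory.
Import numFieldNormedType.Exports.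

Local Open Scope classical_set_scope.
Local Open Scope ring_scope.

Inductive model := AR | ARCH.

(* The parameter is (theta_1, ..., theta_p) for AR(p) and
   (theta_0, theta_1, ..., theta_p) for ARCH(p). *)
Definition pdim (m : model) (p : nat) : nat :=
  match m with AR => p | ARCH => p.+1 end.

Section Models.
Context {R : realType}.

Definition ar_mean (p : nat) (th z : 'rV[R]_p) : R :=
  \sum_(i < p) th 0 i * z 0 i.

Definition arch_vol (p : nat) (th : 'rV[R]_p.+1) (z : 'rV[R]_p) : R :=
  Num.sqrt (th 0 ord0 + \sum_(i < p) th 0 (lift ord0 i) * z 0 i ^+ 2).

Definition G (m : model) (p : nat) : 'rV[R]_p -> 'rV[R]_(pdim m p) -> R -> R :=
  match m with
  | AR => fun z th e => ar_mean th z + e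
  | ARCH => fun z th e => arch_vol th z * e
  end.

Definition w (m : model) (p : nat) : 'rV[R]_p -> R -> 'rV[R]_(pdim m p) -> R :=
  match m with
  | AR => fun z y th => y - ar_mean th z
  | ARCH => fun z y th => y / arch_vol th z
  end.

Definition Theta (m : model) (p : nat) : set 'rV[R]_(pdim m p) :=
  match m with
  | AR => [set th : 'rV[R]_p | forall z : R[i]%C, `|z| <= 1 ->
            1 - \sum_(i < p) (th 0 i)%:C%C * z ^+ i.+1 != 0]
  | ARCH => [set th : 'rV[R]_p.+1 |
            [/\ 0 < th 0 ord0, forall i : 'I_p, 0 <= th 0 (lift ord0 i)
              & \sum_(i < p) th 0 (lift ord0 i) < 1]]
  end.

(* The parameters for which the formulas of G and w make sense for every z:
   the radicand in the ARCH formulas has to be positive.  Without this, Num.sqrt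
   and the inverse would return their default value 0 on bad arguments.
   Theta is contained in this set. *)
Definition param_domain (m : model) (p : nat) : set 'rV[R]_(pdim m p) :=
  match m with
  | AR => setT
  | ARCH => [set th : 'rV[R]_p.+1 |
            0 < th 0 ord0 /\ forall i : 'I_p, 0 <= th 0 (lift ord0 i)]
  end.

(* For a trajectory x, the vector (x_{t-1}, ..., x_{t-p}). *)
Definition lags (p : nat) (x : int -> R) (t : int) : 'rV[R]_p :=
  \row_(i < p) x (t - (i.+1)%:Z).

(* For a trajectory x, the observations (x_{1-p}, ..., x_n). *)
Definition sample (n p : nat) (x : int -> R) : (n + p).-tuple R :=
  [tuple x (1 - p%:Z + (i : nat)%:Z) | i < n + p].

Definition resid (m : model) (p : nat) (th : 'rV[R]_(pdim m p))
    (x : int -> R) (t : int) : R :=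
  w (lags p x t) (x t) th.

End Models.

Arguments Theta {R} m p _.
Arguments param_domain {R} m p _.

Section Processes.
Context {R : realType} {d : measure_display} {T : measurableType d}.
Variable P : probability T R.
Local Open Scope ereal_scope.

(* Strict stationarity of a process indexed by all of Z. *)
Definition stationary (X : int -> {RV P >-> R}) : Prop :=
  forall (k : nat) (s : 'I_k -> int) (h : int) (A : set (k.-tuple R)),
    measurable A ->
    P [set om | A [tuple X (s i + h)%R om | i < k]] =
    P [set om | A [tuple X (s i) om | i < k]].

Definition independent (X : int -> {RV P >-> R}) : Prop :=
  forall (s : seq int) (A : int -> set R), uniq s ->
    (forall i, measurable (A i)) ->
    P [set om | forall i, i \in s -> A i (X i om)] =
    \prod_(i <- s) P (X i @^-1` A i).

Definition iid (X : int -> {RV P >-> R}) : Prop :=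
  independent X /\
  forall (i j : int) (A : set R), measurable A ->
    distribution P (X i) A = distribution P (X j) A.

Definition innovation_moments (m : model) (eps : int -> {RV P >-> R}) : Prop :=
  match m with
  | AR => forall t : int,
      [/\ 'E_P[eps t] = 0, 0 < 'E_P[fun om => (eps t om ^+ 2)%R]
        & 'E_P[fun om => (eps t om ^+ 4)%R] < +oo]
  | ARCH => forall t : int,
      [/\ 'E_P[eps t] = 0, 'E_P[fun om => (eps t om ^+ 2)%R] = 1
        & 'E_P[fun om => (eps t om ^+ 8)%R] < +oo]
  end.

Definition model_condition (m : model) (p : nat) (X eps : int -> {RV P >-> R})
    (theta : 'rV[R]_(pdim m p)) : Prop :=
  [/\ stationary X, iid eps, innovation_moments m eps, Theta m p theta
    & forall t : int,
        {ae P, forall om, X t om = G (lags p (X^~ om) t) theta (eps t om)}].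

(* Convergence to 0 in probability of nonnegative extended real quantities.
   The outer measure mu_ext P agrees with P on measurable sets; it is used so
   that the notion is meaningful when the measurability of Y n is not known
   beforehand, e.g. for a supremum over an uncountable set. *)
Definition cvg_to0_in_prob (Y : nat -> T -> \bar R) : Prop :=
  forall delta : R, (0 < delta)%R ->
    mu_ext P [set om | delta%:E < Y n om] @[n --> \oo] --> 0.

(* f is a Lebesgue density of the distribution function of e, bounded. *)
Definition has_bounded_density (e : T -> R) : Prop :=
  exists f : R -> R,
    [/\ measurable_fun setT f,
        exists M : R, forall y, (0 <= f y <= M)%R
      & forall y : R, P [set om | (e om <= y)%R] =
          \int[lebesgue_measure]_(u in `]-oo, y]) (f u)%:E].

End Processes.

Section Metric.
Context {R : realType}.

Definition is_norm (N : R -> R) : Prop :=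
  [/\ forall x y, N (x + y) <= N x + N y,
      forall a x, N (a * x) = `|a| * N x
    & forall x, N x = 0 -> x = 0].

Definition has_law (d : measure_display) (T : measurableType d)
    (P : probability T R) (X : {RV P >-> R}) (Q : set R -> \bar R) : Prop :=
  forall A, measurable A -> distribution P X A = Q A.

(* The metric d(Q1, Q2) for laws on the real line and the norm N. *)
Definition law_dist (N : R -> R) (Q1 Q2 : set R -> \bar R) : \bar R :=
  ereal_inf [set r : \bar R |
    exists (d : measure_display) (T : measurableType d) (P : probability T R)
           (X Y : {RV P >-> R}),
      [/\ has_law X Q1, has_law Y Q2
        & r = 'E_P[fun om => Num.min (N (X om - Y om)%R) 1%R]%E]].

End Metric.

Section Bootstrap.
Context {R : realType}.

Definition average (n : nat) (v : nat -> R) : R :=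
  n%:R^-1 * \sum_(1 <= t < n.+1) v t.

(* Residuals of the trajectory x computed with the parameter th.  When the
   sample variance vanishes, the ARCH residuals are 0 by convention. *)
Definition eps_check (m : model) (p n : nat) (th : 'rV[R]_(pdim m p))
    (x : int -> R) (t : nat) : R :=
  resid th x t%:Z - average n (fun s => resid th x s%:Z).

Definition eps_hat (m : model) (p n : nat) (th : 'rV[R]_(pdim m p))
    (x : int -> R) (t : nat) : R :=
  match m with
  | AR => eps_check n th x t
  | ARCH => eps_check n th x t /
            Num.sqrt (average n (fun s => eps_check n th x s ^+ 2))
  end.

Definition emp_cdf (n : nat) (v : nat -> R) (y : R) : R :=
  average n (fun t => (v t <= y)%R%:R).

(* The law with distribution function emp_cdf n v, see emp_lawE. *)
Definition emp_law (n : nat) (v : nat -> R) (A : set R) : \bar R :=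
  ((n%:R^-1)%:E * \sum_(1 <= t < n.+1) \d_(v t) A)%E.

Lemma emp_lawE (n : nat) (v : nat -> R) (y : R) :
  emp_law n v `]-oo, y] = (emp_cdf n v y)%:E.
Proof.
rewrite /emp_law /emp_cdf /average EFinM -sumEFin; congr (_ * _)%E.
apply: eq_bigr => t _; rewrite diracE; congr (nat_of_bool _)%:R%:E.
by apply/idP/idP; rewrite inE /= in_itv.
Qed.

(* Law of X_t^* given that its p predecessors are z, for the trajectory x. *)
Definition boot_law (m : model) (p n : nat) (th : 'rV[R]_(pdim m p))
    (x : int -> R) (z : 'rV[R]_p) : set R -> \bar R :=
  pushforward (emp_law n (eps_hat n th x)) (G z th).

Definition model_law (d : measure_display) (T : measurableType d)
    (P : probability T R) (m : model) (p : nat) (th : 'rV[R]_(pdim m p))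
    (e : T -> R) (z : 'rV[R]_p) : set R -> \bar R :=
  pushforward (pushforward P e) (G z th).

End Bootstrap.

(* Main.v *)
Require Import Defs.
From HB Require Import structures.
From mathcomp Require Import all_boot all_order all_algebra.
From mathcomp Require Import all_classical all_reals all_analysis complex.
From mathcomp Require Import measurable_realfun ring lra zify.

Set Implicit Arguments.
Unset Strict Implicit.
Unset Printing Implicit Defensive.

Import Order.TTheory GRing.Theory Num.Theory.
Import numFieldNormedType.Exports.

Local Open Scope classical_set_scope.
Local Open Scope ring_scope.

(** Why the theorem holds.

Let e_t be the residuals at the limit parameter thetabar and F their
distribution function.  For a fixed realisation of the data, the bootstrap law
at x and the model law at x are compared through one explicit coupling on the
given probability space: e = e_{t0} is itself one marginal, and the other is
obtained by splitting the range of e at the quantiles of levels j/n (possible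
since F is continuous) and attaching to the j-th slice the residual of rank j
among e_1, ..., e_n ([quantile_index], [rank]).  The attached index is uniform
on {1, ..., n}, so replacing e_t by the bootstrap residual eps_hat_t produces a
variable with exactly the bootstrap law ([emp_law_index]).  The distance is then
at most a constant, uniform over the compact K, times the sum of

- the error of the estimator, |thetahat - thetabar|;
- the average over t of |eps_hat_t - e_t|;
- the mean of min(|e_rank - e|, 1) under the coupling ([gap_mean]).

The last term is controlled by the differences F_n(y) - F(y) at finitely many
points y ([coupling_gap_grid]), where F_n is the empirical distribution function
of e_1, ..., e_n.  The same coupling converts F_n(y) -> F(y) into laws of large
numbers for e_t and e_t^2 ([residual_lln]), and these control the recentring and
the rescaling of the residuals ([eps_hat_close]).

So everything rests on F_n(y) -> F(y) in probability.  Independence of eps_t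
from the past of X is not assumed, but X is causal: if the recursion is started
from zero k steps before t, the result differs from X_t by an amount that is
small in probability, uniformly in t, when k is large.  For AR(p) the difference
solves a homogeneous recursion, which decays geometrically because the
characteristic polynomial has no zero in the closed unit disc ([ar_stable]).  For
ARCH(p) the squared processes differ by at most the size of the initial values
(tight, by stationarity) times a weight built from the innovations alone, whose
mean decays geometrically since the coefficients have sum < 1
([expectation_wlist]).  Hence the indicators of {e_t <= y} are close in mean to
indicators of k-dependent events (the density of e is bounded), and for these a
variance bound applies ([weak_law]).

The mean of e is zero: for AR(p), X is integrable and its mean mu satisfies
mu (1 - sum theta_i) = 0; for ARCH(p), e_t = eps_t V_t with V_t a function of the
past, and causality allows V_t to be replaced by a truncated function of finitely
many earlier innovations, which is independent of eps_t ([arch_parts_le]). *)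

(** * Means and convergence in probability *)

Section MeasurableComparison.
Context {R : realType} {d : measure_display} {T : measurableType d}.

Lemma measurable_lt_set (f g : T -> R) :
  measurable_fun setT f -> measurable_fun setT g ->
  measurable [set x | f x < g x].
Proof.
move=> mf mg; have := measurable_fun_ltr mf mg measurableT (Y := [set true]) I.
by rewrite setTI.
Qed.

Lemma measurable_le_set (f g : T -> R) :
  measurable_fun setT f -> measurable_fun setT g ->
  measurable [set x | f x <= g x].
Proof.
move=> mf mg; have := measurable_fun_ler mf mg measurableT (Y := [set true]) I.
by rewrite setTI.
Qed.

End MeasurableComparison.

Section Expectation.
Context {R : realType} {d : measure_display} {T : measurableType d}.
Variable P : probability T R.
Local Open Scope ereal_scope.

Lemma ge0_expectationD (f g : T -> R) :
  measurable_fun setT f -> measurable_fun setT g ->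
  (forall x, 0 <= f x)%R -> (forall x, 0 <= g x)%R ->
  'E_P[fun x => (f x + g x)%R] = 'E_P[f] + 'E_P[g].
Proof.
move=> mf mg f0 g0; rewrite unlock.
under eq_integral do rewrite EFinD.
rewrite ge0_integralD//; first by move=> x _; rewrite lee_fin.
- exact/measurable_EFinP.
- by move=> x _; rewrite lee_fin.
- exact/measurable_EFinP.
Qed.

Lemma ge0_expectationZl (k : R) (f : T -> R) :
  measurable_fun setT f -> (forall x, 0 <= f x)%R -> (0 <= k)%R ->
  'E_P[fun x => (k * f x)%R] = k%:E * 'E_P[f].
Proof.
move=> mf f0 k0; rewrite unlock.
under eq_integral do rewrite EFinM.
rewrite ge0_integralZl_EFin//; first by move=> x _; rewrite lee_fin.
exact/measurable_EFinP.
Qed.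

Lemma ge0_expectation_sum (I : Type) (s : seq I) (f : I -> T -> R) :
  (forall i, measurable_fun setT (f i)) -> (forall i x, 0 <= f i x)%R ->
  'E_P[fun x => (\sum_(i <- s) f i x)%R] = \sum_(i <- s) 'E_P[f i].
Proof.
move=> mf f0; elim: s => [|a s IH].
  under eq_fun do rewrite big_nil.
  by rewrite big_nil expectation_cst.
under eq_fun do rewrite big_cons.
rewrite big_cons ge0_expectationD// ?IH//.
- exact: measurable_sum.
- by move=> x; rewrite sumr_ge0.
Qed.

Lemma ge0_expectation_le (f g : T -> R) :
  measurable_fun setT f -> measurable_fun setT g ->
  (forall x, 0 <= f x)%R -> (forall x, f x <= g x)%R -> 'E_P[f] <= 'E_P[g].
Proof.
move=> mf mg f0 fg; apply: expectation_le => //.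
- by move=> x; apply: le_trans (fg x).
- exact: aeW.
Qed.

Lemma expectation_le_cst (f : T -> R) (c : R) :
  measurable_fun setT f -> (forall x, 0 <= f x <= c)%R -> 'E_P[f] <= c%:E.
Proof.
move=> mf fc; rewrite -(expectation_cst P c).
by apply: ge0_expectation_le => // x; case/andP: (fc x).
Qed.

Lemma markov_ge0 (f : T -> R) (c : R) : (0 < c)%R ->
  measurable_fun setT f -> (forall x, 0 <= f x)%R ->
  c%:E * P [set x | c < f x]%R <= 'E_P[f].
Proof.
move=> c0 mf f0.
have mA : measurable [set x | c < f x]%R.
  exact: measurable_lt_set.
rewrite -expectation_indic// -ge0_expectationZl//; last exact: ltW.
apply: ge0_expectation_le => //.
- by apply: measurable_funM => //; exact: measurable_indic.
- by move=> x; rewrite mulr_ge0// ltW.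
- move=> x; rewrite indicE; have [/set_mem /= h|_] := boolP (x \in _).
    by rewrite mulr1 ltW.
  by rewrite mulr0.
Qed.

End Expectation.

Section SmallInProbability.
Context {R : realType} {d : measure_display} {T : measurableType d}.
Variable P : probability T R.
Local Open Scope ereal_scope.

(** Convergence to 0 in probability of real quantities, in epsilon-delta form.  The
outer measure makes it meaningful without measurability, as the bootstrap
quantities are only dominated by measurable ones. *)
Definition small (Z : nat -> T -> R) : Prop :=
  forall del kap : R, (0 < del)%R -> (0 < kap)%R ->
    \forall n \near \oo, mu_ext P [set w | del < Z n w]%R <= kap%:E.

Lemma mu_extU2 (A B : set T) : mu_ext P (A `|` B) <= mu_ext P A + mu_ext P B.
Proof. exact: (outer_measureU2 (mu_ext P)). Qed.

(** The single device for truncation arguments: to show that [Z] is negligible it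
is enough, for each [kap], to bound it by [kap] plus a term of mean at most
[kap], outside an event where a negligible quantity [U] is large.  Markov
inequality then converts means into probabilities. *)
Lemma small_dom (Z : nat -> T -> R) :
  (forall kap : R, (0 < kap)%R -> exists (U V : nat -> T -> R) (del : R),
     [/\ small U, (0 < del)%R,
         (forall n, measurable_fun setT (V n)) /\ (forall n w, 0 <= V n w)%R,
         \forall n \near \oo, 'E_P[V n] <= kap%:E
       & \forall n \near \oo, forall w, (U n w <= del -> Z n w <= kap + V n w)%R]) ->
  small Z.
Proof.
move=> H del kap del0 kap0.
(* The bound k on the mean has to pay for Markov inequality at level del / 2 and
   to be itself at most del / 2. *)
pose k := (del / 2 * Num.min 1 (kap / 2))%R.
have m0 : (0 < Num.min 1 (kap / 2))%R by rewrite lt_min ltr01 divr_gt0.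
have k0 : (0 < k)%R by rewrite mulr_gt0// divr_gt0.
have [U [V [e [sU e0 [mV V0] EV ZUV]]]] := H k k0.
have kap20 : (0 < kap / 2)%R by rewrite divr_gt0.
have := sU e (kap / 2)%R e0 kap20.
move: EV ZUV; apply: filterS3 => n EV ZUV PU.
have -> : kap = (kap / 2 + kap / 2)%R by rewrite -splitr.
apply: (@le_trans _ _ (mu_ext P [set w | e < U n w]%R
                       + mu_ext P [set w | del / 2 < V n w]%R)).
  apply: le_trans (mu_extU2 _ _); apply: le_outer_measure => w /= dZ.
  have [Ue|] := leP (U n w) e; last by left.
  right; have := le_lt_trans (lexx _) (lt_le_trans dZ (ZUV w Ue)).
  have : (k <= del / 2)%R.
    by rewrite ler_piMr ?ge_min ?lexx// ltW// divr_gt0.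
  move: k {k0 ZUV EV H} => k hk hd.
  by lra.
rewrite EFinD leeD// measurable_mu_extE; last first.
  by apply: measurable_lt_set => //; exact: measurable_cst.
have d20 : (0 < del / 2)%R by rewrite divr_gt0.
rewrite -(@lee_pmul2l _ (del / 2)%:E)// ?lte_fin//.
apply: le_trans (markov_ge0 P d20 (mV n) (V0 n)) _.
apply: le_trans EV _.
by rewrite -EFinM lee_fin ler_pM2l// ge_min lexx orbT.
Qed.

Lemma small_le (Z Y : nat -> T -> R) : small Y ->
  (\forall n \near \oo, forall w, Z n w <= Y n w)%R -> small Z.
Proof.
move=> sY ZY del kap d0 k0; have := sY _ _ d0 k0.
move: ZY; apply: filterS2 => n ZY; apply: le_trans.
by apply: le_outer_measure => w /= h; apply: lt_le_trans (ZY w).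
Qed.

Lemma smallD (Z Y : nat -> T -> R) : small Z -> small Y ->
  small (fun n w => Z n w + Y n w)%R.
Proof.
move=> sZ sY del kap d0 k0.
have d20 : (0 < del / 2)%R by rewrite divr_gt0.
have k20 : (0 < kap / 2)%R by rewrite divr_gt0.
have := sZ _ _ d20 k20; have := sY _ _ d20 k20.
apply: filterS2 => n h1 h2.
have -> : kap = (kap / 2 + kap / 2)%R by rewrite -splitr.
rewrite EFinD; apply: le_trans (leeD h2 h1).
apply: le_trans (mu_extU2 _ _); apply: le_outer_measure => w /= h.
have [Ue|] := leP (Z n w) (del / 2)%R; last by left.
by right; lra.
Qed.

Lemma small0 : small (fun _ _ => 0%R).
Proof.
move=> del kap d0 k0; apply: nearW => n.
rewrite [X in mu_ext _ X](_ : _ = set0) ?mu_ext0 ?lee_fin ?ltW//.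
by apply/seteqP; split=> w //=; rewrite ltNge (ltW d0).
Qed.

Lemma small_sum (I : Type) (s : seq I) (Z : I -> nat -> T -> R) :
  (forall i, small (Z i)) -> small (fun n w => \sum_(i <- s) Z i n w)%R.
Proof.
move=> sZ; elim: s => [|a s IH].
  by apply: small_le small0 _; apply: nearW => n w; rewrite big_nil.
apply: small_le (smallD (sZ a) IH) _.
by apply: nearW => n w; rewrite big_cons.
Qed.

Lemma smallZl (c : R) (Z : nat -> T -> R) : (0 <= c)%R -> small Z ->
  small (fun n w => c * Z n w)%R.
Proof.
rewrite le_eqVlt => /predU1P[<- _|c0 sZ del kap d0 k0].
  by apply: small_le small0 _; apply: nearW => n w; rewrite mul0r.
have dc : (0 < del / c)%R by rewrite divr_gt0.
apply: filterS (sZ _ _ dc k0) => n; apply: le_trans.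
by apply: le_outer_measure => w /=; rewrite ltr_pdivrMr// mulrC.
Qed.

Lemma cvg_to0_small (Z : nat -> T -> R) :
  cvg_to0_in_prob P (fun n w => (Z n w)%:E) -> small Z.
Proof.
move=> cZ del kap d0 k0; have /fine_cvgP[fZ /cvgrPdist_le/(_ _ k0) ] := cZ del d0.
move: fZ; apply: filterS2 => n /= fZ; rewrite sub0r normrN => /(le_trans (ler_norm _)).
by rewrite -lee_fin fineK.
Qed.

(** A quantity with values in the extended reals tends to 0 as soon as it is
controlled, in any modulus, by a negligible real one. *)
Lemma small_cvg_to0 (Z : nat -> T -> R) (Y : nat -> T -> \bar R) : small Z ->
  (forall del : R, (0 < del)%R -> exists2 tau : R, (0 < tau)%R &
     \forall n \near \oo, forall w, (Z n w <= tau)%R -> Y n w <= del%:E) ->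
  cvg_to0_in_prob P Y.
Proof.
move=> sZ H del d0; have [tau t0 ZY] := H _ d0.
apply/fine_cvgP; split.
  have := sZ _ _ t0 ltr01; move: ZY; apply: filterS2 => n ZY h.
  rewrite ge0_fin_numE ?mu_ext_ge0//.
  apply: (@le_lt_trans _ _ 1) (ltry _); apply: le_trans h.
  apply: le_outer_measure => w /= dY; rewrite ltNge; apply/negP => /ZY.
  by rewrite leNgt dY.
apply/cvgrPdist_le => kap k0.
have := sZ _ _ t0 k0; move: ZY; apply: filterS2 => n ZY h.
have h' : mu_ext P [set om | del%:E < Y n om] <= kap%:E.
  apply: le_trans h.
  apply: le_outer_measure => w /= dY; rewrite ltNge; apply/negP => /ZY.
  by rewrite leNgt dY.
rewrite sub0r normrN ger0_norm ?fine_ge0 ?mu_ext_ge0//=.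
rewrite -lee_fin fineK// ge0_fin_numE ?mu_ext_ge0//.
exact: le_lt_trans h' (ltry _).
Qed.

End SmallInProbability.

(** * Independence of sigma-algebras of innovations *)

Section Independence.
Context {R : realType} {d : measure_display} {T : measurableType d}.
Variables (P : probability T R) (eps : int -> {RV P >-> R}).

(** Finite-dimensional events of the innovations with indices in [I]: a pi-system,
chosen because independence of the sequence is a statement about exactly these. *)
Definition cylinder (I : set int) : set (set T) :=
  [set B | exists (s : seq int) (A : int -> set R),
     [/\ uniq s, (forall i, i \in s -> I i), (forall i, measurable (A i))
       & B = [set om | forall i, i \in s -> A i (eps i om)]]].

(** Measurability with respect to the sigma-algebra generated by the innovations
with indices in [I]; typing the domain as the generated measurable space lets
the closure properties of measurable functions apply. *)
Definition adapted (I : set int) (f : T -> R) : Prop :=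
  @measurable_fun _ _ (g_sigma_algebraType (cylinder I)) R setT f.

Lemma measurable_event (s : seq int) (A : int -> set R) :
  (forall i, measurable (A i)) ->
  measurable [set om | forall i, i \in s -> A i (eps i om)].
Proof.
move=> mA; elim: s => [|a s IH].
  rewrite [X in measurable X](_ : _ = setT) //.
  by apply/seteqP; split=> om //= _ i; rewrite in_nil.
rewrite [X in measurable X](_ : _ = (eps a @^-1` A a) `&`
    [set om | forall i, i \in s -> A i (eps i om)]); last first.
  apply/seteqP; split=> om /=.
    by move=> h; split => [|i si]; apply: h; rewrite inE ?eqxx ?si ?orbT.
  by move=> [h1 h2] i; rewrite inE => /predU1P[->//|/h2].
apply: measurableI => //.
by rewrite -[X in measurable X]setTI; exact: measurable_funPT.
Qed.

Lemma cylinder_measurable (I : set int) : cylinder I `<=` measurable.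
Proof. by move=> _ [s [A [_ _ mA ->]]]; exact: measurable_event. Qed.

Lemma sigma_cylinder_measurable (I : set int) :
  <<s cylinder I >> `<=` measurable.
Proof.
exact: (smallest_sub (@sigma_algebra_measurable _ T) (@cylinder_measurable I)).
Qed.

Lemma cylinder_setI (I : set int) : setI_closed (cylinder I).
Proof.
move=> _ _ [s [A [us sI mA ->]]] [s' [A' [us' sI' mA' ->]]].
exists (undup (s ++ s')), (fun i => (if i \in s then A i else setT) `&`
  (if i \in s' then A' i else setT)); split.
- exact: undup_uniq.
- by move=> i; rewrite mem_undup mem_cat => /orP[/sI|/sI'].
- by move=> i; apply: measurableI; case: ifP.
- apply/seteqP; split=> om /=.
    move=> [h h'] i _; split; case: ifP => //; [exact: h|exact: h'].
  move=> h; split=> i si.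
    by have := h i; rewrite mem_undup mem_cat si => /(_ isT)[].
  by have := h i; rewrite mem_undup mem_cat si orbT => /(_ isT)[].
Qed.

Lemma cylinder_setT (I : set int) : cylinder I setT.
Proof.
exists [::], (fun=> setT); split=> //.
by apply/seteqP; split=> om //= _ i; rewrite in_nil.
Qed.

Lemma cylinder_sub (I J : set int) : I `<=` J -> cylinder I `<=` cylinder J.
Proof.
move=> IJ _ [s [A [us sI mA ->]]]; exists s, A; split=> // i /sI; exact: IJ.
Qed.

Lemma adapted_sub (I J : set int) (f : T -> R) :
  I `<=` J -> adapted I f -> adapted J f.
Proof.
move=> IJ af mT A mA; have := af measurableT A mA.
apply: smallest_sub; first exact: smallest_sigma_algebra.
by apply: (subset_trans (cylinder_sub IJ)); exact: sub_sigma_algebra.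
Qed.

Lemma adapted_measurable (I : set int) (f : T -> R) :
  adapted I f -> measurable_fun setT f.
Proof.
move=> af mT A mA; have := af measurableT A mA.
exact: sigma_cylinder_measurable.
Qed.

Lemma adapted_eps (I : set int) (i : int) : I i -> adapted I (eps i).
Proof.
move=> Ii _ A mA; apply: sub_sigma_algebra; exists [:: i], (fun=> A); split=> //.
  by move=> j; rewrite inE => /eqP ->.
apply/seteqP; split=> om /=.
  by move=> [_ h] j; rewrite inE => /eqP ->.
by move=> h; split=> //; apply: h; rewrite inE.
Qed.

Hypothesis indep_eps : independent eps.

Lemma independent_cylinder (I J : set int) (A B : set T) :
  (forall i, I i -> J i -> False) -> cylinder I A -> cylinder J B ->
  P (A `&` B) = (P A * P B)%E.
Proof.
move=> IJ [s [C [us sI mC ->]]] [s' [D [us' sJ mD ->]]].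
pose E i := if i \in s then C i else D i.
have ss' i : i \in s' -> (i \in s) = false.
  by move=> /sJ Ji; apply/negP => /sI /IJ; apply.
rewrite (_ : _ `&` _ = [set om | forall i, i \in s ++ s' -> E i (eps i om)]).
  rewrite !indep_eps//.
  - rewrite big_cat/=; congr (_ * _)%E; rewrite big_seq [RHS]big_seq;
      apply: eq_bigr => i si; rewrite /E.
      by rewrite si.
    by rewrite ss'.
  - rewrite cat_uniq us us' andbT /=; apply/hasPn => i /= /ss' ->//.
  - by move=> i; rewrite /E; case: ifP.
apply/seteqP; split=> om /=.
  move=> [h h'] i; rewrite mem_cat /E => /orP[si|si].
    by rewrite si; exact: h.
  by rewrite ss'//; exact: h'.
move=> h; split=> i si.
  by have := h i; rewrite mem_cat /E si => /(_ isT).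
by have := h i; rewrite mem_cat /E si ss' ?orbT// => /(_ isT).
Qed.

(** Pi-lambda argument, once in each variable: with one event fixed, both sides are
finite measures in the other that agree on a pi-system. *)
Lemma independent_sigma (I J : set int) (A B : set T) :
  (forall i, I i -> J i -> False) ->
  <<s cylinder I >> A -> <<s cylinder J >> B ->
  P (A `&` B) = (P A * P B)%E.
Proof.
move=> IJ.
have PB0 B' : (0 <= fine (P B'))%R by exact: fine_ge0.
have step1 A' B' : <<s cylinder I >> A' -> cylinder J B' ->
    P (A' `&` B') = (P A' * P B')%E.
  move=> sA' cB'.
  have mB' := cylinder_measurable cB'.
  have H : forall E, <<s cylinder I >> E ->
      mrestr P mB' E = mscale (NngNum (PB0 B')) P E.
    apply: (g_sigma_algebra_measure_unique (cylinder I)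
      (@cylinder_measurable I) (fun=> setT)).
    + by move=> _; exact: cylinder_setT.
    + by rewrite bigcup_const//; exists 0%N.
    + exact: cylinder_setI.
    + move=> E cE; rewrite /= /mrestr /mscale /= fineK ?fin_num_measure//.
      by rewrite (independent_cylinder IJ)// muleC.
    + move=> _; rewrite /= /mrestr setTI.
      by apply: (le_lt_trans (probability_le1 P mB')); exact: ltry.
  have := H _ sA'; rewrite /= /mrestr /mscale /= fineK ?fin_num_measure// => ->.
  by rewrite muleC.
move=> sA sB; have mA := sigma_cylinder_measurable sA.
have H : forall E, <<s cylinder J >> E ->
    mrestr P mA E = mscale (NngNum (PB0 A)) P E.
  apply: (g_sigma_algebra_measure_unique (cylinder J)
    (@cylinder_measurable J) (fun=> setT)).
  + by move=> _; exact: cylinder_setT.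
  + by rewrite bigcup_const//; exists 0%N.
  + exact: cylinder_setI.
  + move=> E cE; rewrite /= /mrestr /mscale /= fineK ?fin_num_measure//.
    by rewrite setIC step1.
  + move=> _; rewrite /= /mrestr setTI.
    by apply: (le_lt_trans (probability_le1 P mA)); exact: ltry.
by have := H _ sB; rewrite /= /mrestr /mscale /= fineK ?fin_num_measure// setIC.
Qed.

(** The joint law of the two functions agrees with the product law on rectangles,
hence everywhere; Tonelli does the rest. *)
Lemma independent_expectation (I J : set int) (f g : T -> R) :
  (forall i, I i -> J i -> False) -> adapted I f -> adapted J g ->
  (forall x, 0 <= f x) -> (forall x, 0 <= g x) ->
  ('E_P[fun x => (f x * g x)%R] = 'E_P[f] * 'E_P[g])%E.
Proof.
move=> IJ af ag f0 g0.
have mf := adapted_measurable af; have mg := adapted_measurable ag.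
pose F : {mfun T >-> R} := HB.pack f (isMeasurableFun.Build _ _ _ _ f mf).
pose G : {mfun T >-> R} := HB.pack g (isMeasurableFun.Build _ _ _ _ g mg).
have mh : measurable_fun setT (fun x => (f x, g x)) by exact: measurable_fun_pair.
pose H : {mfun T >-> (R * R)%type} :=
  HB.pack (fun x => (f x, g x)) (isMeasurableFun.Build _ _ _ _ _ mh).
have prodE : forall X, measurable X ->
    (distribution P F \x distribution P G)%E X = distribution P H X.
  apply: product_measure_unique => A B mA mB.
  rewrite /distribution /pushforward /=.
  rewrite -(independent_sigma IJ); first by congr (P _); apply/seteqP.
    by have := af measurableT A mA; rewrite setTI.
  by have := ag measurableT B mB; rewrite setTI.
pose phi (z : R * R) : \bar R := (`|z.1| * `|z.2|)%:E.
have mphi : measurable_fun setT phi.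
  apply/measurable_EFinP; apply: measurable_funM;
    apply: measurableT_comp => //; exact: normr_measurable.
have phi0 z : (0 <= phi z)%E by rewrite lee_fin mulr_ge0.
transitivity (\int[distribution P H]_z phi z)%E.
  rewrite ge0_integral_distribution// unlock; apply: eq_integral => x _ /=.
  by rewrite /phi/= !ger0_norm.
rewrite (eq_measure_integral (distribution P F \x distribution P G)%E)//; last first.
  by move=> A mA _; exact/esym/prodE.
rewrite fubini_tonelli1// /fubini_F.
under eq_integral => x _.
  rewrite (_ : (\int[_]_y _)%E = `|x|%:E * \int[distribution P G]_y (`|y|)%:E)%E; last first.
    rewrite -ge0_integralZl_EFin//.
      by apply/measurable_EFinP; exact: normr_measurable.
  over.
rewrite ge0_integralZr//; last first.
- by apply: integral_ge0 => y _; rewrite lee_fin.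
- by apply/measurable_EFinP; exact: normr_measurable.
rewrite !ge0_integral_distribution//; last 2 first.
- by apply/measurable_EFinP; exact: normr_measurable.
- by apply/measurable_EFinP; exact: normr_measurable.
rewrite unlock; congr (_ * _)%E; apply: eq_integral => x _ /=; by rewrite ger0_norm.
Qed.

End Independence.

(** * Stability of autoregressive recursions *)

Section StableRecursion.
Context {R : realType}.
Local Notation C := (R[i]%C).
Local Notation "x %:C" := (real_complex R x).
Import ComplexField.Normc.

Definition weighted_sum (rho : R) (n : nat) (U : {poly C}) : R :=
  \sum_(k < n.+1) rho ^+ k * normc U`_k.

Lemma normc_ge0 (x : C) : 0 <= normc x.
Proof. by case: x => a b; rewrite /= sqrtr_ge0. Qed.

Lemma normc_real (x : R) : normc x%:C = `|x|.
Proof. by rewrite /= expr0n addr0 sqrtr_sqr. Qed.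

(** If V = (1 - a z) U then U_k = V_k + a U_{k-1}; summing with weights rho^k, the
last term costs only a factor rho |a| < 1. *)
Lemma weighted_sum_factor (rho : R) (a : C) (n : nat) (U : {poly C}) :
  0 <= rho -> rho * normc a < 1 ->
  (1 - rho * normc a) * weighted_sum rho n U <=
  weighted_sum rho n ((1 - a *: 'X) * U).
Proof.
move=> rho0 ra.
have coefV k : ((1 - a *: 'X) * U)`_k = U`_k - (if k is j.+1 then a * U`_j else 0).
  rewrite mulrBl mul1r -scalerAl coefB coefZ coefXM; case: k => [|k] /=.
    by rewrite mulr0.
  by [].
have H k : normc U`_k <= normc ((1 - a *: 'X) * U)`_k +
    (if k is j.+1 then normc a * normc U`_j else 0).
  have {1}-> : U`_k = ((1 - a *: 'X) * U)`_k + (if k is j.+1 then a * U`_j else 0).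
    by rewrite coefV subrK.
  apply: le_trans (le_normcD _ _) _; rewrite lerD2l; case: k => [|k].
    by rewrite normc0.
  by rewrite normcM.
rewrite mulrBl mul1r lerBlDr.
apply: (@le_trans _ _ (weighted_sum rho n ((1 - a *: 'X) * U) +
   \sum_(k < n.+1) rho ^+ k * (if (k : nat) is j.+1 then normc a * normc U`_j else 0))).
  rewrite /weighted_sum -big_split /=; apply: ler_sum => k _.
  by rewrite -mulrDr ler_wpM2l// exprn_ge0.
rewrite lerD2l big_ord_recl /= mulr0 add0r /weighted_sum big_ord_recr /= mulrDr.
rewrite mulr_sumr -[leLHS]addr0 lerD//.
  apply: ler_sum => k _; rewrite exprS.
  rewrite (_ : (_ + k)%N = k)//; lra.
by rewrite !mulr_ge0 ?normc_ge0 ?exprn_ge0.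
Qed.

Lemma weighted_sum_factors (rho : R) (s : seq C) (n : nat) (U : {poly C}) :
  0 <= rho -> (forall a, a \in s -> rho * normc a < 1) ->
  \prod_(a <- s) (1 - rho * normc a) * weighted_sum rho n U <=
  weighted_sum rho n (\prod_(a <- s) (1 - a *: 'X) * U).
Proof.
move=> rho0; elim: s U => [|a s IH] U Hs; first by rewrite !big_nil !mul1r.
rewrite !big_cons.
have Ha : rho * normc a < 1 by apply: Hs; rewrite mem_head.
have Hs' b : b \in s -> rho * normc b < 1.
  by move=> bs; apply: Hs; rewrite inE bs orbT.
rewrite -mulrA; apply: (@le_trans _ _ ((1 - rho * normc a) *
    weighted_sum rho n (\prod_(a <- s) (1 - a *: 'X) * U))).
  by rewrite ler_wpM2l ?IH// subr_ge0 ltW.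
rewrite -[X in _ <= weighted_sum _ _ X]mulrA.
exact: weighted_sum_factor.
Qed.

(** Finitely many numbers of modulus < 1 leave room for a common rate r < 1 that
still beats all of them. *)
Lemma exists_rate (s : seq C) : (forall a, a \in s -> normc a < 1) ->
  exists2 r : R, 0 < r < 1 & forall a, a \in s -> r^-1 * normc a < 1.
Proof.
elim: s => [|a s IH] H; first by exists 2^-1 => //; lra.
have [|r /andP[r0 r1] Hr] := IH.
  by move=> b bs; apply: H; rewrite inE bs orbT.
have Ha : normc a < 1 by apply: H; rewrite mem_head.
exists (Num.max r ((normc a + 1) / 2)).
  by rewrite lt_max r0 /= gt_max r1 /=; lra.
move=> b; have m0 : 0 < Num.max r ((normc a + 1) / 2) by rewrite lt_max r0.
rewrite mulrC ltr_pdivrMr// mul1r lt_max inE => /predU1P[->|bs].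
  by apply/orP; right; lra.
by apply/orP; left; have := Hr _ bs; rewrite mulrC ltr_pdivrMr// mul1r.
Qed.

(** The zeros z of 1 - sum theta_i z^(i+1) satisfy |z| > 1 and the constant
coefficient is 1, so the polynomial is the product of the factors 1 - z/z_j. *)
Lemma ar_factorization (p : nat) (th : 'rV[R]_p) : Theta AR p th ->
  exists s : seq C, (forall a, a \in s -> normc a < 1) /\
    1 - \sum_(i < p) (th 0 i)%:C *: 'X^(i.+1) = \prod_(a <- s) (1 - a *: 'X).
Proof.
move=> /= Hth; set q := 1 - _.
have qE z : q.[z] = 1 - \sum_(i < p) (th 0 i)%:C * z ^+ i.+1.
  rewrite !hornerE horner_sum; congr (_ - _); apply: eq_bigr => i _.
  by rewrite hornerZ hornerXn.
have q0 : q.[0] = 1.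
  rewrite qE big1 ?subr0// => i _; by rewrite expr0n mulr0.
have [zs qzs] := closed_field_poly_normal q.
have lq : lead_coef q != 0.
  rewrite lead_coef_eq0; apply/eqP => q00; move: q0; rewrite q00 horner0.
  by move/eqP; rewrite eq_sym oner_eq0.
have rt z : z \in zs -> 1 < normc z.
  move=> zs_; have : q.[z] = 0.
    rewrite qzs hornerZ horner_prod.
    by rewrite (big_rem z)//= hornerXsubC subrr mul0r mulr0.
  rewrite qE => /eqP h; rewrite ltNge; apply/negP => z1.
  have := Hth z; rewrite -(lecR (normc z) 1) in z1.
  by move=> /(_ z1); rewrite h.
have nz z : z \in zs -> z != 0.
  by move=> /rt; apply: contraTneq => ->; rewrite normc0 ltr10.
exists [seq z^-1 | z <- zs]; split.
  move=> a /mapP[z /rt z1 ->]; rewrite normcV invf_lt1//.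
  exact: lt_trans z1.
rewrite big_map.
have -> : q = (lead_coef q * \prod_(z <- zs) (- z)) *: \prod_(z <- zs) (1 - z^-1 *: 'X).
  rewrite {1}qzs -scalerA; congr (_ *: _).
  rewrite -scaler_prod /=; rewrite big_seq [RHS]big_seq; apply: eq_bigr => z /nz z0.
  by rewrite scalerBr scalerA mulNr divff// scaleN1r opprK -alg_polyC scaleNr addrC.
rewrite (_ : _ * _ = 1) ?scale1r//.
rewrite -[RHS]q0 [in RHS]qzs hornerZ horner_prod; congr (_ * _).
by apply: eq_bigr => z _; rewrite hornerXsubC sub0r.
Qed.

(** Geometric stability of the autoregressive recursion.  The sequence [u] is
extended by 0 to negative indices, so that initial values count as inputs of
the recursion; passing to polynomials truncated at degree [n] turns the
recursion into multiplication by the characteristic polynomial. *)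
Lemma ar_stable (p : nat) (th : 'rV[R]_p) : Theta AR p th ->
  exists r c : R, [/\ 0 < r < 1, 0 <= c & forall (u : nat -> R) (n : nat),
    `|u n| <= c * \sum_(k < n.+1) r ^+ (n - k) *
       `|u k - \sum_(i < p | (i < k)%N) th 0 i * u (k - i.+1)%N|].
Proof.
move=> /ar_factorization[s [s1 qE]].
have [r /andP[r0 r1] Hr] := exists_rate s1.
pose K := \prod_(a <- s) (1 - r^-1 * normc a).
have K0 : 0 < K.
  by rewrite /K big_seq prodr_gt0// => a /Hr; rewrite subr_gt0.
exists r, K^-1; split; first by rewrite r0.
  by rewrite invr_ge0 ltW.
move=> u n.
pose U : {poly C} := \poly_(k < n.+1) (u k)%:C.
have UE k : (k <= n)%N -> U`_k = (u k)%:C by rewrite coef_poly ltnS => ->.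
have VE k : (k <= n)%N -> (\prod_(a <- s) (1 - a *: 'X) * U)`_k =
    (u k - \sum_(i < p | (i < k)%N) th 0 i * u (k - i.+1)%N)%:C.
  move=> kn; rewrite -qE mulrBl mul1r coefB UE// mulr_suml coef_sum rmorphB.
  congr (_ - _); rewrite rmorph_sum [RHS]big_mkcond /=; apply: eq_bigr => i _.
  rewrite -scalerAl coefZ coefXnM ltnS leqNgt.
  case: ltnP => ik /=; last by rewrite mulr0.
  rewrite UE ?rmorphM//; exact: leq_trans (leq_subr _ _) kn.
have := weighted_sum_factors (s := s) n U (rho := r^-1).
rewrite invr_ge0 (ltW r0) => /(_ isT Hr); rewrite -/K => H.
rewrite [leRHS]mulrC ler_pdivlMr//.
have := ler_wpM2l (exprn_ge0 n (ltW r0)) H.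
have wU : r ^- n * `|u n| <= weighted_sum r^-1 n U.
  rewrite /weighted_sum big_ord_recr /= UE// normc_real exprVn.
  rewrite lerDr sumr_ge0// => k _; rewrite mulr_ge0 ?normc_ge0//.
  by rewrite exprn_ge0// invr_ge0 ltW.
move=> H2; apply: le_trans (le_trans _ H2) _.
  rewrite mulrCA mulrC ler_wpM2l// ?(ltW K0)//.
  have := ler_wpM2l (exprn_ge0 n (ltW r0)) wU.
  by rewrite mulrA mulfV ?mul1r// expf_neq0// gt_eqF.
rewrite /weighted_sum mulr_sumr; apply: ler_sum => k _.
rewrite VE; last by rewrite -ltnS.
rewrite normc_real mulrA ler_wpM2r// exprVn.
by rewrite expfB_cond ?gt_eqF//= add0n -ltnS.
Qed.

End StableRecursion.

(** * Measurability, stationarity and tightness *)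

Section MeasurableModel.
Context {R : realType} {d : measure_display} {T : measurableType d}.

Lemma measurable_sqrt (f : T -> R) : measurable_fun setT f ->
  measurable_fun setT (fun x => Num.sqrt (f x)).
Proof.
move=> mf; apply: (@measurableT_comp _ _ _ _ _ _ (@Num.sqrt R)) => //.
apply: continuous_measurable_fun; exact: sqrt_continuous.
Qed.

(** Inversion is measurable on nonnegative numbers as the power of exponent -1. *)
Lemma measurable_inv (f : T -> R) : (forall x, 0 <= f x) ->
  measurable_fun setT f -> measurable_fun setT (fun x => (f x)^-1).
Proof.
move=> f0 mf.
have -> : (fun x => (f x)^-1) = (fun x => f x `^ (-1)).
  by apply/funext => x; rewrite powR_inv1.
apply: (@measurableT_comp _ _ _ _ _ _ (fun y : R => y `^ (-1))) => //.
Qed.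

Lemma measurable_ar_mean (p : nat) (th : 'rV[R]_p) (z : T -> 'rV[R]_p) :
  (forall i, measurable_fun setT (fun x => z x 0 i)) ->
  measurable_fun setT (fun x => ar_mean th (z x)).
Proof.
move=> mz; apply: measurable_sum => i.
by apply: measurable_funM => //; exact: measurable_cst.
Qed.

Lemma measurable_arch_vol (p : nat) (th : 'rV[R]_p.+1) (z : T -> 'rV[R]_p) :
  (forall i, measurable_fun setT (fun x => z x 0 i)) ->
  measurable_fun setT (fun x => arch_vol th (z x)).
Proof.
move=> mz; apply: measurable_sqrt; apply: measurable_funD => //.
apply: measurable_sum => i; apply: measurable_funM => //.
exact: measurable_funX.
Qed.

Lemma measurable_G (m : model) (p : nat) (th : 'rV[R]_(pdim m p))
    (z : T -> 'rV[R]_p) (y : T -> R) :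
  (forall i, measurable_fun setT (fun x => z x 0 i)) -> measurable_fun setT y ->
  measurable_fun setT (fun x => G (z x) th (y x)).
Proof.
case: m th => th mz my /=.
  by apply: measurable_funD => //; exact: measurable_ar_mean.
by apply: measurable_funM => //; exact: measurable_arch_vol.
Qed.

Lemma measurable_w (m : model) (p : nat) (th : 'rV[R]_(pdim m p))
    (z : T -> 'rV[R]_p) (y : T -> R) :
  (forall i, measurable_fun setT (fun x => z x 0 i)) -> measurable_fun setT y ->
  measurable_fun setT (fun x => w (z x) (y x) th).
Proof.
case: m th => th mz my /=.
  by apply: measurable_funB => //; exact: measurable_ar_mean.
apply: measurable_funM => //; apply: measurable_inv.
  by move=> x; exact: sqrtr_ge0.
exact: measurable_arch_vol.
Qed.

End MeasurableModel.

Lemma lag_shift (s : int) (k i : nat) :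
  s + k.+1%:Z - i.+1%:Z = s + k%:Z - i%:Z.
Proof. by lia. Qed.

Section Windows.
Context {R : realType}.

(** All functionals of the process that occur are functions of (x_t, ..., x_{t-p});
stationarity is used only through this vector. *)
Definition window (p : nat) (x : int -> R) (t : int) : p.+1.-tuple R :=
  [tuple x (t - (i : nat)%:Z) | i < p.+1].

Definition window_lags (p : nat) (v : p.+1.-tuple R) : 'rV[R]_p :=
  \row_(i < p) tnth v (lift ord0 i).

Lemma window_head (p : nat) (x : int -> R) (t : int) :
  tnth (window p x t) ord0 = x t.
Proof. by rewrite tnth_mktuple subr0. Qed.

Lemma lags_window (p : nat) (x : int -> R) (t : int) :
  lags p x t = window_lags (window p x t).
Proof. by apply/rowP => i; rewrite !mxE tnth_mktuple. Qed.

Lemma measurable_window_lags (p : nat) (i : 'I_p) :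
  measurable_fun setT (fun v : p.+1.-tuple R => window_lags v 0 i).
Proof.
rewrite (_ : (fun _ => _) = (fun v : p.+1.-tuple R => tnth v (lift ord0 i))).
  exact: measurable_tnth.
by apply/funext => v; rewrite mxE.
Qed.

End Windows.

Section Stationarity.
Context {R : realType} {d : measure_display} {T : measurableType d}.
Variables (P : probability T R) (X : int -> {RV P >-> R}) (p : nat).
Local Notation path om := (fun t : int => X t om).

Lemma measurable_window (t : int) :
  measurable_fun setT (fun om => window p (path om) t).
Proof.
apply/measurable_fun_tnthP => i.
rewrite (_ : _ \o _ = X (t - (i : nat)%:Z)); first exact: measurable_funPT.
by apply/funext => om /=; rewrite tnth_mktuple.
Qed.

Lemma measurable_window_comp (t : int) (g : p.+1.-tuple R -> R) :
  measurable_fun setT g -> measurable_fun setT (fun om => g (window p (path om) t)).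
Proof. by move=> mg; exact: (measurableT_comp mg (measurable_window t)). Qed.

Hypothesis stat : stationary X.

Lemma stationary_window (t t' : int) (A : set (p.+1.-tuple R)) : measurable A ->
  P [set om | A (window p (path om) t)] = P [set om | A (window p (path om) t')].
Proof.
move=> mA; have := stat (fun i : 'I_p.+1 => t' - (i : nat)%:Z) (t - t') mA.
rewrite /window => <-; congr (P _); apply/seteqP; split=> om /=;
  congr A; apply/eq_from_tnth => i; rewrite !tnth_mktuple; congr (X _ om); lia.
Qed.

Lemma stationary_expectation (t t' : int) (g : p.+1.-tuple R -> R) :
  measurable_fun setT g -> (forall v, 0 <= g v) ->
  ('E_P[fun om => g (window p (path om) t)] =
   'E_P[fun om => g (window p (path om) t')])%E.
Proof.
move=> mg g0.
pose W s : {mfun T >-> p.+1.-tuple R} :=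
  HB.pack (fun om => window p (path om) s)
    (isMeasurableFun.Build _ _ _ _ _ (measurable_window s)).
have E s : ('E_P[fun om => g (window p (path om) s)] =
            \int[distribution P (W s)]_v (g v)%:E)%E.
  by rewrite unlock ge0_integral_distribution//; exact/measurable_EFinP.
rewrite !E; apply: eq_measure_integral => A mA _.
exact: (stationary_window t t' mA).
Qed.

End Stationarity.

Section Tightness.
Context {R : realType} {d : measure_display} {T : measurableType d}.
Variable P : probability T R.

Lemma tail_small (f : T -> R) (kap : R) : measurable_fun setT f -> 0 < kap ->
  exists2 B : R, 0 < B & (P [set om | (B < f om)%R] <= kap%:E)%E.
Proof.
move=> mf k0.
pose F : {mfun T >-> R} := HB.pack f (isMeasurableFun.Build _ _ _ _ f mf).
have := cvg_ccdfy0 (F : {RV P >-> R}) => /fine_cvgP[fin].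
move/cvgrPdist_le => /(_ _ k0) H.
have : \forall B \near +oo%R, (0 < B)%R /\ (P [set om | (B < f om)%R] <= kap%:E)%E.
  near=> B; split; first by near: B; exact: nbhs_pinfty_gt.
  have hf : ccdf (F : {RV P >-> R}) B \is a fin_num by near: B.
  have : `|0 - fine (ccdf (F : {RV P >-> R}) B)| <= kap by near: B.
  rewrite sub0r normrN => /(le_trans (ler_norm _)); rewrite -lee_fin fineK//.
  by apply: le_trans; rewrite /ccdf /distribution /pushforward/= set_itvE.
by move=> /filter_ex[B [B0 HB]]; exists B.
Unshelve. all: by end_near. Qed.

Lemma stationary_tight (X : int -> {RV P >-> R}) (p : nat)
    (g : p.+1.-tuple R -> R) (kap : R) :
  stationary X -> measurable_fun setT g -> 0 < kap ->
  exists2 B : R, 0 < B &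
    forall t, (P [set om | (B < g (window p (fun s => X s om) t))%R] <= kap%:E)%E.
Proof.
move=> stat mg k0.
have [B B0 HB] := tail_small (measurable_window_comp X 0 mg) k0.
exists B => // t; apply: le_trans HB.
rewrite (stationary_window stat t 0 (A := [set v | B < g v]))//.
by apply: measurable_lt_set => //; exact: measurable_cst.
Qed.

End Tightness.

(** * The recursion started from zero *)

Section Approximants.
Context {R : realType}.

Definition lags_of (p : nat) (L : seq R) : 'rV[R]_p := \row_(i < p) L`_i.

(** The last [k] values, most recent first, of the recursion started after time [s]
from zero initial values: reading the list beyond its end returns 0, which
supplies the initial values. *)
Fixpoint traj (m : model) (p : nat) (th : 'rV[R]_(pdim m p)) (ep : int -> R)
    (s : int) (k : nat) : seq R :=
  if k is k'.+1 then
    let L := traj th ep s k' in G (lags_of p L) th (ep (s + k%:Z)) :: L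
  else [::].

Lemma nth_traj (m : model) (p : nat) (th : 'rV[R]_(pdim m p)) ep s k i :
  (traj th ep s k)`_i = (traj th ep s (k - i))`_0.
Proof.
elim: k i => [|k IH] [|i]; rewrite ?sub0n ?subn0 ?nth_nil//.
by rewrite subSS -IH.
Qed.

(** The difference of the two solutions satisfies the homogeneous recursion, with the
lags of [x] at time [s] as initial values. *)
Lemma ar_traj_close (p : nat) (th : 'rV[R]_p) : Theta AR p th ->
  exists r C : R, [/\ 0 < r < 1, 0 <= C & forall (x ep : int -> R),
    (forall t, x t = G (m := AR) (lags p x t) th (ep t)) ->
    forall (s : int) (k i : nat), (i < p)%N ->
    `|x (s + k%:Z - i%:Z) - (traj (m := AR) th ep s k)`_i| <=
      C * r ^+ (k - p) * \sum_(j < p) `|x (s - (j : nat)%:Z)| ].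
Proof.
move=> /ar_stable[r [c [/andP[r0 r1] c0 H]]].
pose A := 1 + \sum_(i < p) `|th 0 i|.
have A0 : 0 <= A by rewrite addr_ge0// sumr_ge0.
exists r, (c * (p%:R * A)); split; first by rewrite r0.
  by rewrite !mulr_ge0.
move=> x ep xE s k i ip.
pose y j := (traj (m := AR) th ep s j)`_0.
(* The difference is indexed from the oldest lag on, so that index p is time
   s + 1; the truncated subtraction makes y vanish before that. *)
pose u n := x (s + n%:Z + 1 - p%:Z) - y (n.+1 - p)%N.
pose M0 := \sum_(j < p) `|x (s - (j : nat)%:Z)|.
have M00 : 0 <= M0 by rewrite sumr_ge0.
have u_init n : (n < p)%N -> `|u n| <= M0.
  move=> np; rewrite /u /y (eqP (_ : (n.+1 - p == 0)%N)) ?subn_eq0//= subr0.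
  have hj : (p.-1 - n < p)%N by lia.
  rewrite /M0 (bigD1 (Ordinal hj))//=.
  rewrite (_ : s + _ + 1 - _ = s - (p.-1 - n)%N%:Z); last by lia.
  by rewrite lerDl sumr_ge0.
have v_init n : (n < p)%N ->
    `|u n - \sum_(i < p | (i < n)%N) th 0 i * u (n - i.+1)%N| <= A * M0.
  move=> np; apply: le_trans (ler_normB _ _) _.
  rewrite mulrDl mul1r lerD ?u_init//.
  rewrite big_mkcond /=; apply: le_trans (ler_norm_sum _ _ _) _.
  rewrite mulr_suml; apply: ler_sum => j _; case: ifP => jn.
    by rewrite normrM ler_wpM2l// u_init//; lia.
  by rewrite normr0 mulr_ge0.
have v_rec n : (p <= n)%N ->
    u n - \sum_(i < p | (i < n)%N) th 0 i * u (n - i.+1)%N = 0.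
  move=> pn; rewrite /u xE /= /ar_mean.
  have -> : (n.+1 - p)%N = (n - p).+1 by lia.
  rewrite /y /= /ar_mean.
  have -> : s + n%:Z + 1 - p%:Z = s + (n - p).+1%:Z by lia.
  rewrite opprD addrACA subrr addr0 -sumrB.
  apply/eqP; rewrite subr_eq0; apply/eqP.
  rewrite [RHS]big_mkcond /=; apply: eq_bigr => j _.
  have jp := ltn_ord j; have -> : (j < n)%N by lia.
  rewrite !mxE -mulrBr; congr (_ * (x _ - _)); first by lia.
  by rewrite nth_traj; congr (traj _ _ _ _)`_0; lia.
have -> : x (s + k%:Z - i%:Z) - (traj (m := AR) th ep s k)`_i = u (p.-1 + k - i)%N.
  by rewrite /u nth_traj; congr (x _ - y _); lia.
apply: le_trans (H u _) _.
rewrite -!mulrA ler_wpM2l//.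
apply: (@le_trans _ _ (\sum_(l < (p.-1 + k - i).+1) if (l < p)%N then r ^+ (k - p) * (A * M0) else 0)).
  apply: ler_sum => l _; case: ltnP => lp; last first.
    by rewrite v_rec// normr0 mulr0.
  apply: ler_pM => //; first by rewrite exprn_ge0 ?ltW.
    by rewrite ler_wiXn2l ?ltW//; lia.
  exact: v_init.
rewrite -big_mkcond /= sumr_const -[leLHS]mulr_natl.
have -> : r ^+ (k - p) * (A * M0) = A * (r ^+ (k - p) * M0) by ring.
rewrite ler_wpM2r ?ler_nat//.
  by rewrite mulr_ge0// mulr_ge0// exprn_ge0 ?ltW.
rewrite -[leqRHS]card_ord.
pose g (l : 'I_(p.-1 + k - i).+1) : 'I_p := insubd (Ordinal ip) (val l).
rewrite -(card_in_image (f := g)); first exact: max_card.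
move=> a b ap bp /(congr1 val).
have {}ap : (a < p)%N := ap; have {}bp : (b < p)%N := bp.
by rewrite /g !val_insubd ap bp => /val_inj.
Qed.

End Approximants.

(** * Pathwise bounds for the ARCH recursion *)

Section ArchApproximation.
Context {R : realType}.

Lemma arch_vol_sqr (p : nat) (th : 'rV[R]_p.+1) (z : 'rV[R]_p) :
  param_domain ARCH p th ->
  arch_vol th z ^+ 2 = th 0 ord0 + \sum_(i < p) th 0 (lift ord0 i) * z 0 i ^+ 2.
Proof.
move=> [th0 thi]; rewrite sqr_sqrtr// addr_ge0 ?(ltW th0)//.
by rewrite sumr_ge0// => i _; rewrite mulr_ge0 ?sqr_ge0 ?thi.
Qed.

Lemma Theta_domain (m : model) (p : nat) : @Theta R m p `<=` @param_domain R m p.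
Proof. by case: m => //= th []. Qed.

Lemma arch_vol_gt0 (p : nat) (th : 'rV[R]_p.+1) (z : 'rV[R]_p) :
  param_domain ARCH p th -> 0 < arch_vol th z.
Proof.
move=> [th0 thi]; rewrite sqrtr_gt0 ltr_pwDl// sumr_ge0// => i _.
by rewrite mulr_ge0 ?sqr_ge0 ?thi.
Qed.

(** The weights that propagate an initial error of size 1 through the squared ARCH
recursion; the default value 1 of the list is that initial error. *)
Fixpoint wlist (p : nat) (th : 'rV[R]_p.+1) (ep : int -> R) (s : int) (k : nat)
    : seq R :=
  if k is k'.+1 then
    let L := wlist th ep s k' in
    ep (s + k%:Z) ^+ 2 * (\sum_(i < p) th 0 (lift ord0 i) * nth 1 L i) :: L
  else [::].

Lemma wlist_ge0 (p : nat) (th : 'rV[R]_p.+1) ep s k i :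
  param_domain ARCH p th -> 0 <= nth 1 (wlist th ep s k) i.
Proof.
move=> [_ thi]; elim: k i => [|k IH] [|i] //=.
by rewrite mulr_ge0 ?sqr_ge0// sumr_ge0// => j _; rewrite mulr_ge0 ?thi ?IH.
Qed.

(** Squares turn the ARCH recursion into an affine one with nonnegative random
coefficients, so the error is at most its initial size times the weights. *)
Lemma arch_traj_close (p : nat) (th : 'rV[R]_p.+1) (x ep : int -> R) :
  param_domain ARCH p th ->
  (forall t, x t = G (m := ARCH) (lags p x t) th (ep t)) ->
  forall (s : int) (k i : nat), (i < k + p)%N ->
  `|x (s + k%:Z - i%:Z) ^+ 2 - (traj (m := ARCH) th ep s k)`_i ^+ 2| <=
    (\sum_(j < p) x (s - (j : nat)%:Z) ^+ 2) * nth 1 (wlist th ep s k) i.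
Proof.
move=> dth xE s; elim=> [|k IH] i ik.
  rewrite add0n in ik.
  rewrite /= !nth_nil mulr1 expr0n /= subr0 addr0 (bigD1 (Ordinal ik))//=.
  rewrite ger0_norm ?sqr_ge0// lerDl sumr_ge0// => j _; exact: sqr_ge0.
case: i ik => [|i] ik /=; last first.
  by rewrite lag_shift; exact: IH.
rewrite subr0 xE /= !exprMn !arch_vol_sqr// -mulrBl opprD addrACA subrr add0r normrM.
rewrite [`|_ ^+ 2|]ger0_norm ?sqr_ge0// mulrC mulrCA ler_wpM2l ?sqr_ge0//.
rewrite -sumrB; apply: le_trans (ler_norm_sum _ _ _) _.
rewrite mulr_sumr; apply: ler_sum => i _.
rewrite -mulrBr normrM ger0_norm; last by case: dth => _ ->.
rewrite [leRHS]mulrCA ler_wpM2l//; first by case: dth => _ ->.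
by rewrite !mxE lag_shift; apply: IH; exact: ltn_addl.
Qed.

(** The ratio of squared volatilities is a quotient of affine functions of the
squared lags with denominator bounded below; |a - b|^2 <= |a^2 - b^2| for
nonnegative a, b passes to the ratio itself.  The bound is asymmetric in
[z] and [z'] because only the lags of the stationary process are tight. *)
Lemma vol_ratio_close (p : nat) (th thb : 'rV[R]_p.+1) :
  Theta ARCH p th -> Theta ARCH p thb ->
  exists2 C : R, 0 < C & forall z z' : 'rV[R]_p,
   `|arch_vol th z / arch_vol thb z - arch_vol th z' / arch_vol thb z'| ^+ 2 <=
   C * (1 + \sum_(i < p) z 0 i ^+ 2) *
     \sum_(i < p) `|z 0 i ^+ 2 - z' 0 i ^+ 2|.
Proof.
move=> Hth Hthb; have dth := Theta_domain Hth; have dthb := Theta_domain Hthb.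
have sum1 (q : 'rV[R]_p.+1) (i : 'I_p) : Theta ARCH p q -> q 0 (lift ord0 i) <= 1.
  move=> [_ qi q1]; apply: le_trans (ltW q1); rewrite (bigD1 i)//= lerDl.
  by rewrite sumr_ge0// => j _; exact: qi.
set t0 := th 0 ord0; set b0 := thb 0 ord0.
have t00 : 0 < t0 by case: Hth.
have b00 : 0 < b0 by case: Hthb.
exists (b0^-1 + (t0 + 1) / b0 ^+ 2).
  by rewrite addr_gt0 ?invr_gt0// divr_gt0 ?exprn_gt0// addr_gt0.
move=> z z'.
set D := \sum_(i < p) `|_|.
have D0 : 0 <= D by rewrite sumr_ge0.
set S := \sum_(i < p) z 0 i ^+ 2.
have S0 : 0 <= S by rewrite sumr_ge0// => i _; exact: sqr_ge0.
have sqdiff (a b : R) : 0 <= a -> 0 <= b -> `|a - b| ^+ 2 <= `|a ^+ 2 - b ^+ 2|.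
  move=> a0 b0'; rewrite subr_sqr normrM expr2 ler_wpM2l//.
  by rewrite ler_norml; apply/andP; split; have := ler_norm (a + b); lra.
apply: le_trans (sqdiff _ _ _ _) _.
- by rewrite divr_ge0 ?sqrtr_ge0.
- by rewrite divr_ge0 ?sqrtr_ge0.
rewrite !expr_div_n !arch_vol_sqr//.
have close (q : 'rV[R]_p.+1) : Theta ARCH p q ->
    `|(q 0 ord0 + \sum_(i < p) q 0 (lift ord0 i) * z 0 i ^+ 2) -
      (q 0 ord0 + \sum_(i < p) q 0 (lift ord0 i) * z' 0 i ^+ 2)| <= D.
  move=> Hq; rewrite opprD addrACA subrr add0r -sumrB; apply: le_trans (ler_norm_sum _ _ _) _.
  apply: ler_sum => i _; rewrite -mulrBr normrM ler_piMl//.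
  rewrite ger0_norm ?sum1//; by case: Hq.
have := close _ Hth; have := close _ Hthb.
have lowb (u : 'rV[R]_p) : b0 <= thb 0 ord0 + \sum_(i < p) thb 0 (lift ord0 i) * u 0 i ^+ 2.
  rewrite lerDl sumr_ge0// => i _; rewrite mulr_ge0 ?sqr_ge0//; by case: Hthb.
have := lowb z; have := lowb z'.
have upN : 0 <= th 0 ord0 + \sum_(i < p) th 0 (lift ord0 i) * z 0 i ^+ 2
     <= (t0 + 1) * (1 + S).
  apply/andP; split.
    rewrite addr_ge0 ?(ltW t00)// sumr_ge0// => i _; rewrite mulr_ge0 ?sqr_ge0//.
    by case: Hth.
  have : \sum_(i < p) th 0 (lift ord0 i) * z 0 i ^+ 2 <= S.
    apply: ler_sum => i _; by rewrite ler_piMl ?sqr_ge0// sum1.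
  have : 0 <= t0 * S by rewrite mulr_ge0// ltW.
  rewrite -/t0; move: (\sum_(i < p) th _ _ * _) => ?; lra.
move: upN; rewrite -/t0 -/b0.
set N := t0 + \sum_(i < p) _ * z 0 i ^+ 2.
set N' := t0 + \sum_(i < p) _ * z' 0 i ^+ 2.
set B := b0 + \sum_(i < p) _ * z 0 i ^+ 2.
set B' := b0 + \sum_(i < p) _ * z' 0 i ^+ 2.
move=> /andP[N0 NS] bB' bB BB NN.
have B0 : 0 < B by apply: lt_le_trans bB.
have B'0 : 0 < B' by apply: lt_le_trans bB'.
have -> : N / B - N' / B' = (N - N') / B' + N * (B' - B) / (B * B').
  by field; rewrite !gt_eqF.
apply: le_trans (ler_normD _ _) _.
have h1 : `|(N - N') / B'| <= b0^-1 * (1 + S) * D.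
  rewrite normrM [`|B'^-1|]ger0_norm ?invr_ge0 ?(ltW B'0)// mulrC -mulrA.
  apply: ler_pM => //; first by rewrite invr_ge0 ltW.
    by rewrite lef_pV2 ?posrE.
  by apply: le_trans NN _; rewrite ler_peMl// lerDl.
have h2 : `|N * (B' - B) / (B * B')| <= (t0 + 1) / b0 ^+ 2 * (1 + S) * D.
  rewrite !normrM (ger0_norm N0) [`|(B * B')^-1|]ger0_norm; last first.
    by rewrite invr_ge0 mulr_ge0 ?ltW.
  rewrite (_ : (t0 + 1) / b0 ^+ 2 * (1 + S) * D = (t0 + 1) * (1 + S) * D / b0 ^+ 2); last by ring.
  apply: ler_pM => //; rewrite ?mulr_ge0 ?invr_ge0 ?mulr_ge0 ?(ltW B0) ?(ltW B'0)//.
    by apply: ler_pM => //; rewrite distrC.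
  rewrite lef_pV2 ?posrE ?exprn_gt0 ?mulr_gt0//.
  by rewrite expr2; apply: ler_pM => //; rewrite ltW.
by apply: le_trans (lerD h1 h2) _; rewrite -!mulrDl.
Qed.

Lemma bernoulli_le (x : R) (n : nat) : 0 <= x <= 1 -> 1 - n%:R * x <= (1 - x) ^+ n.
Proof.
move=> /andP[x0 x1]; elim: n => [|n IH]; first by rewrite mul0r subr0 expr0.
rewrite exprS; have h : (1 - x) * (1 - n%:R * x) <= (1 - x) * (1 - x) ^+ n.
  by rewrite ler_wpM2l// subr_ge0.
apply: le_trans h; rewrite -natr1.
have : 0 <= n%:R * x * x by rewrite !mulr_ge0.
by move: (n%:R) => y; lra.
Qed.

Lemma geometric_small (r K eta : R) : 0 < r < 1 -> 0 <= K -> 0 < eta ->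
  exists k0 : nat, forall k, (k0 <= k)%N -> K * r ^+ k <= eta.
Proof.
move=> /andP[r0 r1] K0 e0.
have h : `|r| < 1 by rewrite ger0_norm// ltW.
have eK : 0 < eta / (K + 1) by rewrite divr_gt0// ltr_wpDl.
have := cvg_expr h => /cvgrPdist_le /(_ _ eK) [k0 _ Hk].
exists k0 => k /Hk /=; rewrite sub0r normrN ger0_norm ?exprn_ge0 ?(ltW r0)//.
rewrite ler_pdivlMr ?ltr_wpDl// => h2; apply: le_trans h2.
by rewrite mulrC ler_wpM2l ?exprn_ge0 ?(ltW r0)// lerDl.
Qed.

End ArchApproximation.

(** * Adaptedness of the approximations *)

Section AlmostEverywhere.
Context {R : realType} {d : measure_display} {T : measurableType d}.
Variable P : probability T R.

Lemma probability_le_ae (A B : set T) : measurable A -> measurable B ->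
  {ae P, forall x, A x -> B x} -> (P A <= P B)%E.
Proof.
move=> mA mB AB; rewrite -!(expectation_indic P)//; apply: expectation_le => //.
apply: filterS AB => x AB; rewrite !indicE ler_nat.
have [/set_mem /AB Bx|//] := boolP (x \in A).
by rewrite mem_set.
Qed.

Lemma ae_forall_int (Q : int -> T -> Prop) :
  (forall t, {ae P, forall om, Q t om}) -> {ae P, forall om, forall t, Q t om}.
Proof.
move=> H.
have H1 : {ae P, forall om, forall n : nat, Q n%:Z om} by exact: ae_foralln.
have H2 : {ae P, forall om, forall n : nat, Q (- n%:Z) om} by exact: ae_foralln.
apply: filterS2 H1 H2 => om h1 h2 t.
have [t0|t0] := leP 0 t; first by have := h1 `|t|%N; rewrite gez0_abs.
by have := h2 `|t|%N; rewrite ltz0_abs// opprK.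
Qed.

End AlmostEverywhere.

Section CausalApproximation.
Context {R : realType} {d : measure_display} {T : measurableType d}.
Variables (P : probability T R) (X eps : int -> {RV P >-> R}) (p : nat).
Local Notation path om := (fun t : int => X t om).
Local Notation noise om := (fun t : int => eps t om).

Definition past (s : int) (k : nat) : set int :=
  [set j | (s < j)%R /\ (j <= s + k%:Z)%R].

Lemma adapted_traj (m : model) (th : 'rV[R]_(pdim m p)) (s : int) (k i : nat) :
  adapted eps (past s k) (fun om => (traj th (noise om) s k)`_i).
Proof.
elim: k i => [|k IH] i.
  rewrite (_ : (fun om => _) = cst 0); first exact: measurable_cst.
  by apply/funext => om /=; rewrite nth_nil.
have IH' j : adapted eps (past s k.+1) (fun om => (traj th (noise om) s k)`_j).
  by apply: adapted_sub (IH j) => l [sl lk]; split => //; lia.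
case: i => [|i] //=.
apply: measurable_G; last by apply: adapted_eps; split; lia.
move=> j; rewrite [X in measurable_fun _ X](_ : _ =
    fun om => (traj th (noise om) s k)`_j); first exact: IH'.
by apply/funext => om; rewrite mxE.
Qed.

Lemma adapted_lags_traj (m : model) (th : 'rV[R]_(pdim m p)) (s : int) (k : nat)
    (i : 'I_p) :
  adapted eps (past s k) (fun om => lags_of p (traj th (noise om) s k) 0 i).
Proof.
rewrite (_ : (fun om => _) = fun om => (traj th (noise om) s k)`_i).
  exact: adapted_traj.
by apply/funext => om; rewrite mxE.
Qed.

Lemma adapted_wlist (th : 'rV[R]_p.+1) (s : int) (k i : nat) :
  adapted eps (past s k) (fun om => nth 1 (wlist th (noise om) s k) i).
Proof.
elim: k i => [|k IH] i.
  rewrite (_ : (fun om => _) = cst 1); first exact: measurable_cst.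
  by apply/funext => om /=; rewrite nth_nil.
have IH' j : adapted eps (past s k.+1) (fun om => nth 1 (wlist th (noise om) s k) j).
  by apply: adapted_sub (IH j) => l [sl lk]; split => //; lia.
case: i => [|i] //=.
apply: measurable_funM.
  by apply: measurable_funX; apply: adapted_eps; split; lia.
apply: measurable_sum => j; apply: measurable_funM; last exact: IH'.
exact: measurable_cst.
Qed.

(** The residual at time s + k + 1 when the observed lags are replaced by those of
the recursion started from zero after time [s]. *)
Definition resid_approx (m : model) (th thb : 'rV[R]_(pdim m p)) (s : int)
    (k : nat) (om : T) : R :=
  let L := lags_of p (traj th (noise om) s k) in
  w L (G L th (eps (s + k.+1%:Z) om)) thb.

Lemma adapted_resid_approx (m : model) (th thb : 'rV[R]_(pdim m p)) s k :
  adapted eps (past s k.+1) (resid_approx th thb s k).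
Proof.
have H i : adapted eps (past s k.+1)
    (fun om => lags_of p (traj th (noise om) s k) 0 i).
  refine (adapted_sub _ (@adapted_lags_traj m th s k i)).
  by move=> l [sl lk]; split=> //; lia.
apply: measurable_w => //; apply: measurable_G => //.
by apply: adapted_eps; split; lia.
Qed.

Lemma measurable_resid (m : model) (thb : 'rV[R]_(pdim m p)) (t : int) :
  measurable_fun setT (fun om => resid thb (path om) t).
Proof.
apply: measurable_w; last exact: measurable_funPT.
move=> i; rewrite [Y in measurable_fun _ Y](_ : _ = (X (t - i.+1%:Z) : T -> R)).
  exact: measurable_funPT.
by apply/funext => om; rewrite mxE.
Qed.

Hypothesis stat : stationary X.

(** Tightness, uniform in time by stationarity, of the initial values. *)
Lemma lags_sum_tight (f : R -> R) (kap : R) : measurable_fun setT f -> 0 < kap ->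
  exists2 B : R, 0 < B & forall s, (P [set om |
    (B < \sum_(j < p) f (X (s - (j : nat)%:Z) om))%R] <= kap%:E)%E.
Proof.
move=> mf k0.
pose g (v : p.+1.-tuple R) := \sum_(j < p) f (tnth v (widen_ord (leqnSn p) j)).
have mg : measurable_fun setT g.
  apply: measurable_sum => j; apply: measurableT_comp => //.
  exact: measurable_tnth.
have [B B0 HB] := stationary_tight stat mg k0.
exists B => // s; have := HB s; rewrite /g.
by under eq_set => om do under eq_bigr => j _ do rewrite tnth_mktuple.
Qed.

End CausalApproximation.

(** * Causality of AR residuals *)

Lemma ar_resid_diff (R : realType) (p : nat) (th thb z z' : 'rV[R]_p) (e : R) :
  (ar_mean th z + e - ar_mean thb z) - (ar_mean th z' + e - ar_mean thb z') =
  \sum_(i < p) (th 0 i - thb 0 i) * (z 0 i - z' 0 i).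
Proof.
have E (u : 'rV[R]_p) : ar_mean th u - ar_mean thb u =
    \sum_(i < p) (th 0 i - thb 0 i) * u 0 i.
  by rewrite -sumrB; apply: eq_bigr => i _; rewrite mulrBl.
under [RHS]eq_bigr => i _ do rewrite mulrBr.
by rewrite sumrB -!E; ring.
Qed.

Section ResidualApproximation.
Context {R : realType} {d : measure_display} {T : measurableType d}.
Variables (P : probability T R) (X eps : int -> {RV P >-> R}) (p : nat).
Local Notation path om := (fun t : int => X t om).
Local Notation noise om := (fun t : int => eps t om).

Lemma model_recursion (m : model) (th : 'rV[R]_(pdim m p)) :
  model_condition X eps th ->
  {ae P, forall om, forall t, X t om = G (lags p (path om) t) th (eps t om)}.
Proof. by case=> _ _ _ _ H; exact: ae_forall_int. Qed.

(** Causality, in the form used below: uniformly in time, the residual is close in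
probability to a function of the last [k] + 1 innovations. *)
Definition approximable (m : model) (th thb : 'rV[R]_(pdim m p)) : Prop :=
  forall eta kap : R, 0 < eta -> 0 < kap -> exists k0 : nat,
  forall k, (k0 <= k)%N -> forall s : int,
  (P [set om | (eta < `|resid thb (path om) (s + k.+1%:Z) -
                        resid_approx eps th thb s k om|)%R] <= kap%:E)%E.

Lemma measurable_resid_diff (m : model) (th thb : 'rV[R]_(pdim m p)) s k t :
  measurable_fun setT (fun om => `|resid thb (path om) t -
                        resid_approx eps th thb s k om|).
Proof.
apply: measurableT_comp => //; apply: measurable_funB.
  exact: measurable_resid.
exact: adapted_measurable (@adapted_resid_approx _ _ _ P eps p m th thb s k).
Qed.

Lemma measurable_lags_sum (f : R -> R) (s : int) : measurable_fun setT f ->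
  measurable_fun setT (fun om => \sum_(j < p) f (X (s - (j : nat)%:Z) om)).
Proof. by move=> mf; apply: measurable_sum => j; apply: measurableT_comp. Qed.

(** The error is a deterministic geometric factor times a tight initial value. *)
Lemma ar_approximable (th thb : 'rV[R]_p) :
  model_condition (m := AR) X eps th -> approximable (m := AR) th thb.
Proof.
move=> hX; have [stat _ _ Hth _] := hX.
have [r [C [r01 C0 close]]] := ar_traj_close Hth.
move=> eta kap e0 k0.
have mn : measurable_fun setT (@Num.norm R R) by exact: normr_measurable.
have [B B0 HB] := lags_sum_tight p stat mn k0.
pose A := \sum_(i < p) `|th 0 i - thb 0 i|.
have A0 : 0 <= A by rewrite sumr_ge0.
have [K0 HK] := geometric_small (K := A * C * B) r01
  (mulr_ge0 (mulr_ge0 A0 C0) (ltW B0)) e0.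
exists (K0 + p)%N => k kK s; apply: le_trans (HB s).
apply: probability_le_ae.
- by apply: measurable_lt_set; [exact: measurable_cst|exact: measurable_resid_diff].
- by apply: measurable_lt_set; [exact: measurable_cst|exact: measurable_lags_sum].
apply: filterS (model_recursion hX) => om xE /=.
move=> h; rewrite ltNge; apply/negP => MB; move: h; apply/negP; rewrite -leNgt.
have := HK (k - p)%N; rewrite leq_subRL; last by lia.
rewrite addnC => /(_ kK); apply: le_trans.
rewrite /resid /resid_approx /= xE /= /ar_mean.
rewrite (_ : _ - _ - _ = \sum_(i < p) (th 0 i - thb 0 i) *
    (X (s + k%:Z - (i : nat)%:Z) om - (traj (m := AR) th (noise om) s k)`_i)).
  apply: le_trans (ler_norm_sum _ _ _) _.
  rewrite -!mulrA mulr_suml; apply: ler_sum => i _; rewrite normrM ler_wpM2l//.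
  apply: le_trans (close _ _ xE s k i (ltn_ord i)) _.
  rewrite -mulrA ler_wpM2l// mulrC ler_wpM2r// exprn_ge0//.
  by case/andP: r01 => /ltW.
rewrite ar_resid_diff; apply: eq_bigr => i _; rewrite !mxE.
by rewrite lag_shift.
Qed.

End ResidualApproximation.

(** * Causality of ARCH residuals *)

Section ArchResidualApproximation.
Context {R : realType} {d : measure_display} {T : measurableType d}.
Variables (P : probability T R) (X eps : int -> {RV P >-> R}) (p : nat).
Local Notation path om := (fun t : int => X t om).
Local Notation noise om := (fun t : int => eps t om).
Variables (th thb : 'rV[R]_p.+1).
Hypotheses (p0 : (0 < p)%N) (hX : model_condition (m := ARCH) X eps th).

Let dth : param_domain ARCH p th.
Proof. by case: hX => _ _ _ /Theta_domain. Qed.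

(** By independence the means of the weights satisfy the recursion with coefficients
theta_i, of sum rho < 1; any r < 1 with r^p >= rho is then a rate. *)
Lemma expectation_wlist : exists2 r : R, 0 < r < 1 & forall s k i,
  ('E_P[fun om => (nth 1 (wlist th (noise om) s k) i)%R] <= (r ^+ k / r ^+ i)%:E)%E.
Proof.
have [_ [indep _] mom [_ thi th1] _] := hX.
set rho := \sum_(i < p) th 0 (lift ord0 i) in th1.
have rho0 : 0 <= rho by rewrite sumr_ge0.
have pR0 : (0 : R) < p%:R by rewrite ltr0n.
(* With this r, Bernoulli inequality gives rho <= r ^+ p. *)
pose r := 1 - (1 - rho) / (p%:R + 1).
have x01 : 0 < (1 - rho) / (p%:R + 1) < 1.
  rewrite divr_gt0 ?subr_gt0 ?addr_gt0//= ltr_pdivrMr ?addr_gt0// mul1r; lra.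
have r01 : 0 < r < 1 by rewrite /r; case/andP: x01 => ? ?; lra.
have /andP[r0 r1] := r01.
have rp : rho <= r ^+ p.
  apply: le_trans (bernoulli_le (x := (1 - rho) / (p%:R + 1)) p _); last first.
    by case/andP: x01 => *; rewrite !ltW.
  have : p%:R * ((1 - rho) / (p%:R + 1)) <= 1 - rho; last by lra.
  rewrite mulrCA ler_piMr ?subr_ge0 ?(ltW th1)//.
  by rewrite ler_pdivrMr ?addr_gt0// mul1r lerDl.
have mw s k i : measurable_fun setT (fun om => nth 1 (wlist th (noise om) s k) i).
  exact: adapted_measurable (@adapted_wlist _ _ _ P eps p th s k i).
exists r => // s k; elim: k => [|k IH] i.
  rewrite (_ : (fun om => _) = cst 1); last by apply/funext => om /=; rewrite nth_nil.
  rewrite expectation_cst lee_fin expr0 div1r -[leLHS]invr1.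
  by rewrite lef_pV2 ?posrE ?exprn_gt0// exprn_ile1 ?ltW.
case: i => [|i] /=; last first.
  by rewrite !exprS -mulf_div divff ?gt_eqF// mul1r; exact: IH.
rewrite (independent_expectation (I := [set s + k.+1%:Z]%R) (J := past s k) indep) //.
- have -> : ('E_P[fun om => (eps (s + k.+1%:Z) om ^+ 2)%R] = 1)%E.
    by case: (mom (s + k.+1%:Z)).
  rewrite mul1e ge0_expectation_sum; last 2 first.
  + by move=> j; apply: measurable_funM => //; exact: measurable_cst.
  + by move=> j om; rewrite mulr_ge0 ?thi ?wlist_ge0.
  apply: (@le_trans _ _ (\sum_(j < p) (th 0 (lift ord0 j) * (r ^+ k / r ^+ p.-1))%:E)%E).
    apply: lee_sum => j _.
    rewrite ge0_expectationZl//; last by move=> om; exact: wlist_ge0.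
    rewrite EFinM lee_wpmul2l ?lee_fin ?thi//; apply: le_trans (IH j) _.
    rewrite lee_fin ler_wpM2l ?exprn_ge0 ?(ltW r0)//.
    rewrite lef_pV2 ?posrE ?exprn_gt0// ler_wiXn2l ?ltW//.
    by rewrite -ltnS (prednK p0).
  rewrite sumEFin lee_fin -mulr_suml -/rho expr0 divr1.
  apply: (@le_trans _ _ (r ^+ p * (r ^+ k / r ^+ p.-1))).
    by rewrite ler_wpM2r// divr_ge0 ?exprn_ge0 ?ltW.
  rewrite -{1}(prednK p0) !exprS mulrCA -!mulrA [r ^+ _ * _]mulrCA.
  by rewrite mulfV ?mulr1 ?expf_neq0 ?gt_eqF// mulrC.
- by move=> j -> [_]; lia.
- by apply: measurable_funX; apply: adapted_eps.
- apply: measurable_sum => j; apply: measurable_funM; first exact: measurable_cst.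
  exact: adapted_wlist.
- by move=> om; rewrite sqr_ge0.
- by move=> om; rewrite sumr_ge0// => j _; rewrite mulr_ge0 ?thi ?wlist_ge0.
Qed.

Hypothesis Hthb : Theta ARCH p thb.

Definition vol_ratio (z : 'rV[R]_p) : R := arch_vol th z / arch_vol thb z.

Lemma vol_ratio_ge0 z : 0 <= vol_ratio z.
Proof. by rewrite divr_ge0 ?sqrtr_ge0. Qed.

Lemma measurable_vol_ratio (d' : measure_display) (T' : measurableType d')
    (z : T' -> 'rV[R]_p) : (forall i, measurable_fun setT (fun x => z x 0 i)) ->
  measurable_fun setT (fun x => vol_ratio (z x)).
Proof.
move=> mz; apply: measurable_funM; first exact: measurable_arch_vol.
by apply: measurable_inv; [move=> x; exact: sqrtr_ge0|exact: measurable_arch_vol].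
Qed.

Lemma measurable_lags (t : int) i :
  measurable_fun setT (fun om => lags p (path om) t 0 i).
Proof.
rewrite [Y in measurable_fun _ Y](_ : _ = (X (t - i.+1%:Z) : T -> R)).
  exact: measurable_funPT.
by apply/funext => om; rewrite mxE.
Qed.

Lemma measurable_vol_ratio_diff s k :
  measurable_fun setT (fun om =>
    `|vol_ratio (lags p (path om) (s + k.+1%:Z)) -
      vol_ratio (lags_of p (traj (m := ARCH) th (noise om) s k))|).
Proof.
apply: measurableT_comp => //; apply: measurable_funB.
  by apply: measurable_vol_ratio => i; exact: measurable_lags.
apply: measurable_vol_ratio => i.
exact: (adapted_measurable (@adapted_lags_traj _ _ _ P eps p ARCH th s k i)).
Qed.

(** Two tight factors (the current and the initial lags) multiply a weight that
tends to 0 in mean, hence in probability. *)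
Lemma vol_ratio_approximable (eta kap : R) : 0 < eta -> 0 < kap ->
  exists k0 : nat, forall k, (k0 <= k)%N -> forall s : int,
  (P [set om | (eta < `|vol_ratio (lags p (path om) (s + k.+1%:Z)) -
      vol_ratio (lags_of p (traj (m := ARCH) th (noise om) s k))|)%R] <= kap%:E)%E.
Proof.
move=> e0 k0; have [stat _ _ Hth _] := hX.
have [C C0 close] := vol_ratio_close Hth Hthb.
have kap30 : 0 < kap / 3 by rewrite divr_gt0.
have msq : measurable_fun setT (fun x : R => x ^+ 2) by exact: exprn_measurable.
have [B B0 HB] := lags_sum_tight p stat msq kap30.
have [r r01 Hr] := expectation_wlist.
have /andP[r0 r1] := r01.
pose W k s om := \sum_(i < p) nth 1 (wlist th (noise om) s k) i.
have mW k s : measurable_fun setT (W k s).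
  apply: measurable_sum => i.
  exact: (adapted_measurable (@adapted_wlist _ _ _ P eps p th s k i)).
have W0 k s om : 0 <= W k s om.
  by rewrite sumr_ge0// => i _; exact: wlist_ge0.
have EW k s : ('E_P[W k s] <= (p%:R / r ^+ p * r ^+ k)%:E)%E.
  rewrite ge0_expectation_sum; last 2 first.
  - by move=> i; exact: (adapted_measurable (@adapted_wlist _ _ _ P eps p th s k i)).
  - by move=> i om; exact: wlist_ge0.
  apply: (@le_trans _ _ (\sum_(i < p) (r ^+ k / r ^+ p)%:E)%E).
    apply: lee_sum => i _; apply: le_trans (Hr s k i) _.
    rewrite lee_fin ler_wpM2l ?exprn_ge0 ?(ltW r0)//.
    by rewrite lef_pV2 ?posrE ?exprn_gt0// ler_wiXn2l ?(ltW r0) ?(ltW r1)// ltnW.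
  rewrite sumEFin lee_fin sumr_const card_ord -[leLHS]mulr_natl.
  by rewrite mulrA mulrAC.
pose K := C * (1 + B) * B / eta ^+ 2.
have K0 : 0 < K by rewrite divr_gt0 ?exprn_gt0// !mulr_gt0// addr_gt0.
have [k1 Hk1] := geometric_small (K := K * (p%:R / r ^+ p)) r01
  (mulr_ge0 (ltW K0) (divr_ge0 (ler0n _ _) (exprn_ge0 _ (ltW r0)))) kap30.
exists k1 => k kk s.
have Ki0 : 0 < K^-1 by rewrite invr_gt0.
have mS t : measurable_fun setT
    (fun om => \sum_(j < p) X (t - (j : nat)%:Z) om ^+ 2).
  exact: (measurable_lags_sum X p t msq).
have mc (c : R) : measurable_fun setT (cst c : T -> R) by exact: measurable_cst.
apply: (@le_trans _ _ (P ([set om | (B < \sum_(j < p) X (s + k%:Z - (j : nat)%:Z) om ^+ 2)%R] `|`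
   ([set om | (B < \sum_(j < p) X (s - (j : nat)%:Z) om ^+ 2)%R] `|`
   [set om | (K^-1 < W k s om)%R])))).
  apply: probability_le_ae.
  - by apply: measurable_lt_set => //; exact: measurable_vol_ratio_diff.
  - apply: measurableU; first exact: measurable_lt_set.
    by apply: measurableU; exact: measurable_lt_set.
  apply: filterS (model_recursion hX) => om xE /= h.
  have [S1|] := leP (\sum_(j < p) X (s + k%:Z - (j : nat)%:Z) om ^+ 2) B; last by left.
  have [S2|] := leP (\sum_(j < p) X (s - (j : nat)%:Z) om ^+ 2) B; last by right; left.
  right; right; rewrite ltNge; apply/negP => WK.
  move: h; apply/negP; rewrite -leNgt.
  rewrite -(@ler_pXn2r _ 2%N) ?nnegrE ?(ltW e0)//.
  apply: le_trans (close _ _) _.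
  have lE i : lags p (path om) (s + k.+1%:Z) 0 i = X (s + k%:Z - (i : nat)%:Z) om.
    by rewrite mxE lag_shift.
  have -> : eta ^+ 2 = C * (1 + B) * (B * K^-1).
    rewrite /K; field; rewrite !gt_eqF ?exprn_gt0// ?addr_gt0//.
  apply: ler_pM.
  - rewrite mulr_ge0 ?(ltW C0)// addr_ge0// sumr_ge0// => i _; exact: sqr_ge0.
  - by rewrite sumr_ge0.
  - rewrite ler_wpM2l ?(ltW C0)// lerD2l; apply: le_trans S1.
    by apply: ler_sum => i _; rewrite lE.
  apply: (@le_trans _ _ (\sum_(i < p) (B * nth 1 (wlist th (noise om) s k) i))).
    apply: ler_sum => i _; rewrite lE mxE.
    apply: le_trans (arch_traj_close dth xE s _) _.
      exact: ltn_addl.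
    by rewrite ler_wpM2r ?wlist_ge0.
  by rewrite -mulr_sumr ler_wpM2l// ltW.
apply: le_trans (measureU2 _ _ _) _.
- exact: measurable_lt_set.
- by apply: measurableU; exact: measurable_lt_set.
have -> : kap = kap / 3 + (kap / 3 + kap / 3) by field.
rewrite !EFinD leeD//; first exact: HB.
apply: le_trans (measureU2 _ _ _) _.
- exact: measurable_lt_set.
- exact: measurable_lt_set.
rewrite leeD//; first exact: HB.
rewrite -(@lee_pmul2l _ (K^-1)%:E)// ?lte_fin//.
apply: le_trans (markov_ge0 P Ki0 (mW k s) (W0 k s)) _.
apply: le_trans (EW k s) _; rewrite -EFinM lee_fin.
rewrite ler_pdivlMl//; apply: le_trans (Hk1 k kk).
by rewrite !mulrA.
Qed.

Lemma arch_resid_path om t : X t om = arch_vol th (lags p (path om) t) * eps t om ->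
  resid (m := ARCH) thb (path om) t = eps t om * vol_ratio (lags p (path om) t).
Proof.
by rewrite /resid /= => ->; rewrite /vol_ratio; ring.
Qed.

Lemma arch_approximable : approximable X eps (m := ARCH) th thb.
Proof.
move=> eta kap e0 k0.
have kap20 : 0 < kap / 2 by rewrite divr_gt0.
pose B := Num.sqrt (2 / kap).
have B0 : 0 < B by rewrite sqrtr_gt0 divr_gt0.
have [_ _ mom _ _] := hX.
have eB : 0 < eta / B by rewrite divr_gt0.
have [k1 Hk1] := vol_ratio_approximable eB kap20.
exists k1 => k kk s.
pose t := s + k.+1%:Z.
have mc (c : R) : measurable_fun setT (cst c : T -> R) by exact: measurable_cst.
have me2 : measurable_fun setT (fun om => eps t om ^+ 2) by exact: measurable_funX.
have HB : (P [set om | (2 / kap < eps t om ^+ 2)%R] <= (kap / 2)%:E)%E.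
  have k20 : 0 < 2 / kap by rewrite divr_gt0.
  rewrite -(@lee_pmul2l _ (2 / kap)%:E)// ?lte_fin//.
  apply: le_trans (markov_ge0 P k20 me2 _) _; first by move=> om; exact: sqr_ge0.
  have [_ -> _] := mom t.
  rewrite -EFinM lee_fin (_ : _ * _ = 1)//; field; rewrite gt_eqF//.
apply: (@le_trans _ _ (P ([set om | (2 / kap < eps t om ^+ 2)%R] `|`
   [set om | (eta / B < `|vol_ratio (lags p (path om) t) -
      vol_ratio (lags_of p (traj (m := ARCH) th (noise om) s k))|)%R]))).
  apply: probability_le_ae.
  - by apply: measurable_lt_set => //; exact: measurable_resid_diff.
  - apply: measurableU; first exact: measurable_lt_set.
    by apply: measurable_lt_set => //; exact: measurable_vol_ratio_diff.
  apply: filterS (model_recursion hX) => om xE h /=.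
  have {}h : eta < `|resid (m := ARCH) thb (path om) t -
    resid_approx eps (m := ARCH) th thb s k om| := h.
  have [S1|] := leP (eps t om ^+ 2) (2 / kap); last by left.
  right; rewrite ltNge; apply/negP => VB.
  move: h; apply/negP; rewrite -leNgt.
  rewrite (arch_resid_path (xE t)).
  rewrite /resid_approx /= -/t.
  rewrite [arch_vol th (lags_of _ _) * _]mulrC -mulrA -mulrBr normrM.
  have -> : eta = B * (eta / B) by field; rewrite gt_eqF.
  apply: ler_pM => //.
  rewrite -sqrtr_sqr ler_wsqrtr//.
apply: le_trans (measureU2 _ _ _) _.
- exact: measurable_lt_set.
- by apply: measurable_lt_set => //; exact: measurable_vol_ratio_diff.
rewrite [leRHS](_ : _ = (kap / 2)%:E + (kap / 2)%:E)%E; last first.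
  by rewrite -EFinD -splitr.
by apply: leeD; [exact: HB|exact: (Hk1 k kk s)].
Qed.

End ArchResidualApproximation.

(** * A weak law for finitely dependent events *)

Section WeakLaw.
Context {R : realType} {d : measure_display} {T : measurableType d}.
Variable P : probability T R.

Lemma bounded_Lfun (f : T -> R) (M : R) : measurable_fun setT f ->
  (forall x, `|f x| <= M) -> f \in Lfun P 1%E.
Proof.
move=> mf fM; apply/Lfun1_integrable; apply: measurable_bounded_integrable => //.
  by have := fin_num_measure P _ measurableT; rewrite ge0_fin_numE.
exists M; split; first exact: num_real.
by move=> z Mz x _; apply: le_trans (fM x) (ltW Mz).
Qed.

Definition centered (B : set T) (om : T) : R := \1_B om - fine (P B).

Lemma measurable_centered (B : set T) : measurable B ->
  measurable_fun setT (centered B).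
Proof.
move=> mB; apply: measurable_funB; last exact: measurable_cst.
exact: measurable_indic.
Qed.

Lemma fine_prob_01 (B : set T) : measurable B -> 0 <= fine (P B) <= 1.
Proof.
move=> mB; rewrite fine_ge0//= -lee_fin fineK ?probability_le1//.
exact: fin_num_measure.
Qed.

Lemma indic_01 (B : set T) (om : T) : 0 <= (\1_B om : R) <= 1.
Proof. by rewrite indicE; case: (_ \in _); rewrite /= lexx ler01. Qed.

Lemma normr_centered (B : set T) (om : T) : measurable B -> `|centered B om| <= 1.
Proof.
move=> mB; have := fine_prob_01 mB; have := indic_01 B om; rewrite /centered.
by move=> /andP[? ?] /andP[? ?]; rewrite ler_norml; apply/andP; split; lra.
Qed.

Lemma expectation_centered (A B : set T) : measurable A -> measurable B ->
  P (A `&` B) = (P A * P B)%E ->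
  ('E_P[fun om => (centered A om * centered B om)%R] = 0)%E.
Proof.
move=> mA mB AB.
have L1 (C : set T) : measurable C -> (\1_C : T -> R) \in Lfun P 1%E.
  move=> mC; apply: (@bounded_Lfun _ 1); first exact: measurable_indic.
  by move=> x; have /andP[h1 h2] := indic_01 C x; rewrite ger0_norm.
have E : (\1_A * \1_B)%R = (\1_(A `&` B) : T -> R).
  by apply/funext => x; rewrite indicI.
have := covarianceE (L1 _ mA) (L1 _ mB); rewrite E => /(_ (L1 _ _)).
rewrite !expectation_indic//; last exact: measurableI.
move=> /(_ (measurableI _ _ mA mB)); rewrite AB subee; last first.
  by rewrite fin_numM// fin_num_measure.
rewrite unlock => <-; congr expectation; apply/funext => x /=.
by rewrite !expectation_indic.
Qed.

Lemma card_near (n K s : nat) :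
  (\sum_(1 <= t < n.+1) ((s < t + K) && (t < s + K)) <= 2 * K)%N.
Proof.
rewrite (eq_bigr (fun t => if (s < t + K) && (t < s + K) then 1 else 0)%N); last first.
  by move=> t _; case: (_ && _).
rewrite -big_mkcond sum1_count -size_filter -(size_iota (s.+1 - K) (2 * K)).
apply: uniq_leq_size; first by rewrite filter_uniq// iota_uniq.
by move=> t; rewrite mem_filter !mem_iota => /andP[/andP[h1 h2] _]; lia.
Qed.

Lemma second_moment_avg (K : nat) (B : nat -> set T) (n : nat) :
  (forall t, measurable (B t)) ->
  (forall s t, (s + K <= t)%N -> P (B s `&` B t) = (P (B s) * P (B t))%E) ->
  (0 < n)%N ->
  ('E_P[fun om => ((average n (fun t => centered (B t) om)) ^+ 2)%R] <=
   ((2 * K)%N%:R / n%:R)%:E)%E.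
Proof.
move=> mB indB n0.
have nR : (0 : R) < n%:R by rewrite ltr0n.
pose c s t om := centered (B s) om * centered (B t) om.
have mc s t : measurable_fun setT (c s t).
  by apply: measurable_funM; exact: measurable_centered.
have c1 s t om : `|c s t om| <= 1.
  by rewrite normrM mulr_ile1// normr_centered.
have ic s t : P.-integrable setT (EFin \o c s t).
  exact/Lfun1_integrable/(bounded_Lfun (mc s t) (c1 s t)).
have indB' s t : ~~ ((s < t + K) && (t < s + K))%N ->
    P (B s `&` B t) = (P (B s) * P (B t))%E.
  rewrite negb_and -!leqNgt => /orP[h|h]; last exact: indB.
  by rewrite setIC indB// muleC.
have Ec s t : ('E_P[c s t] <= (((s < t + K) && (t < s + K))%N : nat)%:R%:E)%E.
  have [_|/indB' h] := boolP ((s < t + K) && (t < s + K))%N; last first.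
    by rewrite expectation_centered.
  rewrite -(expectation_cst P 1) unlock; apply: le_integral => //.
  - exact: ic.
  - exact: finite_measure_integrable_cst.
  - by move=> om _; rewrite lee_fin; apply: le_trans (c1 s t om); exact: ler_norm.
have -> : (fun om => ((average n (fun t => centered (B t) om)) ^+ 2)%R) =
    (fun om => n%:R ^- 2 * \sum_(1 <= s < n.+1) \sum_(1 <= t < n.+1) c s t om)%R.
  apply/funext => om; rewrite /average exprMn exprVn; congr (_ * _).
  rewrite expr2 mulr_suml; apply: eq_bigr => s _.
  by rewrite mulr_sumr.
have iS s : P.-integrable setT (fun x => \sum_(1 <= t < n.+1) (c s t x)%:E)%E.
  by apply: integrable_sum => // t _; exact: ic.
have E : ('E_P[fun om => (n%:R ^- 2 * \sum_(1 <= s < n.+1) \sum_(1 <= t < n.+1) c s t om)%R]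
   = (n%:R ^- 2)%:E * \sum_(1 <= s < n.+1) \sum_(1 <= t < n.+1) 'E_P[c s t])%E.
  rewrite unlock.
  under eq_integral => om _.
    rewrite EFinM -sumEFin; under eq_bigr => u _ do rewrite -sumEFin.
    over.
  rewrite integralZl//; last exact: integrable_sum.
  rewrite integral_sum//; congr (_ * _)%E; apply: eq_bigr => s _.
  by rewrite integral_sum// => t; exact: ic.
rewrite E; apply: (@le_trans _ _ ((n%:R ^- 2)%:E *
  \sum_(1 <= s < n.+1) (2 * K)%N%:R%:E)%E).
  rewrite lee_wpmul2l ?lee_fin ?invr_ge0 ?exprn_ge0//.
  apply: lee_sum => s _.
  apply: (@le_trans _ _ (\sum_(1 <= t < n.+1)
    ((((s < t + K) && (t < s + K))%N : nat)%:R%:E))%E).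
    by apply: lee_sum => t _; exact: Ec.
  by rewrite sumEFin lee_fin -natr_sum ler_nat card_near.
rewrite sumEFin -EFinM lee_fin sumr_const_nat subn1 /= -[X in _ * X <= _]mulr_natl.
rewrite (_ : _ * _ = (2 * K)%:R / n%:R)//.
by field; rewrite gt_eqF.
Qed.

(** Weak law for K-dependent events: in the second moment of the average only the
at most 2 K n pairs of near indices contribute. *)
Lemma weak_law (K : nat) (B : nat -> set T) :
  (forall t, measurable (B t)) ->
  (forall s t, (s + K <= t)%N -> P (B s `&` B t) = (P (B s) * P (B t))%E) ->
  small P (fun n om => `|average n (fun t => centered (B t) om)|).
Proof.
move=> mB indB del kap d0 k0.
have dk0 : 0 < del ^+ 2 * kap by rewrite mulr_gt0// exprn_gt0.
have H : \forall n \near \oo, (2 * K)%N%:R / (del ^+ 2 * kap) <= n%:R :> R.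
  exact: nbhs_infty_ger.
near=> n.
have n0 : (0 < n)%N by near: n; exists 1%N.
have nR : (0 : R) < n%:R by rewrite ltr0n.
have mA : measurable_fun setT (fun om => average n (fun t => centered (B t) om)).
  apply: measurable_funM; first exact: measurable_cst.
  by apply: measurable_sum => t; exact: measurable_centered.
have sq (x : R) : (del < `|x|) = (del ^+ 2 < x ^+ 2).
  by rewrite -[x ^+ 2]real_normK ?num_real// ltr_pXn2r ?nnegrE// ltW.
have -> : [set om | del < `|average n (fun t => centered (B t) om)| ] =
    [set om | del ^+ 2 < average n (fun t => centered (B t) om) ^+ 2].
  by apply/seteqP; split=> om /=; rewrite sq.
rewrite measurable_mu_extE; last first.
  by apply: measurable_lt_set; [exact: measurable_cst|exact: measurable_funX].
have d20 : 0 < del ^+ 2 by rewrite exprn_gt0.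
rewrite -(@lee_pmul2l _ (del ^+ 2)%:E)// ?lte_fin//.
apply: le_trans (markov_ge0 P d20 _ _) _.
- exact: measurable_funX.
- by move=> om; exact: sqr_ge0.
apply: le_trans (second_moment_avg mB indB n0) _.
rewrite -EFinM lee_fin ler_pdivrMr// -ler_pdivrMl//.
by rewrite mulrC; near: n.
Unshelve. all: by end_near. Qed.

End WeakLaw.

(** * The empirical distribution function of the residuals *)

Section Averages.
Context {R : realType}.
Implicit Types (n : nat) (u v : nat -> R).

Lemma averageD n u v :
  average n (fun t => u t + v t) = average n u + average n v.
Proof. by rewrite /average big_split /= mulrDr. Qed.

Lemma averageN n u : average n (fun t => - u t) = - average n u.
Proof. by rewrite /average sumrN mulrN. Qed.

Lemma averageZ n (c : R) u : average n (fun t => c * u t) = c * average n u.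
Proof. by rewrite /average -mulr_sumr mulrCA. Qed.

Lemma average_cst n (c : R) : (0 < n)%N -> average n (fun=> c) = c.
Proof.
move=> n0; rewrite /average sumr_const_nat subn1 /= -[c *+ n]mulr_natl mulrA.
by rewrite mulVf ?mul1r// pnatr_eq0 -lt0n.
Qed.

Lemma average_le n u v : (forall t, (1 <= t <= n)%N -> u t <= v t) ->
  average n u <= average n v.
Proof.
move=> uv; rewrite /average ler_wpM2l ?invr_ge0//.
by rewrite big_nat_cond [leRHS]big_nat_cond; apply: ler_sum => t /andP[/uv].
Qed.

Lemma average_ge0 n u : (forall t, 0 <= u t) -> 0 <= average n u.
Proof. by move=> u0; rewrite /average mulr_ge0 ?invr_ge0 ?sumr_ge0. Qed.

Lemma ler_norm_average n u : `|average n u| <= average n (fun t => `|u t|).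
Proof.
by rewrite /average normrM ger0_norm ?invr_ge0// ler_wpM2l ?invr_ge0// ler_norm_sum.
Qed.

End Averages.

Section ExpectationAverage.
Context {R : realType} {d : measure_display} {T : measurableType d}.
Variable P : probability T R.

Lemma measurable_average (n : nat) (f : nat -> T -> R) :
  (forall t, measurable_fun setT (f t)) ->
  measurable_fun setT (fun om => average n (f ^~ om)).
Proof.
move=> mf; apply: measurable_funM; first exact: measurable_cst.
exact: measurable_sum.
Qed.

Lemma expectation_average_le (n : nat) (f : nat -> T -> R) (c : R) :
  (0 < n)%N -> (forall t, measurable_fun setT (f t)) ->
  (forall t om, 0 <= f t om) -> (forall t, ('E_P[f t] <= c%:E)%E) ->
  ('E_P[fun om => average n (f ^~ om)] <= c%:E)%E.
Proof.
move=> n0 mf f0 Ef; rewrite ge0_expectationZl//.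
- rewrite ge0_expectation_sum//.
  apply: (@le_trans _ _ ((n%:R^-1)%:E * \sum_(1 <= t < n.+1) c%:E)%E).
    by rewrite lee_wpmul2l ?lee_fin ?invr_ge0//; apply: lee_sum.
  rewrite sumEFin -EFinM lee_fin.
  by have := average_cst c n0; rewrite /average => ->.
- exact: measurable_sum.
- by move=> om; rewrite sumr_ge0.
Qed.

End ExpectationAverage.

Section BoundedDensity.
Context {R : realType} {d : measure_display} {T : measurableType d}.
Variables (P : probability T R) (e : T -> R).
Hypothesis me : measurable_fun setT e.

Lemma measurable_le_cst (y : R) : measurable [set om | e om <= y].
Proof. by apply: measurable_le_set => //; exact: measurable_cst. Qed.

Lemma bounded_density_lipschitz : has_bounded_density P e ->
  exists2 M : R, 0 < M & forall a b, a <= b ->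
    (P [set om | (a < e om <= b)%R] <= (M * (b - a))%:E)%E.
Proof.
case=> f [mf [M fM] fE].
have M0 : 0 <= M by case/andP: (fM 0); exact: le_trans.
exists (M + 1) => [|a b ab]; first by rewrite ltr_wpDl.
have f0 y : (0 <= (f y)%:E)%E by rewrite lee_fin; case/andP: (fM y).
have mfE D : measurable D -> measurable_fun D (fun y => (f y)%:E).
  by move=> mD; apply/measurable_EFinP; exact: measurable_funS mf.
have mab : measurable [set om | a < e om <= b].
  rewrite [X in measurable X](_ : _ = [set om | a < e om] `&` [set om | e om <= b]).
    apply: measurableI; last exact: measurable_le_cst.
    by apply: measurable_lt_set => //; exact: measurable_cst.
  by apply/seteqP; split=> om /= => [/andP[]|[-> ->]].
have splitE : [set om | e om <= b] = [set om | e om <= a] `|` [set om | a < e om <= b].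
  apply/seteqP; split=> om /=.
    by move=> eb; have [ea|ea] := leP (e om) a; [left|right].
  by case=> [ea|/andP[]//]; exact: le_trans ab.
have disj : [disjoint [set om | e om <= a] & [set om | a < e om <= b]].
  apply/disj_setPS => om /= [ea /andP[ae _]].
  by have := le_lt_trans ea ae; rewrite ltxx.
have PU : (P [set om | (e om <= b)%R] =
    P [set om | (e om <= a)%R] + P [set om | (a < e om <= b)%R])%E.
  rewrite splitE measureU//; first exact: measurable_le_cst.
  by move/disj_set2P: disj.
have itvE : `]-oo, b]%classic = `]-oo, a]%classic `|` `]a, b]%classic.
  by apply: itv_bndbnd_setU; rewrite bnd_simp.
have disj2 : [disjoint `]-oo, a]%classic & `]a, b]%classic].
  apply/disj_setPS => y /=; rewrite !in_itv /= => -[ya /andP[ay _]].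
  by have := le_lt_trans ya ay; rewrite ltxx.
have := fE b; rewrite itvE ge0_integral_setU//; last first.
  by apply: mfE; exact: measurableU.
rewrite -fE PU => h.
have P1f : P [set om | e om <= a] \is a fin_num.
  by apply: fin_num_measure; exact: measurable_le_cst.
have := congr1 (fun z => z - P [set om | (e om <= a)%R])%E h.
rewrite ![(P [set om | (e om <= a)%R] + _)%E]addeC !addeK// => ->.
apply: (@le_trans _ _ (\int[lebesgue_measure]_(x in `]a, b]) (cst M%:E x))%E).
  apply: ge0_le_integral => //; first exact: mfE.
  by move=> x _; rewrite lee_fin; case/andP: (fM x).
rewrite integral_cst//= lebesgue_measure_itv/= lte_fin.
case: ifPn => _; last by rewrite mule0 lee_fin mulr_ge0 ?subr_ge0 ?addr_ge0.
by rewrite -?EFinD -EFinM lee_fin ler_wpM2r ?subr_ge0// lerDl.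
Qed.

End BoundedDensity.

Section EmpiricalDistribution.
Context {R : realType} {d : measure_display} {T : measurableType d}.
Variables (P : probability T R) (X eps : int -> {RV P >-> R}) (p : nat).
Local Notation path om := (fun t : int => X t om).
Variables (m : model) (th thb : 'rV[R]_(pdim m p)).

Definition window_resid (v : p.+1.-tuple R) : R :=
  w (window_lags v) (tnth v ord0) thb.

Lemma measurable_window_resid : measurable_fun setT window_resid.
Proof.
apply: measurable_w; last exact: measurable_tnth.
exact: measurable_window_lags.
Qed.

Lemma resid_window (x : int -> R) (t : int) :
  resid thb x t = window_resid (window p x t).
Proof. by rewrite /resid /window_resid lags_window window_head. Qed.

Hypothesis stat : stationary X.

Lemma resid_stationary (t t' : int) (A : set R) : measurable A ->
  P [set om | A (resid thb (path om) t)] = P [set om | A (resid thb (path om) t')].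
Proof.
move=> mA.
have mB : measurable [set v | A (window_resid v)].
  by have := measurable_window_resid measurableT mA; rewrite setTI.
have := stationary_window stat t t' mB.
by under eq_set => om do rewrite /= -resid_window;
   under [X in _ = _ X]eq_set => om do rewrite /= -resid_window.
Qed.

Hypothesis indep : independent eps.
Hypothesis approx : approximable X eps th thb.
Variable t0 : int.
Hypothesis dens : has_bounded_density P (fun om => resid thb (path om) t0).

Definition resid_cdf (y : R) : R := fine (P [set om | (resid thb (path om) t0 <= y)%R]).

Let me t : measurable_fun setT (fun om => resid thb (path om) t).
Proof. exact: measurable_resid. Qed.

(** The indicators of {e_t <= y} and of the approximate event differ only if the
residuals are far apart or e_t is close to y; the second has small probability
since the density is bounded. *)
Lemma indic_resid_close (y kap : R) : 0 < kap -> exists k : nat, forall t : int,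
  ('E_P[fun om => `|\1_[set om | (resid thb (path om) t <= y)%R] om -
     \1_[set om | (resid_approx eps th thb (t - k.+1%:Z) k om <= y)%R] om|%R] <= kap%:E)%E.
Proof.
move=> k0; have [M M0 HM] := bounded_density_lipschitz (me t0) dens.
have kap20 : 0 < kap / 2 by rewrite divr_gt0.
(* An interval of length 2 eta around y then has probability at most kap / 2. *)
pose eta := kap / (4 * M).
have eta0 : 0 < eta by rewrite divr_gt0// mulr_gt0.
have [k Hk] := approx eta0 kap20.
exists k => t; have := Hk k (leqnn k) (t - k.+1%:Z); rewrite subrK => HA.
set a := resid_approx eps th thb (t - k.+1%:Z) k.
have ma : measurable_fun setT a.
  exact: (adapted_measurable (@adapted_resid_approx _ _ _ P eps p m th thb _ k)).
have mc (c : R) : measurable_fun setT (cst c : T -> R) by exact: measurable_cst.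
set A := [set om | (eta < `|resid thb (path om) t - a om|)%R].
set B := [set om | (y - eta < resid thb (path om) t <= y + eta)%R].
have mA : measurable A by apply: measurable_lt_set => //; exact: measurable_resid_diff.
have mitv : measurable [set u : R | y - eta < u <= y + eta].
  by rewrite -[X in measurable X]set_itvE.
have mB : measurable B.
  by have := me t measurableT mitv; rewrite setTI.
have PB : (P B <= (kap / 2)%:E)%E.
  rewrite /B (resid_stationary t t0 mitv); apply: le_trans (HM _ _ _) _; first by lra.
  rewrite lee_fin (_ : _ * _ = kap / 2)// /eta; field; rewrite gt_eqF//.
have m1 : measurable [set om | (resid thb (path om) t <= y)%R].
  exact: measurable_le_cst.
have m2 : measurable [set om | (a om <= y)%R] by exact: measurable_le_cst.
apply: (@le_trans _ _ ('E_P[fun om => (\1_A om + \1_B om)%R])%E).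
  apply: ge0_expectation_le => //.
  - by apply: measurableT_comp => //; apply: measurable_funB; exact: measurable_indic.
  - by apply: measurable_funD; exact: measurable_indic.
  move=> om; rewrite !indicE.
  have [Aom|Aom] := boolP (om \in A).
    case: (om \in B); case: (_ \in _); case: (_ \in _);
      rewrite /= ?subrr ?subr0 ?sub0r ?normrN ?normr1 ?normr0; lra.
  have Aom' : `|resid thb (path om) t - a om| <= eta.
    by rewrite leNgt; apply: contra Aom => h; rewrite mem_set.
  have Bom : ~~ (om \in B) ->
      (om \in [set om | resid thb (path om) t <= y]) = (om \in [set om | a om <= y]).
    move=> nB; have {}nB : ~ (y - eta < resid thb (path om) t <= y + eta).
      by move=> h; move/negP: nB; apply; rewrite mem_set.
    apply/idP/idP => /set_mem /= h; rewrite mem_set//=; move: Aom';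
      rewrite ler_norml => /andP[h1 h2].
      have [h3|h3] := leP (resid thb (path om) t) (y - eta); first by lra.
      by exfalso; apply: nB; apply/andP; split => //; lra.
    have [h3|h3] := leP (resid thb (path om) t) (y - eta); first by lra.
    by exfalso; apply: nB; apply/andP; split => //; lra.
  have [Bom'|/Bom ->] := boolP (om \in B); last by rewrite subrr normr0.
  case: (_ \in _); case: (_ \in _);
      rewrite /= ?subrr ?subr0 ?sub0r ?normrN ?normr1 ?normr0; lra.
rewrite ge0_expectationD//; try exact: measurable_indic.
rewrite !expectation_indic// [leRHS](_ : _ = (kap / 2)%:E + (kap / 2)%:E)%E.
  exact: leeD.
by rewrite -EFinD -splitr.
Qed.

(** Glivenko-Cantelli at one point: up to an error small in mean, the indicators are
those of finitely dependent events. *)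
Lemma ecdf_small (y : R) :
  small P (fun n om => `|emp_cdf n (fun t => resid thb (path om) t%:Z) y - resid_cdf y|).
Proof.
apply: small_dom => kap k0.
have kap30 : 0 < kap / 3 by rewrite divr_gt0.
have [k Hk] := indic_resid_close y kap30.
pose a (t : nat) := resid_approx eps th thb (t%:Z - k.+1%:Z) k.
have ma t : measurable_fun setT (a t).
  exact: (adapted_measurable (@adapted_resid_approx _ _ _ P eps p m th thb _ k)).
pose A (t : nat) := [set om | a t om <= y].
pose B (t : nat) := [set om | resid thb (path om) t%:Z <= y].
have mA t : measurable (A t) by exact: measurable_le_cst.
have mB t : measurable (B t) by exact: measurable_le_cst.
pose V n om := average n (fun t => `|\1_(B t) om - \1_(A t) om : R|).
have mterm t : measurable_fun setT (fun om => `|\1_(B t) om - \1_(A t) om : R|).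
  by apply: measurableT_comp => //; apply: measurable_funB; exact: measurable_indic.
have PB t : P (B t) = (resid_cdf y)%:E.
  rewrite /resid_cdf fineK; last by apply: fin_num_measure; exact: measurable_le_cst.
  have := resid_stationary t%:Z t0 (A := [set u | u <= y]); apply.
  by rewrite -[X in measurable X]set_itvE.
have PAB t : `|fine (P (A t)) - resid_cdf y| <= kap / 3.
  have -> : resid_cdf y = fine (P (B t)) by rewrite PB.
  have HE : ('E_P[fun om => `|\1_(B t) om - \1_(A t) om : R|%R] <= (kap / 3)%:E)%E.
    exact: Hk.
  have le1 (C D : set T) : measurable C -> measurable D ->
      ('E_P[fun om => `|\1_C om - \1_D om : R|%R] <= (kap / 3)%:E)%E ->
      fine (P C) <= fine (P D) + kap / 3.
    move=> mC mD h; rewrite -lee_fin EFinD !fineK ?fin_num_measure//.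
    apply: le_trans (leeD2l _ h); rewrite -!(expectation_indic P)//.
    rewrite -ge0_expectationD//; try exact: measurable_indic.
      apply: ge0_expectation_le => //; try exact: measurable_indic.
        apply: measurable_funD; first exact: measurable_indic.
        apply: measurableT_comp => //.
        by apply: measurable_funB; exact: measurable_indic.
      by move=> om; rewrite -lerBlDl ler_norm.
    apply: measurableT_comp => //.
    by apply: measurable_funB; exact: measurable_indic.
  have h1 := le1 _ _ (mB t) (mA t) HE.
  have h2 : fine (P (A t)) <= fine (P (B t)) + kap / 3.
    by apply: le1 => //; under eq_fun do rewrite distrC.
  by rewrite ler_norml; apply/andP; split; lra.
exists (fun n om => `|average n (fun t => centered P (A t) om)|), V, (kap / 3); split=> //.
- apply: (weak_law (K := k.+1)) => // s t st.
  apply: (independent_sigma indep (I := past (s%:Z - k.+1%:Z) k.+1)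
    (J := past (t%:Z - k.+1%:Z) k.+1)).
  + by move=> i [h1 h2] [h3 h4]; lia.
  + have := @adapted_resid_approx _ _ _ P eps p m th thb (s%:Z - k.+1%:Z) k
      measurableT [set u | u <= y].
    by rewrite setTI; apply; rewrite -[X in measurable X]set_itvE.
  + have := @adapted_resid_approx _ _ _ P eps p m th thb (t%:Z - k.+1%:Z) k
      measurableT [set u | u <= y].
    by rewrite setTI; apply; rewrite -[X in measurable X]set_itvE.
- split=> [n|n om]; last by rewrite average_ge0.
  exact: measurable_average.
- near=> n.
  have n0 : (0 < n)%N by near: n; exists 1%N.
  apply: expectation_average_le => // t; apply: le_trans (Hk t%:Z) _.
  by rewrite lee_fin; lra.
- near=> n => om hU.
  have n0 : (0 < n)%N by near: n; exists 1%N.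
  have -> : emp_cdf n (fun t => resid thb (path om) t%:Z) y - resid_cdf y =
      average n (fun t => \1_(B t) om - \1_(A t) om) +
      average n (fun t => centered P (A t) om) +
      average n (fun t => fine (P (A t)) - resid_cdf y).
    rewrite /centered !averageD !averageN (average_cst (resid_cdf y) n0).
    rewrite (_ : emp_cdf _ _ _ = average n (fun t => \1_(B t) om)); first by ring.
    rewrite /emp_cdf; congr average; apply/funext => t.
    rewrite indicE; congr (nat_of_bool _)%:R.
    by apply/idP/idP; rewrite inE.
  apply: le_trans (ler_normD _ _) _; rewrite addrC.
  have h3 : `|average n (fun t => fine (P (A t)) - resid_cdf y)| <= kap / 3.
    apply: le_trans (ler_norm_average _ _) _.
    rewrite -[leRHS](average_cst _ n0); apply: average_le => t _; exact: PAB.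
  have h4 : `|average n (fun t => \1_(B t) om - \1_(A t) om : R)| <= V n om.
    exact: ler_norm_average.
  have := ler_normD (average n (fun t => \1_(B t) om - \1_(A t) om))
    (average n (fun t => centered P (A t) om)).
  lra.
Unshelve. all: by end_near. Qed.

End EmpiricalDistribution.

(** * Quantile slices *)

Section QuantileCoupling.
Context {R : realType} {d : measure_display} {T : measurableType d}.
Variables (P : probability T R) (e : T -> R).
Hypothesis me : measurable_fun setT e.

Definition distr_fun (y : R) : R := fine (P [set om | (e om <= y)%R]).

Lemma distr_funE y : P [set om | (e om <= y)%R] = (distr_fun y)%:E.
Proof. by rewrite fineK// fin_num_measure//; exact: measurable_le_cst. Qed.

Lemma distr_fun_le a b : a <= b -> distr_fun a <= distr_fun b.
Proof.
move=> ab; rewrite -lee_fin -!distr_funE le_measure ?inE//;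
  try exact: measurable_le_cst.
by move=> om /= /le_trans; apply.
Qed.

Lemma distr_fun_small (kap : R) : 0 < kap -> exists2 B : R, 0 < B &
  distr_fun (- B) <= kap /\ 1 - kap <= distr_fun B.
Proof.
move=> k0.
have [B1 B10 H1] := tail_small P me k0.
have mNe : measurable_fun setT (fun om => - e om) by exact: measurableT_comp.
have [B2 B20 H2] := tail_small P mNe k0.
exists (B1 + B2 + 1); first by rewrite !addr_gt0.
split.
  rewrite -lee_fin -distr_funE; apply: le_trans H2.
  rewrite le_measure ?inE//; first exact: measurable_le_cst.
    by apply: measurable_lt_set => //; exact: measurable_cst.
  by move=> om /=; lra.
have : 1 <= distr_fun (B1 + B2 + 1) + kap; last by lra.
rewrite -lee_fin EFinD -distr_funE; apply: le_trans (leeD2l _ H1).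
rewrite -[leLHS](@probability_setT _ _ _ P).
apply: le_trans (measureU2 _ _ _) => //; last 2 first.
- exact: measurable_le_cst.
- by apply: measurable_lt_set => //; exact: measurable_cst.
rewrite le_measure ?inE//.
  apply: measurableU; first exact: measurable_le_cst.
  by apply: measurable_lt_set => //; exact: measurable_cst.
move=> om _ /=; have [h|h] := leP (e om) (B1 + B2 + 1); [by left|right; lra].
Qed.

(** The index of the slice of e: [k om] = j when e lies between its quantiles of
levels j/n and (j+1)/n.  What matters is that the slices have probability 1/n
and are ordered like the values of e, which is the nesting property. *)
Record quantile_index (n : nat) (k : T -> nat) : Prop := QuantileIndex {
  quantile_index_lt : forall om, (k om < n)%N;
  quantile_index_measurable : forall c, measurable [set om | (k om < c)%N];
  quantile_index_prob : forall c, (c <= n)%N ->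
    P [set om | (k om < c)%N] = (c%:R / n%:R)%:E;
  quantile_index_nested : forall c y,
    [set om | (k om < c)%N] `<=` [set om | (e om <= y)%R] \/
    [set om | (e om <= y)%R] `<=` [set om | (k om < c)%N] }.

Lemma exists_threshold (M u : R) : 0 < M ->
  (forall a b, a <= b -> distr_fun b - distr_fun a <= M * (b - a)) ->
  0 < u < 1 -> exists y, distr_fun y = u.
Proof.
move=> M0 lip /andP[u0 u1].
have [B1 B10 [h1 _]] := distr_fun_small u0.
have u10 : 0 < 1 - u by rewrite subr_gt0.
have [B2 B20 [_ h2]] := distr_fun_small u10.
have ab : - B1 <= B2 by lra.
have Ln (x t : R) : `|distr_fun x - distr_fun t| <= M * `|x - t|.
  have [xt|tx] := leP x t.
    rewrite ler0_norm ?subr_le0 ?distr_fun_le// opprB.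
    by rewrite ler0_norm ?subr_le0// opprB; exact (lip x t xt).
  have {}tx := ltW tx.
  rewrite ger0_norm ?subr_ge0 ?distr_fun_le//.
  by rewrite ger0_norm ?subr_ge0//; exact (lip t x tx).
have cf : {within `[- B1, B2], continuous distr_fun}.
  apply: continuous_subspaceT => x; apply/cvgrPdist_le => eps0 e0.
  near=> t.
  have h : `|x - t| <= eps0 / M.
    near: t; apply: cvgr_dist_le; last by rewrite divr_gt0.
    exact: cvg_id.
  apply: (@le_trans _ _ (M * `|x - t|)); last first.
    by rewrite mulrC -ler_pdivlMr.
  exact: Ln.
have [|c _ <-] := IVT (v := u) ab cf; last by exists c.
rewrite ge_min h1 /= le_max; apply/orP; right; lra.
Unshelve. all: by end_near. Qed.

(** Count the quantiles of levels j/n, 0 < j < n, that lie below e; they exist by the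
intermediate value theorem because F is Lipschitz. *)
Lemma exists_quantile_index (M : R) (n : nat) : 0 < M ->
  (forall a b, a <= b -> distr_fun b - distr_fun a <= M * (b - a)) ->
  (0 < n)%N -> exists k, quantile_index n k.
Proof.
move=> M0 lip n0; have nR : (0 : R) < n%:R by rewrite ltr0n.
have Hy j : exists y, (0 < j < n)%N -> distr_fun y = j%:R / n%:R.
  have [/andP[j0 jn]|] := boolP (0 < j < n)%N; last by exists 0.
  have [|y <-] := exists_threshold (u := j%:R / n%:R) M0 lip; last by exists y.
  by rewrite divr_gt0 ?ltr0n//= ltr_pdivrMr// mul1r ltr_nat.
have [y yE] := choice Hy.
have y_le i j : (0 < i)%N -> (i <= j)%N -> (j < n)%N -> y i <= y j.
  move=> i0; rewrite leq_eqVlt => /predU1P[->//|ij] jn.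
  rewrite leNgt; apply/negP => /ltW /distr_fun_le.
  rewrite !yE; [|lia|lia].
  by rewrite ler_pM2r ?invr_gt0// ler_nat; lia.
pose k om := (\sum_(1 <= j < n) (y j < e om)%R)%N.
have kc c om : (0 < c < n)%N -> (k om < c)%N = (e om <= y c).
  move=> /andP[c0 cn].
  have kE : k om = (\sum_(1 <= j < c) (y j < e om)%R + \sum_(c <= j < n) (y j < e om)%R)%N.
    by rewrite /k (big_cat_nat _ (n := c))//; exact: ltnW.
  have [ec|ce] := leP (e om) (y c).
    rewrite kE [X in (_ + X)%N]big_nat_cond [X in (_ + X)%N]big1 ?addn0.
      apply: (@leq_ltn_trans (\sum_(1 <= j < c) 1)%N).
        by apply: leq_sum => j _; case: (_ < _).
      by rewrite sum_nat_const_nat muln1; lia.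
    move=> j /andP[/andP[cj jn] _]; rewrite ltNge (le_trans ec)//.
    exact: y_le.
  apply/negbTE; rewrite -leqNgt kE big_nat_cond.
  rewrite (eq_bigr (fun=> 1%N)); last first.
    move=> j /andP[/andP[j1 jc] _]; rewrite (le_lt_trans _ ce)//.
    by apply: y_le => //; exact: ltnW.
  rewrite -big_nat_cond sum_nat_const_nat muln1 big_ltn// ce; lia.
have kn om : (k om < n)%N.
  apply: (@leq_ltn_trans (\sum_(1 <= j < n) 1)%N).
    by apply: leq_sum => j _; case: (_ < _).
  by rewrite sum_nat_const_nat muln1; lia.
have kset c : [set om | (k om < c)%N] =
    if (c == 0)%N then set0 else if (c < n)%N then [set om | (e om <= y c)%R] else setT.
  case: eqP => [->|/eqP c0]; first by apply/seteqP; split.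
  case: ltnP => cn; apply/seteqP; split=> om //=.
  - by rewrite kc// lt0n c0.
  - by rewrite kc// lt0n c0.
  - by move=> _; exact: leq_trans cn.
exists k; split=> //.
- move=> c; rewrite kset; case: eqP => // _; case: ifP => // _.
  exact: measurable_le_cst.
- move=> c cn; rewrite kset; case: eqP => [->|/eqP c0].
    by rewrite measure0 mul0r.
  case: ltnP => cn'; first by rewrite distr_funE yE// lt0n c0.
  have -> : c = n by apply/eqP; rewrite eqn_leq cn.
  by rewrite probability_setT divff// gt_eqF.
- move=> c z; rewrite kset; case: eqP => [_|_]; first by left.
  case: ifP => _; last by right.
  have [h|h] := leP (y c) z; [left|right] => om /= h'.
    exact: le_trans h.
  exact: le_trans h' (ltW h).
Qed.

End QuantileCoupling.

(** * The coupling with the empirical law *)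

Section QuantileCouplingBounds.
Context {R : realType} {d : measure_display} {T : measurableType d}.
Variables (P : probability T R) (e : T -> R).
Hypothesis me : measurable_fun setT e.

Section FixedIndex.
Variables (n : nat) (k : T -> nat).
Hypothesis Hk : quantile_index P e n k.

Lemma measurable_index_eq (j : nat) : measurable [set om | k om = j].
Proof.
rewrite [X in measurable X](_ : _ =
    [set om | (k om < j.+1)%N] `\` [set om | (k om < j)%N]).
  by apply: measurableD; exact: (quantile_index_measurable Hk).
apply/seteqP; split=> om /=; first by move=> ->; rewrite ltnSn ltnn.
by rewrite ltnS => -[h1 /negP]; rewrite -leqNgt => h2; apply/eqP; rewrite eqn_leq h1.
Qed.

Lemma prob_index_eq (j : nat) : (j < n)%N ->
  P [set om | k om = j] = (n%:R^-1)%:E.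
Proof.
move=> jn; have H1 := quantile_index_prob Hk jn.
have H2 := quantile_index_prob Hk (ltnW jn).
have E : [set om | (k om < j.+1)%N] = [set om | (k om < j)%N] `|` [set om | k om = j].
  apply/seteqP; split=> om /=.
    by rewrite ltnS leq_eqVlt => /predU1P[|]; [right|left].
  by case=> [/ltnW|->]; rewrite ltnS.
have D : [set om | (k om < j)%N] `&` [set om | k om = j] = set0.
  by apply/seteqP; split=> om //= -[h1 h2]; rewrite h2 ltnn in h1.
have : (P [set om | (k om < j.+1)%N] =
    P [set om | (k om < j)%N] + P [set om | k om = j])%E.
  rewrite E measureU//; first exact: (quantile_index_measurable Hk).
  exact: measurable_index_eq.
rewrite H1 H2 => H.
have Pf : P [set om | k om = j] \is a fin_num.
  by apply: fin_num_measure; exact: measurable_index_eq.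
rewrite -[LHS](fineK Pf); congr EFin.
move: H; rewrite -(fineK Pf) -EFinD => -[].
by rewrite -natr1 mulrDl mul1r => /addrI.
Qed.

Lemma index_sum (g : nat -> R) om :
  g (k om) = \sum_(0 <= j < n) g j * \1_[set om' | k om' = j] om.
Proof.
rewrite (bigD1_seq (k om)) ?mem_index_iota ?iota_uniq//=; last first.
  exact: (quantile_index_lt Hk).
rewrite indicE mem_set//= mulr1 big1 ?addr0// => j jk.
rewrite indicE memNset ?mulr0//= => kj.
by rewrite kj eqxx in jk.
Qed.

Lemma measurable_index_comp (g : nat -> R) : measurable_fun setT (fun om => g (k om)).
Proof.
under eq_fun do rewrite index_sum.
apply: measurable_sum => j; apply: measurable_funM; first exact: measurable_cst.
by apply: measurable_indic; exact: measurable_index_eq.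
Qed.

Lemma expectation_index (g : nat -> R) : (forall j, 0 <= g j) ->
  ('E_P[fun om => g (k om)] = (n%:R^-1 * \sum_(0 <= j < n) g j)%:E)%E.
Proof.
move=> g0; under eq_fun do rewrite index_sum.
have m1 j : measurable_fun setT (\1_[set om' | k om' = j] : T -> R).
  by apply: measurable_indic; exact: measurable_index_eq.
rewrite ge0_expectation_sum; last 2 first.
- by move=> j; apply: measurable_funM => //; exact: measurable_cst.
- by move=> j om; rewrite mulr_ge0.
rewrite mulr_sumr -sumEFin; rewrite big_nat_cond [RHS]big_nat_cond.
apply: eq_bigr => j /andP[/andP[_ jn] _].
rewrite ge0_expectationZl// expectation_indic; last exact: measurable_index_eq.
by rewrite prob_index_eq// muleC EFinM.
Qed.

(** The two events are nested, so their symmetric difference has as probability the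
difference of their probabilities. *)
Lemma expectation_index_diff (c : nat) (y : R) : (c <= n)%N ->
  ('E_P[fun om => `|\1_[set om' | (k om' < c)%N] om -
     \1_[set om' | (e om' <= y)%R] om : R|%R] <=
   `|c%:R / n%:R - distr_fun P e y|%:E)%E.
Proof.
move=> cn.
have mA := quantile_index_measurable Hk c.
have mB := measurable_le_cst me y.
have nested (A B : set T) : measurable A -> measurable B -> A `<=` B ->
    ('E_P[fun om => `|\1_A om - \1_B om : R|%R] <= `|fine (P A) - fine (P B)|%:E)%E.
  move=> mA' mB' AB.
  rewrite (_ : (fun om => _) = \1_(B `\` A)); last first.
    apply/funext => om; rewrite !indicE in_setD.
    have [/set_mem/AB/mem_set ->|_] := boolP (om \in A).
      by rewrite subrr normr0 andbF.
    by rewrite andbT sub0r normrN; case: (om \in B); rewrite ?normr1 ?normr0.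
  rewrite expectation_indic; last exact: measurableD.
  have PB : (P B = P A + P (B `\` A))%E.
    rewrite -measureU ?setDUK ?setDIK//; exact: measurableD.
  have fA : P A \is a fin_num by exact: fin_num_measure.
  have fD : P (B `\` A) \is a fin_num.
    by apply: fin_num_measure; exact: measurableD.
  rewrite PB fineD// opprD addrA subrr sub0r normrN.
  by rewrite -[leLHS](fineK fD) lee_fin ler_norm.
have FA : fine (P [set om | (k om < c)%N]) = c%:R / n%:R.
  by rewrite (quantile_index_prob Hk cn).
rewrite -FA /distr_fun.
case: (quantile_index_nested Hk c y) => AB; first exact: nested.
by rewrite distrC; under eq_fun do rewrite distrC; exact: nested.
Qed.

End FixedIndex.

(** The time index in 1, ..., n with the j-th smallest value of v, counting from 0. *)
Definition rank (v : nat -> R) (n j : nat) : nat :=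
  nth 0%N (sort (fun a b => v a <= v b) (iota 1 n)) j.

Lemma rank_sum (V : nmodType) (v : nat -> R) (n : nat) (f : nat -> V) :
  \sum_(0 <= j < n) f (rank v n j) = \sum_(1 <= t < n.+1) f t.
Proof.
rewrite [RHS](perm_big (sort (fun a b => v a <= v b) (iota 1 n))) /=; last first.
  by rewrite /index_iota subn1 /= perm_sym perm_sort.
by rewrite [RHS](big_nth 0%N) size_sort size_iota.
Qed.

Lemma sorted_count (v : nat -> R) (s : seq nat) (y : R) (j : nat) :
  sorted (fun a b => v a <= v b) s -> (j < size s)%N ->
  (v (nth 0%N s j) <= y) = (j < count (fun t => (v t <= y)%R) s)%N.
Proof.
elim: s j => [|x s IH] j //= ps js.
have tr : transitive (fun a b => v a <= v b) by move=> b a c; exact: le_trans.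
have [xy|yx] := leP (v x) y.
  by case: j js => [|j] js /=; rewrite ?xy// add1n ltnS IH// (path_sorted ps).
have /allP all_s := order_path_min tr ps.
rewrite add0n (eq_in_count (a2 := pred0)); last first.
  by move=> z /all_s xz /=; apply/negbTE; rewrite -ltNge (lt_le_trans yx).
rewrite count_pred0 ltn0; apply/negbTE; rewrite -ltNge.
case: j js => [|j] //= js; apply: lt_le_trans yx _.
by apply: all_s; rewrite mem_nth.
Qed.

Lemma rank_le (v : nat -> R) (n j : nat) (y : R) : (j < n)%N ->
  (v (rank v n j) <= y) = (j < count (fun t => (v t <= y)%R) (iota 1 n))%N.
Proof.
move=> jn; rewrite sorted_count ?size_sort ?size_iota//.
  by congr (_ < _)%N; apply/permP; rewrite perm_sort.
by apply: sort_sorted => a b; exact: le_total.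
Qed.

Lemma emp_cdf_count (v : nat -> R) (n : nat) (y : R) :
  emp_cdf n v y = (count (fun t => v t <= y) (iota 1 n))%:R / n%:R.
Proof.
rewrite /emp_cdf /average mulrC; congr (_ / _).
rewrite -sum1_count natr_sum [RHS]big_mkcond /index_iota subn1 /=.
by apply: eq_bigr => t _; case: (_ <= _).
Qed.

Definition coupling_gap (v : nat -> R) (n : nat) (k : T -> nat) (om : T) : R :=
  Num.min `|v (rank v n (k om)) - e om| 1.

(** If both coupled variables lie on the same side of every point of a grid of mesh
eta/3 covering the bulk of the law of e, they are within eta/3 of each other;
for each grid point, the probability that they lie on different sides is
|F_n(y) - F(y)|. *)
Lemma coupling_gap_grid (eta : R) : 0 < eta -> exists ys : seq R,
  forall (n : nat) (k : T -> nat) (v : nat -> R),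
    (0 < n)%N -> quantile_index P e n k ->
    ('E_P[coupling_gap v n k] <=
     (eta + \sum_(y <- ys) `|emp_cdf n v y - distr_fun P e y|)%:E)%E.
Proof.
move=> eta0; have eta30 : 0 < eta / 3 by rewrite divr_gt0.
have [B B0 [FB1 FB2]] := distr_fun_small P me eta30.
pose h := eta / 3.
have [M HM] : exists M : nat, 2 * B <= h * M%:R.
  exists (Num.trunc (2 * B / h)).+1.
  by rewrite [leRHS]mulrC -ler_pdivrMr//; apply: ltW; exact: truncnS_gt.
pose y (j : nat) := - B + h * j%:R.
exists [seq y j | j <- iota 0 M.+1] => n k v n0 Hk.
pose c j := count (fun t => v t <= y j) (iota 1 n).
have cn j : (c j <= n)%N by rewrite -[leqRHS](size_iota 1 n) count_size.
pose D j om := `|\1_[set om' | (k om' < c j)%N] om -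
     \1_[set om' | (e om' <= y j)%R] om : R|.
have mD j : measurable_fun setT (D j).
  apply: measurableT_comp => //; apply: measurable_funB; apply: measurable_indic.
    exact: (quantile_index_measurable Hk).
  exact: measurable_le_cst.
have D0 j om : 0 <= D j om by rewrite /D normr_ge0.
pose L := [set om | (e om <= - B)%R]; pose U := ~` [set om | (e om <= B)%R].
have mL : measurable L by exact: measurable_le_cst.
have mU : measurable U by apply: measurableC; exact: measurable_le_cst.
have mS : measurable_fun setT (fun om => \sum_(j <- iota 0 M.+1) D j om).
  exact: measurable_sum.
have mgap : measurable_fun setT (coupling_gap v n k).
  apply: measurable_minr; last exact: measurable_cst.
  apply: measurableT_comp => //; apply: measurable_funB => //.
  exact: (measurable_index_comp Hk (fun j => v (rank v n j))).
apply: (@le_trans _ _ ('E_P[fun om => (h + (\1_L om + (\1_U om +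
    \sum_(j <- iota 0 M.+1) D j om)))%R])%E).
  apply: ge0_expectation_le => //.
  - apply: measurable_funD; first exact: measurable_cst.
    apply: measurable_funD; first exact: measurable_indic.
    by apply: measurable_funD => //; exact: measurable_indic.
  - by move=> om; rewrite le_min normr_ge0 ler01.
  move=> om; have S0 : 0 <= \sum_(j <- iota 0 M.+1) D j om by rewrite sumr_ge0.
  have /andP[L0 _] := @indic_01 R _ _ L om; have /andP[U0 _] := @indic_01 R _ _ U om.
  have h0 : 0 <= h by exact: ltW.
  have [Lom|nL] := pselect (L om).
    have -> : \1_L om = 1 :> R by rewrite indicE mem_set.
    apply: (@le_trans _ _ 1); first by rewrite ge_min lexx orbT.
    by move: S0 U0; move: (\sum_(_ <- _) _) => S; lra.
  have [Uom|nU] := pselect (U om).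
    have -> : \1_U om = 1 :> R by rewrite indicE mem_set.
    apply: (@le_trans _ _ 1); first by rewrite ge_min lexx orbT.
    by move: S0 L0; move: (\sum_(_ <- _) _) => S; lra.
  have [[j jM Dj]|nD] := pselect (exists2 j, (j <= M)%N & D j om != 0).
    have Dj1 : D j om = 1.
      move: Dj; rewrite /D !indicE; case: (_ \in _); case: (_ \in _);
        by rewrite /= ?subrr ?subr0 ?sub0r ?normrN ?normr1 ?normr0 ?eqxx.
    have : 1 <= \sum_(j <- iota 0 M.+1) D j om.
      by rewrite (bigD1_seq j) ?iota_uniq ?mem_iota//= Dj1 lerDl sumr_ge0.
    move=> S1; apply: (@le_trans _ _ 1); first by rewrite ge_min lexx orbT.
    by move: S1 L0 U0; move: (\sum_(_ <- _) _) => S; lra.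
  have agree j : (j <= M)%N -> (v (rank v n (k om)) <= y j) = (e om <= y j).
    move=> jM; have : D j om = 0.
      by apply: contrapT => /eqP Dj; apply: nD; exists j.
    rewrite rank_le ?(quantile_index_lt Hk)// -/(c j) /D !indicE => /eqP.
    rewrite normr_eq0 subr_eq0 eqr_nat => /eqP h1.
    have b1 : (om \in [set om' | (k om' < c j)%N]) = (k om < c j)%N.
      by apply/idP/idP; rewrite inE.
    have b2 : (om \in [set om' | (e om' <= y j)%R]) = (e om <= y j).
      by apply/idP/idP; rewrite inE.
    by move: h1; rewrite b1 b2; case: (_ < _)%N; case: (_ <= _).
  have eB : - B < e om by rewrite ltNge; apply/negP.
  have eB' : e om <= B by apply: contrapT.
  have ex : exists j, e om <= y j.
    by exists M; apply: le_trans eB' _; rewrite /y; lra.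
  (* The cell of the grid that contains e also contains the coupled variable. *)
  case: (ex_minnP ex) => j ej jmin.
  have jM : (j <= M)%N.
    by apply: jmin; apply: le_trans eB' _; rewrite /y; lra.
  have j0 : (0 < j)%N.
    rewrite lt0n; apply/eqP => j00; move: ej; rewrite j00 /y mulr0 addr0 leNgt.
    by rewrite eB.
  have nej : y j.-1 < e om.
    by rewrite ltNge; apply/negP => /jmin; rewrite leqNgt prednK// leqnn.
  have wj : v (rank v n (k om)) <= y j by rewrite agree.
  have nwj : y j.-1 < v (rank v n (k om)).
    by rewrite ltNge agree ?(leq_trans (leq_pred _))// -ltNge.
  have yj : y j = y j.-1 + h.
    by rewrite /y -{1}(prednK j0) -natr1; ring.
  have hgap : coupling_gap v n k om <= h.
    rewrite ge_min; apply/orP; left; rewrite ler_norml; apply/andP; split; lra.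
  apply: (le_trans hgap); rewrite lerDl !addr_ge0//.
rewrite ge0_expectationD//; last 3 first.
- apply: measurable_funD; first exact: measurable_indic.
  by apply: measurable_funD => //; exact: measurable_indic.
- by move=> om; exact: ltW.
- by move=> om; rewrite !addr_ge0 ?sumr_ge0 ?(proj1 (andP (indic_01 _ _))).
rewrite ge0_expectationD//; last 2 first.
- by apply: measurable_funD => //; exact: measurable_indic.
- by move=> om; rewrite !addr_ge0 ?sumr_ge0 ?(proj1 (andP (indic_01 _ _))).
rewrite ge0_expectationD//; last by move=> om; rewrite sumr_ge0.
rewrite ge0_expectation_sum// !expectation_indic// expectation_cst.
have -> : (eta + \sum_(y0 <- [seq y j | j <- iota 0 M.+1]) `|emp_cdf n v y0 - distr_fun P e y0|)%:E
  = (h%:E + ((eta / 3)%:E + ((eta / 3)%:E + \sum_(j <- iota 0 M.+1)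
     `|emp_cdf n v (y j) - distr_fun P e (y j)|%:E)))%E.
  rewrite sumEFin -!EFinD big_map /h; congr EFin.
  by rewrite -[LHS]addr0; move: (\sum_(_ <- _) _) => S; lra.
rewrite leeD2l// leeD//; first by rewrite /L distr_funE// lee_fin.
rewrite leeD//.
  rewrite /U probability_setC; last exact: measurable_le_cst.
  by rewrite distr_funE// -EFinB lee_fin; lra.
apply: lee_sum => j _; rewrite emp_cdf_count -/(c j).
exact: expectation_index_diff.
Qed.

End QuantileCouplingBounds.

(** * Laws of large numbers through the coupling *)

Section DominatedSmall.
Context {R : realType} {d : measure_display} {T : measurableType d}.
Variable P : probability T R.

(** Dominated convergence, in the form needed to choose truncation levels. *)
Lemma dominated_small (f : nat -> T -> R) (h : T -> R) (kap : R) :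
  (forall j, measurable_fun setT (f j)) -> measurable_fun setT h ->
  (forall j om, 0 <= f j om <= h om) -> (forall om, f^~ om @ \oo --> 0) ->
  ('E_P[h] < +oo)%E -> 0 < kap -> exists j, ('E_P[f j] <= kap%:E)%E.
Proof.
move=> mf mh fh cvgf Eh k0.
have h0 om : 0 <= h om by case/andP: (fh 0%N om); exact: le_trans.
have ih : P.-integrable setT (EFin \o h).
  apply/integrableP; split; first exact/measurable_EFinP.
  rewrite unlock in Eh; apply: le_lt_trans Eh; rewrite le_eqVlt; apply/orP; left.
  by apply/eqP; apply: eq_integral => om _ /=; rewrite ger0_norm.
have H : (\int[P]_om (f n om)%:E @[n --> \oo] --> \int[P]_om (cst 0 om))%E.
  apply: (@dominated_cvg _ _ _ P setT measurableT _ _ (EFin \o h)) => //.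
  - by move=> n; apply/measurable_EFinP.
  - move=> om _ /=; apply: cvg_EFin; first exact: nearW.
    exact: cvgf.
  - by move=> n om _ /=; rewrite lee_fin ger0_norm; case/andP: (fh n om).
move: H; rewrite integral_cst// mul0e => /fine_cvgP[ffin /cvgrPdist_le /(_ _ k0)] H.
have : \forall n \near \oo, ('E_P[f n] <= kap%:E)%E.
  near=> n; have hf : (\int[P]_om (f n om)%:E)%E \is a fin_num by near: n.
  have : `|0 - fine (\int[P]_om (f n om)%:E)%E| <= kap by near: n.
  rewrite unlock -[X in (X <= _)%E](fineK hf) lee_fin sub0r normrN.
  by apply: le_trans; exact: ler_norm.
by move=> /filter_ex[j Hj]; exists j.
Unshelve. all: by end_near. Qed.

End DominatedSmall.

Section EmpiricalCoupling.
Context {R : realType} {d : measure_display} {T : measurableType d}.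
Variables (P : probability T R) (X eps : int -> {RV P >-> R}) (p : nat).
Local Notation path om := (fun t : int => X t om).
Variables (m : model) (th thb : 'rV[R]_(pdim m p)).
Hypotheses (stat : stationary X) (indep : independent eps).
Hypothesis approx : approximable X eps th thb.
Variable t0 : int.
Local Notation res t := (fun om => resid thb (path om) t).
Hypothesis dens : has_bounded_density P (res t0).

Let mres t : measurable_fun setT (res t).
Proof. exact: measurable_resid. Qed.

Lemma exists_quantile_indices :
  exists k : nat -> T -> nat, forall n, (0 < n)%N -> quantile_index P (res t0) n (k n).
Proof.
have [M M0 HM] := bounded_density_lipschitz (mres t0) dens.
suff /choice[k Hk] : forall n, exists kn, (0 < n)%N -> quantile_index P (res t0) n kn.
  by exists k.
move=> n; have [n0|] := ltnP 0 n; last by exists (fun=> 0%N).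
have [|k Hk] := exists_quantile_index (P := P) (mres t0) M0 _ n0; last by exists k.
move=> a b ab; rewrite lerBlDl -lee_fin EFinD -!(distr_funE P (mres t0)).
apply: le_trans (leeD2l _ (HM a b ab)).
have mab : measurable [set om | a < resid thb (path om) t0 <= b].
  have mI : measurable [set u : R | a < u <= b].
    by rewrite -[X in measurable X]set_itvE.
  by have := mres t0 measurableT mI; rewrite setTI.
apply: le_trans (measureU2 _ _ _) => //; last exact: measurable_le_cst.
rewrite le_measure ?inE//; first exact: measurable_le_cst.
  by apply: measurableU => //; exact: measurable_le_cst.
move=> om /= h; have [h'|h'] := leP (resid thb (path om) t0) a; [by left|right].
by rewrite h.
Qed.

Variable k : nat -> T -> nat.
Hypothesis Hk : forall n, (0 < n)%N -> quantile_index P (res t0) n (k n).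

Local Notation obs om := (fun t : nat => resid thb (path om) t%:Z).

(** The quality of the coupling of the empirical law of the residuals with the law of
e, for fixed data; the data point is [om], the integration variable is the one
of the coupling. *)
Definition gap_mean (n : nat) (om : T) : R :=
  fine ('E_P[coupling_gap (res t0) (obs om) n (k n)]).

Lemma coupling_gap_01 (v : nat -> R) n om :
  0 <= coupling_gap (res t0) v n (k n) om <= 1.
Proof. by rewrite /coupling_gap le_min normr_ge0 ler01 ge_min lexx orbT. Qed.

Lemma measurable_coupling_gap (v : nat -> R) n : (0 < n)%N ->
  measurable_fun setT (coupling_gap (res t0) v n (k n)).
Proof.
move=> n0; apply: measurable_minr; last exact: measurable_cst.
apply: measurableT_comp => //; apply: measurable_funB => //.
exact: (measurable_index_comp (Hk n0) (fun j => v (rank v n j))).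
Qed.

Lemma gap_meanE (n : nat) (om : T) : (0 < n)%N ->
  ('E_P[coupling_gap (res t0) (obs om) n (k n)] = (gap_mean n om)%:E)%E.
Proof.
move=> n0; rewrite fineK// ge0_fin_numE.
  apply: le_lt_trans (ltry 1); apply: expectation_le_cst.
    exact: measurable_coupling_gap.
  exact: coupling_gap_01.
by apply: expectation_ge0 => om'; case/andP: (coupling_gap_01 (obs om) n om').
Qed.

Lemma gap_mean_ge0 n om : 0 <= gap_mean n om.
Proof.
apply/fine_ge0/expectation_ge0 => om'.
by case/andP: (coupling_gap_01 (obs om) n om').
Qed.

Lemma gap_mean_small : small P gap_mean.
Proof.
apply: small_dom => kap k0.
have [ys Hys] := coupling_gap_grid P (mres t0) (divr_gt0 k0 (ltr0n R 2)).
exists (fun n om => \sum_(y <- ys) `|emp_cdf n (obs om) y - resid_cdf X thb t0 y|).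
exists (fun _ => cst 0), (kap / 2); split.
- by apply: small_sum => y; exact: (ecdf_small stat indep approx dens).
- by rewrite divr_gt0.
- by split=> // n; exact: measurable_cst.
- by near=> n; rewrite expectation_cst lee_fin ltW.
- near=> n => om hU; rewrite /cst addr0.
  have n0 : (0 < n)%N by near: n; exists 1%N.
  rewrite -lee_fin -gap_meanE//; apply: le_trans (Hys n (k n) (obs om) n0 (Hk n0)) _.
  rewrite lee_fin; have := hU; rewrite /resid_cdf /distr_fun.
  by move: (\sum_(_ <- _) _) => S; lra.
Unshelve. all: by end_near. Qed.

Lemma average_coupling (n : nat) (om : T) (g : R -> R) : (0 < n)%N ->
  (forall x, 0 <= g x) ->
  (average n (fun t => g (obs om t)))%:E =
  ('E_P[fun om' => g (obs om (rank (obs om) n (k n om')))])%E.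
Proof.
move=> n0 g0.
rewrite (expectation_index (Hk n0) (g := fun j => g (obs om (rank (obs om) n j))))//.
by rewrite (rank_sum (obs om) n (fun t => g (obs om t))).
Qed.

Lemma resid_expectation (g : R -> R) (t : int) :
  measurable_fun setT g -> (forall x, 0 <= g x) ->
  ('E_P[fun om => g (res t om)] = 'E_P[fun om => g (res t0 om)])%E.
Proof.
move=> mg g0.
have := stationary_expectation stat t t0 (g := g \o window_resid thb).
under eq_fun do rewrite /= -resid_window.
under [in X in _ -> _ -> _ = X]eq_fun do rewrite /= -resid_window.
apply => [|v] /=; last exact: g0.
by apply: measurableT_comp => //; exact: measurable_window_resid.
Qed.

Definition clamp (M x : R) : R := Num.max (- M) (Num.min x M).

Lemma clamp_bound M x : 0 <= M -> - M <= clamp M x <= M.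
Proof.
move=> M0; rewrite /clamp le_max lexx /= ge_max ge_min lexx orbT andbT; lra.
Qed.

Lemma clamp_lipschitz M x y : `|clamp M x - clamp M y| <= `|x - y|.
Proof.
rewrite /clamp /Num.max /Num.min.
have := ler_norm (x - y); have := ler_norm (y - x); rewrite [`|y - x|]distrC.
move=> h1 h2; rewrite ler_norml; apply/andP; split;
  case: (ltP x M) => *; case: (ltP y M) => *;
  do ?case: ltP => *; try lra.
Qed.

Lemma clamp_id M x : - M <= x <= M -> clamp M x = x.
Proof.
by move=> /andP[h1 h2]; rewrite /clamp (min_idPl h2); apply/max_idPr.
Qed.

(** Law of large numbers for psi(e_t) by truncation: for bounded Lipschitz psi the
coupling gives it directly, and the truncation error is uniformly small in mean
by stationarity. *)
Lemma residual_lln (psi : R -> R) : measurable_fun setT psi ->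
  (forall x, 0 <= psi x) ->
  (forall M, 0 <= M -> exists2 L, 0 <= L &
     forall x y, - M <= x <= M -> - M <= y <= M -> `|psi x - psi y| <= L * `|x - y|) ->
  (forall M x, 0 <= M -> psi (clamp M x) <= psi x) ->
  ('E_P[fun om => psi (res t0 om)] < +oo)%E ->
  small P (fun n om => `|average n (fun t => psi (obs om t)) -
    fine ('E_P[fun om => psi (res t0 om)])|).
Proof.
move=> mpsi psi0 psiL psiM Efin; apply: small_dom => kap k0.
have kap30 : 0 < kap / 3 by rewrite divr_gt0.
have mclamp M : measurable_fun setT (clamp M).
  apply: measurable_maxr; first exact: measurable_cst.
  by apply: measurable_minr => //; exact: measurable_cst.
pose g (j : nat) (x : R) := psi x - psi (clamp j%:R x).
have g0 j x : 0 <= g j x by rewrite subr_ge0 psiM.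
have mg j : measurable_fun setT (g j).
  by apply: measurable_funB => //; exact: (measurableT_comp mpsi).
have [j Hj] : exists j, ('E_P[fun om => g j (res t0 om)] <= (kap / 3)%:E)%E.
  apply: (dominated_small (h := fun om => psi (res t0 om))) => //.
  - by move=> j; exact: (measurableT_comp (mg j)).
  - exact: (measurableT_comp mpsi).
  - by move=> j om; rewrite g0 lerBlDr lerDl psi0.
  - move=> om; apply/cvgrPdist_le => e0 e00.
    have : \forall n \near \oo, `|res t0 om| <= n%:R by exact: nbhs_infty_ger.
    apply: filterS => n; rewrite ler_norml => h.
    by rewrite /g clamp_id// subrr subrr normr0 ltW.
set M : R := j%:R in Hj; have M0 : 0 <= M by rewrite /M.
have [L L0 HL] := psiL M M0.
pose psiM' x := psi (clamp M x).
have psiM'0 x : 0 <= psiM' x by exact: psi0.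
have mpsiM' : measurable_fun setT psiM' by exact: (measurableT_comp mpsi).
(* The truncation has values in an interval of length 2 M, so its increments are
   bounded by those of x capped at 1, up to this factor. *)
pose L' := L * (2 * M + 1).
have L'0 : 0 <= L' by rewrite mulr_ge0// addr_ge0// mulr_ge0.
have lipM x y : `|psiM' x - psiM' y| <= L' * Num.min `|x - y| 1.
  apply: le_trans (HL _ _ (clamp_bound _ M0) (clamp_bound _ M0)) _.
  rewrite /L' -mulrA ler_wpM2l//.
  have hc := clamp_lipschitz M x y.
  have := clamp_bound x M0; have := clamp_bound y M0 => /andP[? ?] /andP[? ?].
  have h2 : `|clamp M x - clamp M y| <= 2 * M.
    by rewrite ler_norml; apply/andP; split; lra.
  rewrite minEle; case: ifP => _; last by rewrite mulr1; lra.
  apply: le_trans hc _; rewrite ler_peMl//; lra.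
have finM : ('E_P[fun om => psiM' (res t0 om)] <= 'E_P[fun om => psi (res t0 om)])%E.
  apply: ge0_expectation_le => //.
  - exact: (measurableT_comp mpsiM').
  - exact: (measurableT_comp mpsi).
  - by move=> om; exact: psiM.
set c1 := fine ('E_P[fun om => psi (res t0 om)]).
pose c2 := fine ('E_P[fun om => psiM' (res t0 om)]).
have E1 : ('E_P[fun om => psi (res t0 om)] = c1%:E)%E.
  by rewrite fineK// ge0_fin_numE//; exact: expectation_ge0.
have E2 : ('E_P[fun om => psiM' (res t0 om)] = c2%:E)%E.
  rewrite fineK// ge0_fin_numE//; last exact: expectation_ge0.
  exact: le_lt_trans finM _.
have c21 : c2 <= c1 by rewrite -lee_fin -E1 -E2.
have c12 : c1 <= c2 + kap / 3.
  rewrite -lee_fin EFinD -E1 -E2; apply: le_trans (leeD2l _ Hj).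
  rewrite -ge0_expectationD//.
  - apply: ge0_expectation_le => //.
    + exact: (measurableT_comp mpsi).
    + apply: measurable_funD; first exact: (measurableT_comp mpsiM').
      exact: (measurableT_comp (mg j)).
    + by move=> om; rewrite /g /psiM' addrC subrK.
  - exact: (measurableT_comp mpsiM').
  - exact: (measurableT_comp (mg j)).
exists (fun n om => L' * gap_mean n om), (fun n om => average n (fun t => g j (obs om t))), (kap / 3).
split=> //.
- by apply: smallZl => //; exact: gap_mean_small.
- split=> [n|n om]; last exact: average_ge0.
  apply: (measurable_average n (f := fun t om => g j (obs om t))) => t.
  exact: (measurableT_comp (mg j)).
- near=> n; have n0 : (0 < n)%N by near: n; exists 1%N.
  apply: (expectation_average_le (f := fun t om => g j (obs om t))) => //.
    by move=> t; exact: (measurableT_comp (mg j)).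
  move=> t; rewrite (resid_expectation t%:Z (mg j) (g0 j)); apply: le_trans Hj _.
  by rewrite lee_fin; lra.
near=> n => om hU; have n0 : (0 < n)%N by near: n; exists 1%N.
have mV := measurable_index_comp (Hk n0) (fun j => psiM' (obs om (rank (obs om) n j))).
have mgap := measurable_coupling_gap (obs om) n0.
have gap0 om' : 0 <= coupling_gap (res t0) (obs om) n (k n) om'.
  by case/andP: (coupling_gap_01 (obs om) n om').
have EL : ('E_P[fun om' => L' * coupling_gap (res t0) (obs om) n (k n) om']%R =
    (L' * gap_mean n om)%:E)%E.
  by rewrite ge0_expectationZl// gap_meanE// EFinM.
have mLg : measurable_fun setT (fun om' => L' * coupling_gap (res t0) (obs om) n (k n) om').
  by apply: measurable_funM => //; exact: measurable_cst.
have Lg0 om' : 0 <= L' * coupling_gap (res t0) (obs om) n (k n) om' by exact: mulr_ge0.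
have mpr : measurable_fun setT (fun om' => psiM' (res t0 om')).
  exact: (measurableT_comp mpsiM').
have up : average n (fun t => psiM' (obs om t)) <= c2 + L' * gap_mean n om.
  rewrite -lee_fin EFinD average_coupling// -E2 -EL -ge0_expectationD//.
  apply: ge0_expectation_le => //; first exact: measurable_funD.
  move=> om'; rewrite -lerBlDl; apply: le_trans (lipM _ _); exact: ler_norm.
have lo : c2 <= average n (fun t => psiM' (obs om t)) + L' * gap_mean n om.
  rewrite -lee_fin EFinD average_coupling// -E2 -EL -ge0_expectationD//.
  apply: ge0_expectation_le => //; first exact: measurable_funD.
  move=> om'; rewrite -lerBlDl; apply: le_trans (ler_norm _) _.
  by rewrite distrC; exact: lipM.
have avE : average n (fun t => psi (obs om t)) =
    average n (fun t => psiM' (obs om t)) + average n (fun t => g j (obs om t)).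
  rewrite -averageD; congr average; apply/funext => t.
  by rewrite /g /psiM' addrC subrK.
have V0 : 0 <= average n (fun t => g j (obs om t)) by exact: average_ge0.
rewrite avE ler_norml; apply/andP; split; lra.
Unshelve. all: by end_near. Qed.

End EmpiricalCoupling.

(** * Positive and negative parts *)

Section ExpectationTools.
Context {R : realType} {d : measure_display} {T : measurableType d}.
Variable P : probability T R.

Definition pos_part (x : R) : R := Num.max x 0.
Definition neg_part (x : R) : R := Num.max (- x) 0.

Lemma pos_part_ge0 x : 0 <= pos_part x.
Proof. by rewrite /pos_part le_max lexx orbT. Qed.

Lemma neg_part_ge0 x : 0 <= neg_part x.
Proof. by rewrite /neg_part le_max lexx orbT. Qed.

Lemma pos_partB x : pos_part x - neg_part x = x.
Proof.
rewrite /pos_part /neg_part; case: (ltP x 0) => h; case: (ltP (- x) 0) => h';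
  lra.
Qed.

Lemma pos_part_le x : pos_part x <= `|x|.
Proof. by rewrite /pos_part ge_max ler_norm normr_ge0. Qed.

Lemma neg_part_le x : neg_part x <= `|x|.
Proof. by rewrite /neg_part ge_max -normrN ler_norm normr_ge0. Qed.

Lemma measurable_pos_part : measurable_fun setT pos_part.
Proof. by apply: measurable_maxr => //; exact: measurable_cst. Qed.

Lemma measurable_neg_part : measurable_fun setT neg_part.
Proof. by apply: measurable_maxr => //; exact: measurable_cst. Qed.

Lemma expectation_lty_Lfun (f : T -> R) : measurable_fun setT f ->
  ('E_P[fun om => `|f om|%R] < +oo)%E -> f \in Lfun P 1%E.
Proof.
move=> mf Ef; apply/Lfun1_integrable/integrableP; split.
  exact/measurable_EFinP.
by move: Ef; rewrite unlock.
Qed.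

(** A centred variable is handled through its two parts, so that all later integrals
are of nonnegative functions. *)
Lemma expectation_zero_parts (f : T -> R) : measurable_fun setT f ->
  ('E_P[fun om => `|f om|%R] < +oo)%E -> ('E_P[f] = 0)%E ->
  ('E_P[fun om => pos_part (f om)] = 'E_P[fun om => neg_part (f om)])%E.
Proof.
move=> mf Ef E0.
have mp : measurable_fun setT (fun om => pos_part (f om)).
  exact: (measurableT_comp measurable_pos_part).
have mn : measurable_fun setT (fun om => neg_part (f om)).
  exact: (measurableT_comp measurable_neg_part).
have ma : measurable_fun setT (fun om => `|f om|) by exact: measurableT_comp.
have Lp : (fun om => pos_part (f om)) \in Lfun P 1%E.
  apply: expectation_lty_Lfun => //; apply: le_lt_trans Ef.
  apply: ge0_expectation_le => //; first exact: measurableT_comp.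
  by move=> om; rewrite ger0_norm ?pos_part_ge0// pos_part_le.
have Ln : (fun om => neg_part (f om)) \in Lfun P 1%E.
  apply: expectation_lty_Lfun => //; apply: le_lt_trans Ef.
  apply: ge0_expectation_le => //; first exact: measurableT_comp.
  by move=> om; rewrite ger0_norm ?neg_part_ge0// neg_part_le.
have := expectationB Lp Ln.
rewrite (_ : _ \- _ = f); last by apply/funext => om /=; exact: pos_partB.
rewrite E0 => /esym/eqP; rewrite sube_eq ?add0e//.
- by move/eqP.
- exact: expectation_fin_num.
Qed.

Lemma expectation_le_trunc (f : T -> R) (C : \bar R) : measurable_fun setT f ->
  (forall om, 0 <= f om) ->
  (forall j : nat, ('E_P[fun om => Num.min (f om) j%:R] <= C)%E) ->
  ('E_P[f] <= C)%E.
Proof.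
move=> mf f0 H.
have mj (j : nat) : measurable_fun setT (fun om => Num.min (f om) (j%:R : R)).
  by apply: measurable_minr => //; exact: measurable_cst.
have cv : (\int[P]_om (Num.min (f om) (n%:R : R))%:E @[n --> \oo] -->
    \int[P]_om (f om)%:E)%E.
  rewrite (_ : (\int[P]_om (f om)%:E)%E =
      (\int[P]_om limn (fun n : nat => (Num.min (f om) (n%:R : R))%:E))%E).
    apply: cvg_monotone_convergence => //.
    - by move=> n; apply/measurable_EFinP.
    - by move=> n om _; rewrite lee_fin le_min f0 ler0n.
    - move=> om _ a b ab; rewrite lee_fin le_min ge_min lexx /=.
      by rewrite ge_min ler_nat ab orbT.
  apply: eq_integral => om _; apply/esym/cvg_lim => //.
  apply: cvg_EFin; first exact: nearW.
  apply/cvgrPdist_le => e0 e00.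
  have : \forall n \near \oo, f om <= n%:R by exact: nbhs_infty_ger.
  by apply: filterS => n h; rewrite /= (min_idPl h) subrr normr0 ltW.
rewrite unlock -(cvg_lim _ cv)//; apply: lime_le; first by apply/cvg_ex; exists (\int[P]_om (f om)%:E)%E.
by apply: nearW => n; have := H n; rewrite unlock.
Qed.

End ExpectationTools.

Section IidMoments.
Context {R : realType} {d : measure_display} {T : measurableType d}.
Variables (P : probability T R) (eps : int -> {RV P >-> R}).

Lemma iid_expectation (g : R -> R) (i j : int) : iid eps ->
  measurable_fun setT g -> (forall x, 0 <= g x) ->
  ('E_P[fun om => g (eps i om)] = 'E_P[fun om => g (eps j om)])%E.
Proof.
move=> [_ id] mg g0.
have E l : ('E_P[fun om => g (eps l om)] =
            \int[distribution P (eps l)]_v (g v)%:E)%E.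
  by rewrite unlock ge0_integral_distribution//; exact/measurable_EFinP.
by rewrite !E; apply: eq_measure_integral => A mA _; exact: id.
Qed.

(** Every even moment dominates the first absolute one. *)
Lemma innovation_integrable (m : model) (i : int) : innovation_moments m eps ->
  ('E_P[fun om => `|eps i om|%R] < +oo)%E.
Proof.
have H (n : nat) : (0 < n)%N -> ('E_P[fun om => (eps i om ^+ n.*2)%R] < +oo)%E ->
    ('E_P[fun om => `|eps i om|%R] < +oo)%E.
  move=> n0 h.
  have mX : measurable_fun setT (fun om => eps i om ^+ n.*2) by exact: measurable_funX.
  have X0 om : 0 <= eps i om ^+ n.*2 by rewrite -mul2n exprM exprn_ge0// sqr_ge0.
  apply: (@le_lt_trans _ _ ('E_P[fun om => (1 + eps i om ^+ n.*2)%R])%E).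
    apply: ge0_expectation_le => //.
    - exact: measurableT_comp.
    - by apply: measurable_funD => //; exact: measurable_cst.
    move=> om; have [h1|h1] := leP `|eps i om| 1.
      by apply: le_trans h1 _; rewrite lerDl.
    rewrite -mul2n exprM -(real_normK (num_real (eps i om))) -exprM mul2n.
    apply: (@le_trans _ _ (`|eps i om| ^+ n.*2)); last by rewrite lerDr.
    by rewrite -{1}[`|_|]expr1 ler_weXn2l ?(ltW h1)//; lia.
  rewrite ge0_expectationD//; first by rewrite expectation_cst lte_add_pinfty ?ltry.
case: m => mom; have [_ _ h] := mom i.
- exact: (H 2%N).
- exact: (H 4%N).
Qed.

End IidMoments.

(** * AR residuals have mean zero *)

Section ArMean.
Context {R : realType} {d : measure_display} {T : measurableType d}.
Variables (P : probability T R) (X eps : int -> {RV P >-> R}) (p : nat).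
Variable th : 'rV[R]_p.
Hypothesis hX : model_condition (m := AR) X eps th.
Local Notation path om := (fun t : int => X t om).

Lemma stationary_marginal (g : R -> R) (t t' : int) :
  measurable_fun setT g -> (forall x, 0 <= g x) ->
  ('E_P[fun om => g (X t om)] = 'E_P[fun om => g (X t' om)])%E.
Proof.
move=> mg g0; have [stat _ _ _ _] := hX.
have E s : (fun om => g (X s om)) = (fun om => g (tnth (window p (path om) s) ord0)).
  by apply/funext => om; rewrite window_head.
rewrite !E.
apply: (stationary_expectation stat t t' (g := fun v : p.+1.-tuple R => g (tnth v ord0))) => //.
by apply: (measurableT_comp mg); exact: measurable_tnth.
Qed.

Lemma geometric_sum_le (r : R) (n : nat) : 0 < r < 1 ->
  \sum_(k < n.+1) r ^+ (n - k) <= (1 - r)^-1.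
Proof.
move=> /andP[r0 r1]; rewrite (reindex_inj rev_ord_inj) /=.
under eq_bigr => k _.
  rewrite subSS subKn; last by have := ltn_ord k; rewrite ltnS.
  over.
have r10 : 0 < 1 - r by rewrite subr_gt0.
rewrite -[leRHS]div1r ler_pdivlMr// mulrC.
have := subrX1 r n.+1; have := exprn_ge0 n.+1 (ltW r0).
move: (\sum_(i < n.+1) _) (r ^+ n.+1) => S q q0 h.
have -> : (1 - r) * S = 1 - q by rewrite -[1 - q]opprB h -mulNr opprB.
by rewrite lerBlDr lerDl.
Qed.

(** By stationarity the truncated mean of |X_t| is the one at a late time n + p,
where the stability bound leaves a geometric sum of the means of |eps| and a
remainder from the initial values that vanishes as n grows. *)
Lemma ar_integrable (t : int) : ('E_P[fun om => `|X t om|%R] < +oo)%E.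
Proof.
have [stat iide mom Hth _] := hX.
have [r [c [r01 c0 H]]] := ar_stable Hth.
have /andP[r0 r1] := r01.
have mn : measurable_fun setT (@Num.norm R R) by exact: normr_measurable.
have Efin : ('E_P[fun om => `|eps 0 om|%R] < +oo)%E.
  exact: innovation_integrable mom.
pose E1 := fine ('E_P[fun om => `|eps 0 om|%R])%E.
have E1E i : ('E_P[fun om => `|eps i om|%R] = E1%:E)%E.
  rewrite (iid_expectation i 0 iide mn)//.
  rewrite fineK// ge0_fin_numE//; exact: expectation_ge0.
have E10 : 0 <= E1 by apply/fine_ge0/expectation_ge0.
pose C := c * ((1 - r)^-1 * E1).
apply: (@le_lt_trans _ _ (C + 1)%:E); last exact: ltry.
have mX s : measurable_fun setT (fun om => `|X s om|) by exact: measurableT_comp.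
apply: expectation_le_trunc => // M.
pose u om (k : nat) := X k%:Z om.
pose vv om (k : nat) := u om k - \sum_(i < p | (i < k)%N) th 0 i * u om (k - i.+1)%N.
have mvv k : measurable_fun setT (vv ^~ k).
  apply: measurable_funB => //; under eq_fun do rewrite big_mkcond /=.
  apply: measurable_sum => i; case: (i < k)%N; last exact: measurable_cst.
  by apply: measurable_funM => //; exact: measurable_cst.
(* The first p inputs of the recursion carry the initial values; no moment of them
   is known, so their contribution is capped by M. *)
pose I om := \sum_(k < p) `|vv om k|.
have mI : measurable_fun setT I.
  by apply: measurable_sum => k; exact: measurableT_comp.
have I0 om : 0 <= I om by rewrite /I sumr_ge0.
pose J (n : nat) om := Num.min (c * r ^+ n * I om) M%:R.
have mJ n : measurable_fun setT (J n).
  apply: measurable_minr; last exact: measurable_cst.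
  by apply: measurable_funM => //; exact: measurable_cst.
have J0 n om : 0 <= J n om.
  by rewrite le_min ler0n andbT !mulr_ge0// exprn_ge0// ltW.
have [n Hn] : exists n, ('E_P[J n] <= 1%:E)%E.
  apply: (dominated_small (h := cst M%:R)) => //.
  - by move=> n om; rewrite J0 ge_min lexx orbT.
  - move=> om; apply/cvgrPdist_le => e e0.
    have cI : 0 <= c * I om by rewrite mulr_ge0.
    have [k0 Hk0] := geometric_small r01 cI e0.
    exists k0 => // n /= /Hk0 h; rewrite sub0r normrN ger0_norm//.
    by apply: le_trans h; rewrite ge_min mulrAC lexx.
  - by rewrite expectation_cst ltry.
have mmin s : measurable_fun setT (fun om => Num.min `|X s om| M%:R).
  by apply: measurable_minr => //; exact: measurable_cst.
pose g (x : R) : R := Num.min `|x| M%:R.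
have mg : measurable_fun setT g.
  by apply: measurable_minr => //; exact: measurable_cst.
rewrite (stationary_marginal t (n + p)%N%:Z mg); last first.
  by move=> x; rewrite le_min normr_ge0 ler0n.
pose N := (n + p)%N.
pose S om := \sum_(k < N.+1) r ^+ (N - k) * `|eps k%:Z om|.
have mS : measurable_fun setT S.
  apply: measurable_sum => k; apply: measurable_funM; first exact: measurable_cst.
  exact: measurableT_comp.
have S0 om : 0 <= S om.
  by rewrite sumr_ge0// => k _; rewrite mulr_ge0// exprn_ge0// ltW.
have mcS : measurable_fun setT (fun om => c * S om).
  by apply: measurable_funM => //; exact: measurable_cst.
apply: (@le_trans _ _ ('E_P[fun om => (c * S om + J n om)%R])%E).
  apply: expectation_le.
  - exact: mmin.
  - exact: measurable_funD.
  - by move=> om; rewrite le_min normr_ge0 ler0n.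
  - by move=> om; rewrite addr_ge0// mulr_ge0.
  apply: filterS (model_recursion hX) => om xE.
  have vE k : (p <= k)%N -> vv om k = eps k%:Z om.
    move=> pk; rewrite /vv /u xE /= /ar_mean addrAC.
    rewrite [X in _ - X]big_mkcond /= (_ : _ - _ = 0) ?add0r//.
    apply/eqP; rewrite subr_eq0; apply/eqP; apply: eq_bigr => i _.
    have ip := ltn_ord i; have -> : (i < k)%N by lia.
    by rewrite mxE; congr (_ * X _ om); lia.
  have bnd : `|X N%:Z om| <= c * S om + c * r ^+ n * I om.
    apply: le_trans (H (u om) N) _.
    rewrite -mulrA -mulrDr ler_wpM2l//.
    apply: (@le_trans _ _ (\sum_(k < N.+1) (r ^+ (N - k) * `|eps k%:Z om| +
        (if (k < p)%N then r ^+ n * `|vv om k| else 0)))).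
      apply: ler_sum => k _; rewrite -/(vv om k).
      case: ltnP => kp; last by rewrite vE// addr0.
      rewrite -[leLHS]add0r lerD//; first by rewrite mulr_ge0// exprn_ge0// ltW.
      rewrite ler_wpM2r// ler_wiXn2l ?(ltW r0) ?(ltW r1)//.
      by rewrite /N -addnBA ?leq_addr// ltnW.
    rewrite big_split /= lerD2l /I mulr_sumr.
    rewrite (big_ord_widen N.+1 (fun k => r ^+ n * `|vv om k|)); last first.
      by rewrite /N; lia.
    by rewrite [leRHS]big_mkcond.
  have M0 : (0 : R) <= M%:R by [].
  rewrite /J; have [h|h] := leP (c * r ^+ n * I om) M%:R.
    by rewrite ge_min; apply/orP; left.
  have cS0 : 0 <= c * S om by rewrite mulr_ge0.
  by rewrite ge_min; apply/orP; right; rewrite lerDr.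
rewrite ge0_expectationD//; last by move=> om; rewrite mulr_ge0.
rewrite EFinD leeD// ge0_expectationZl// ge0_expectation_sum; last 2 first.
- move=> k; apply: measurable_funM; first exact: measurable_cst.
  exact: measurableT_comp.
- by move=> k om; rewrite mulr_ge0// exprn_ge0// ltW.
rewrite /C EFinM lee_wpmul2l ?lee_fin//.
apply: (@le_trans _ _ (\sum_(k < N.+1) (r ^+ (N - k) * E1)%:E)%E).
  apply: lee_sum => k _; rewrite ge0_expectationZl ?exprn_ge0 ?(ltW r0)//.
    by rewrite E1E EFinM.
  exact: measurableT_comp.
by rewrite sumEFin lee_fin -mulr_suml ler_wpM2r// geometric_sum_le.
Qed.

Variable thb : 'rV[R]_p.

(** Taking means in the recursion gives mu (1 - sum theta_i) = 0, and 1 is not a zero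
of the characteristic polynomial. *)
Lemma ar_resid_mean (t0 : int) :
  ('E_P[fun om => `|resid (m := AR) thb (path om) t0|%R] < +oo)%E /\
  ('E_P[fun om => pos_part (resid (m := AR) thb (path om) t0)] =
   'E_P[fun om => neg_part (resid (m := AR) thb (path om) t0)])%E.
Proof.
have [stat iide mom Hth _] := hX.
have LX t : (X t : T -> R) \in Lfun P 1%E.
  by apply: expectation_lty_Lfun => //; exact: ar_integrable.
have Lpart t (g : R -> R) : measurable_fun setT g -> (forall x, 0 <= g x <= `|x|) ->
    (fun om => g (X t om)) \in Lfun P 1%E.
  move=> mg hg; apply: expectation_lty_Lfun; first exact: measurableT_comp.
  apply: le_lt_trans (ar_integrable t); apply: ge0_expectation_le => //.
  - by apply: measurableT_comp => //; exact: measurableT_comp.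
  - exact: measurableT_comp.
  - by move=> om; case/andP: (hg (X t om)) => h1 h2; rewrite ger0_norm.
have Lp t := Lpart t _ measurable_pos_part
  (fun x => introT andP (conj (pos_part_ge0 x) (pos_part_le x))).
have Ln t := Lpart t _ measurable_neg_part
  (fun x => introT andP (conj (neg_part_ge0 x) (neg_part_le x))).
have muE t : ('E_P[X t] = 'E_P[X 0%R])%E.
  have E s : ('E_P[X s] = 'E_P[fun om => pos_part (X s om)] -
      'E_P[fun om => neg_part (X s om)])%E.
    rewrite -expectationB//; congr expectation; apply/funext => om /=.
    by rewrite pos_partB.
  rewrite !E (stationary_marginal t 0 measurable_pos_part pos_part_ge0).
  by rewrite (stationary_marginal t 0 measurable_neg_part neg_part_ge0).
pose mu := fine ('E_P[X 0]).
have muF t : ('E_P[X t] = mu%:E)%E.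
  by rewrite muE fineK// expectation_fin_num.
pose comb (q : 'rV[R]_p) (t : int) : T -> R := fun om =>
  X t om - \sum_(i < p) q 0 i * X (t - i.+1%:Z) om.
have LS (q : 'rV[R]_p) t (s : seq 'I_p) :
    (fun om => \sum_(i <- s) q 0 i * X (t - i.+1%:Z) om) \in Lfun P 1%E /\
    ('E_P[fun om => (\sum_(i <- s) q 0 i * X (t - i.+1%:Z) om)%R] =
     (\sum_(i <- s) q 0 i * mu)%R%:E)%E.
  elim: s => [|i s [IH1 IH2]].
    rewrite big_nil; under eq_fun do rewrite big_nil.
    split; [exact: Lfun_cst|exact: expectation_cst].
  under eq_fun do rewrite big_cons.
  have LZ : (q 0 i \o* X (t - i.+1%:Z)) \in Lfun P 1%E by exact: Lfun_scale.
  rewrite (_ : (fun om => _) = (q 0 i \o* X (t - i.+1%:Z)) \+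
    (fun om => \sum_(j <- s) q 0 j * X (t - j.+1%:Z) om)); last first.
    by apply/funext => om /=; rewrite mulrC.
  split; first by apply: rpredD.
  rewrite expectationD// expectationZl// muF IH2 big_cons.
  by rewrite EFinD EFinM.
have combE (q : 'rV[R]_p) t : comb q t \in Lfun P 1%E /\
    ('E_P[comb q t] = (mu * (1 - \sum_(i < p) q 0 i))%R%:E)%E.
  have [h1 h2] := LS q t (index_enum 'I_p).
  have -> : comb q t = (X t : T -> R) \- (fun om => \sum_(i < p) q 0 i * X (t - i.+1%:Z) om).
    by [].
  split; first by apply: rpredB.
  rewrite expectationB// muF h2 -mulr_suml -EFinB; congr EFin; ring.
have mcomb q t : measurable_fun setT (comb q t).
  apply: measurable_funB => //; apply: measurable_sum => i.
  by apply: measurable_funM => //; exact: measurable_cst.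
have resE : (fun om => resid (m := AR) thb (path om) t0) = comb thb t0.
  apply/funext => om; rewrite /comb /resid /= /ar_mean; congr (_ - _).
  by apply: eq_bigr => i _; rewrite mxE.
have mu0 : mu = 0.
  have [_ h] := combE th 0.
  have : ('E_P[comb th 0%R] = 'E_P[eps 0%R])%E.
    rewrite unlock; apply: ae_eq_integral => //.
    - by apply/measurable_EFinP; exact: mcomb.
    - exact/measurable_EFinP.
    apply: filterS (model_recursion hX) => om xE _; congr EFin.
    rewrite /comb xE /= /ar_mean addrAC (_ : _ - _ = 0) ?add0r//.
    by apply/eqP; rewrite subr_eq0; apply/eqP; apply: eq_bigr => i _; rewrite mxE.
  have [-> _ _] := mom 0; rewrite h => -[] /eqP; rewrite mulf_eq0 => /orP[/eqP//|/eqP s0].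
  exfalso; have := Hth 1; rewrite normr1 lexx => /(_ isT) /eqP; apply.
  under eq_bigr => i _ do rewrite expr1n mulr1.
  by rewrite -rmorph_sum -(rmorph1 (real_complex R)) -rmorphB s0 rmorph0.
have [h1 h2] := combE thb t0.
have Eabs : ('E_P[fun om => `|comb thb t0 om|%R] < +oo)%E.
  have /Lfun1_integrable/integrableP[_] := h1.
  by rewrite unlock.
have := expectation_zero_parts (mcomb thb t0) Eabs.
rewrite h2 mu0 mul0r => /(_ erefl) h.
have E0 om : resid (m := AR) thb (path om) t0 = comb thb t0 om.
  by rewrite -[LHS]/((fun om => resid (m := AR) thb (path om) t0) om) resE.
by split; [under eq_fun do rewrite E0|under eq_fun do rewrite E0;
  under [X in _ = expectation _ X]eq_fun do rewrite E0].
Qed.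

End ArMean.

(** * ARCH residuals have mean zero *)

Section ArchMean.
Context {R : realType} {d : measure_display} {T : measurableType d}.
Variables (P : probability T R) (X eps : int -> {RV P >-> R}) (p : nat).
Variables (th thb : 'rV[R]_p.+1).
Hypotheses (p0 : (0 < p)%N) (hX : model_condition (m := ARCH) X eps th).
Hypothesis Hthb : Theta ARCH p thb.
Variable t0 : int.
Local Notation path om := (fun t : int => X t om).
Local Notation noise om := (fun t : int => eps t om).
Local Notation res t := (fun om => resid (m := ARCH) thb (path om) t).
Hypothesis var1 : ('E_P[fun om => (res t0 om ^+ 2)%R] = 1)%E.

Local Notation e0 := (fun om => eps t0 om).

Lemma expectation_mul_close (g : R -> R) (U1 U2 : T -> R) (kap : R) :
  measurable_fun setT g -> (forall x, 0 <= g x <= `|x|) ->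
  measurable_fun setT U1 -> measurable_fun setT U2 ->
  (forall om, 0 <= U1 om) -> (forall om, 0 <= U2 om) ->
  ('E_P[fun om => (`|e0 om| * `|U1 om - U2 om|)%R] <= kap%:E)%E ->
  ('E_P[fun om => (g (e0 om) * U1 om)%R] <=
   'E_P[fun om => (g (e0 om) * U2 om)%R] + kap%:E)%E.
Proof.
move=> mg hg mU1 mU2 U10 U20 h; apply: le_trans (leeD2l _ h).
have mge : measurable_fun setT (fun om => g (e0 om)) by exact: measurableT_comp.
have g0 x : 0 <= g x by case/andP: (hg x).
have m2 : measurable_fun setT (fun om => g (e0 om) * U2 om) by exact: measurable_funM.
have m3 : measurable_fun setT (fun om => `|e0 om| * `|U1 om - U2 om|).
  apply: measurable_funM; first exact: measurableT_comp.
  by apply: measurableT_comp => //; exact: measurable_funB.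
rewrite -ge0_expectationD//; last by move=> om; rewrite mulr_ge0.
apply: ge0_expectation_le.
- exact: measurable_funM.
- exact: measurable_funD.
- by move=> om; rewrite mulr_ge0.
move=> om; rewrite -lerBlDl -mulrBr.
apply: (@le_trans _ _ (g (e0 om) * `|U1 om - U2 om|)).
  by rewrite ler_wpM2l// ler_norm.
by rewrite ler_wpM2r//; case/andP: (hg (e0 om)).
Qed.

Let V om := vol_ratio th thb (lags p (path om) t0).

Let V0 om : 0 <= V om.
Proof. exact: vol_ratio_ge0. Qed.

Let mV : measurable_fun setT V.
Proof. by apply: measurable_vol_ratio => i; exact: measurable_lags. Qed.

Lemma arch_resid_ae : {ae P, forall om, res t0 om = eps t0 om * V om}.
Proof.
apply: filterS (model_recursion hX) => om xE.
exact: (arch_resid_path thb (xE t0)).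
Qed.

Let mres : measurable_fun setT (res t0).
Proof. exact: measurable_resid. Qed.

Lemma arch_resid_integrable : ('E_P[fun om => `|res t0 om|%R] < +oo)%E.
Proof.
apply: (@le_lt_trans _ _ ('E_P[fun om => (1 + res t0 om ^+ 2)%R])%E).
  apply: ge0_expectation_le => //.
  - exact: measurableT_comp.
  - by apply: measurable_funD; [exact: measurable_cst|exact: measurable_funX].
  move=> om; have := sqr_ge0 (`|res t0 om| - 1).
  by rewrite sqrrB1 real_normK ?num_real//; have := normr_ge0 (res t0 om); lra.
rewrite ge0_expectationD//; last 2 first.
- exact: measurable_funX.
- by move=> om; exact: sqr_ge0.
by rewrite expectation_cst var1 -EFinD ltry.
Qed.

(** Approximation in mean, against |eps|, of the truncated volatility ratio: with q
the difference, |eps| |q| <= (kap/2) eps^2 + q^2 / (2 kap). *)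
Lemma vol_trunc_close (M : nat) (kap : R) : 0 < kap -> exists k : nat,
  ('E_P[fun om => (`|e0 om| * `|Num.min (V om) M%:R -
     Num.min (vol_ratio th thb
       (lags_of p (traj (m := ARCH) th (noise om) (t0 - k.+1%:Z) k))) M%:R|)%R]
   <= kap%:E)%E.
Proof.
move=> k0.
pose eta := kap / 2.
have eta0 : 0 < eta by rewrite divr_gt0.
pose M2 : R := M%:R ^+ 2.
have M20 : 0 <= M2 by exact: sqr_ge0.
have kap'0 : 0 < kap ^+ 2 / (2 * (M2 + 1)).
  by rewrite divr_gt0 ?exprn_gt0// mulr_gt0// ltr_wpDl.
have [k Hk] := vol_ratio_approximable p0 hX Hthb eta0 kap'0.
exists k; have := Hk k (leqnn k) (t0 - k.+1%:Z); rewrite subrK.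
set Vk := fun om => vol_ratio th thb
       (lags_of p (traj (m := ARCH) th (noise om) (t0 - k.+1%:Z) k)).
rewrite -/(Vk _) => HA.
have mVk : measurable_fun setT Vk.
  apply: measurable_vol_ratio => i.
  exact: (adapted_measurable (@adapted_lags_traj _ _ _ P eps p ARCH th _ k i)).
set A := [set om | (eta < `|V om - Vk om|)%R].
have mA : measurable A.
  apply: measurable_lt_set; first exact: measurable_cst.
  by apply: measurableT_comp => //; exact: measurable_funB.
have HA' : (P A <= (kap ^+ 2 / (2 * (M2 + 1)))%:E)%E by exact: HA.
pose q om := Num.min (V om) M%:R - Num.min (Vk om) M%:R.
have mq : measurable_fun setT q.
  by apply: measurable_funB; apply: measurable_minr => //; exact: measurable_cst.
have Vk0 om : 0 <= Vk om by exact: vol_ratio_ge0.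
have M0 : (0 : R) <= M%:R by [].
have qM om : `|q om| <= M%:R.
  rewrite /q /Num.min; have := V0 om; have := Vk0 om.
  by move=> ? ?; rewrite ler_norml; apply/andP; split; do 2?case: ltP => *; lra.
have qV om : `|q om| <= `|V om - Vk om|.
  rewrite /q /Num.min.
  have := ler_norm (V om - Vk om); have := ler_norm (Vk om - V om).
  rewrite [`|Vk om - _|]distrC => h1 h2.
  by rewrite ler_norml; apply/andP; split; do 2?case: ltP => *; lra.
have q2 om : q om ^+ 2 <= eta ^+ 2 + M2 * \1_A om.
  rewrite -[q om ^+ 2]real_normK ?num_real//.
  have [Aom|nA] := pselect (A om).
    rewrite indicE mem_set// mulr1 -[leLHS]add0r lerD ?sqr_ge0//.
    by rewrite /M2 ler_pXn2r ?nnegrE.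
  rewrite indicE memNset// mulr0 addr0 ler_pXn2r ?nnegrE ?(ltW eta0)//.
  apply: le_trans (qV om) _; rewrite leNgt; exact/negP.
have amgm om : `|e0 om| * `|q om| <=
    kap / 2 * e0 om ^+ 2 + (2 * kap)^-1 * (eta ^+ 2 + M2 * \1_A om).
  apply: (@le_trans _ _ (kap / 2 * e0 om ^+ 2 + (2 * kap)^-1 * q om ^+ 2)); last first.
    by rewrite lerD2l ler_wpM2l// invr_ge0 mulr_ge0// ltW.
  rewrite -(real_normK (num_real (e0 om))) -[q om ^+ 2]real_normK ?num_real//.
  move: (`|e0 om|) (`|q om|) => a b.
  have : 0 <= (kap * a - b) ^+ 2 / (2 * kap).
    by rewrite divr_ge0 ?sqr_ge0// mulr_ge0// ltW.
  rewrite (_ : _ / _ = kap / 2 * a ^+ 2 + (2 * kap)^-1 * b ^+ 2 - a * b); first by lra.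
  by field; rewrite gt_eqF.
have me2 : measurable_fun setT (fun om => e0 om ^+ 2) by exact: measurable_funX.
have m1A : measurable_fun setT (\1_A : T -> R) by exact: measurable_indic.
have mM1 : measurable_fun setT (fun om => M2 * \1_A om).
  by apply: measurable_funM => //; exact: measurable_cst.
have mS1 : measurable_fun setT (fun om => eta ^+ 2 + M2 * \1_A om).
  by apply: measurable_funD => //; exact: measurable_cst.
have S10 om : 0 <= eta ^+ 2 + M2 * \1_A om.
  by rewrite addr_ge0 ?sqr_ge0// mulr_ge0.
have i20 : 0 <= (2 * kap)^-1 by rewrite invr_ge0 mulr_ge0// ltW.
have k20 : 0 <= kap / 2 by rewrite divr_ge0// ltW.
have [_ _ mom _ _] := hX.
have Ee2 : ('E_P[fun om => (e0 om ^+ 2)%R] = 1)%E by case: (mom t0).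
apply: (@le_trans _ _ ('E_P[fun om => (kap / 2 * e0 om ^+ 2 +
    (2 * kap)^-1 * (eta ^+ 2 + M2 * \1_A om))%R])%E).
  apply: ge0_expectation_le => //.
  - by apply: measurable_funM; apply: measurableT_comp.
  - by apply: measurable_funD; apply: measurable_funM => //; exact: measurable_cst.
rewrite ge0_expectationD; first last.
- by move=> om; rewrite mulr_ge0.
- by move=> om; rewrite mulr_ge0 ?sqr_ge0.
- by apply: measurable_funM => //; exact: measurable_cst.
- by apply: measurable_funM => //; exact: measurable_cst.
rewrite ge0_expectationZl//; last by move=> om; exact: sqr_ge0.
rewrite ge0_expectationZl// Ee2 mule1.
rewrite ge0_expectationD//; first last.
- by move=> om; rewrite mulr_ge0.
- by move=> om; rewrite sqr_ge0.
rewrite expectation_cst ge0_expectationZl// expectation_indic//.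
apply: (@le_trans _ _ ((kap / 2)%:E + ((2 * kap)^-1)%:E *
   ((eta ^+ 2)%:E + M2%:E * (kap ^+ 2 / (2 * (M2 + 1)))%:E))%E).
  by rewrite leeD2l// lee_wpmul2l ?lee_fin// leeD2l// lee_wpmul2l ?lee_fin.
rewrite -!(EFinM, EFinD) lee_fin.
have h1 : M2 * (kap ^+ 2 / (2 * (M2 + 1))) <= kap ^+ 2 / 2.
  have M21 : 0 < M2 + 1 by rewrite ltr_wpDl.
  have -> : M2 * (kap ^+ 2 / (2 * (M2 + 1))) = kap ^+ 2 / 2 * (M2 / (M2 + 1)).
    by field; rewrite gt_eqF.
  rewrite ler_piMr ?divr_ge0 ?sqr_ge0// ler_pdivrMr// mul1r lerDl//.
apply: (@le_trans _ _ (kap / 2 + (2 * kap)^-1 * (eta ^+ 2 + kap ^+ 2 / 2))).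
  by rewrite lerD2l ler_wpM2l// lerD2l.
rewrite (_ : kap / 2 + _ = kap * (7 / 8)); first by lra.
by rewrite /eta; field; rewrite gt_eqF.
Qed.

(** For an approximate truncated ratio W, which depends on earlier innovations only,
the mean of g(eps) W factorises and so is the same for g and g'; removing the
four approximations costs at most [kap].  Applied to the positive and the
negative part in both orders it shows that e has mean 0. *)
Lemma arch_parts_le (g g' : R -> R) :
  measurable_fun setT g -> measurable_fun setT g' ->
  (forall x, 0 <= g x <= `|x|) -> (forall x, 0 <= g' x <= `|x|) ->
  ('E_P[fun om => g (e0 om)] = 'E_P[fun om => g' (e0 om)])%E ->
  ('E_P[fun om => (g (e0 om) * V om)%R] <= 'E_P[fun om => (g' (e0 om) * V om)%R])%E.
Proof.
move=> mg mg' hg hg' Egg'; apply/lee_addgt0Pr => kap k0.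
have k40 : 0 < kap / 4 by rewrite divr_gt0.
have mVM (M : nat) : measurable_fun setT (fun om => Num.min (V om) M%:R).
  by apply: measurable_minr => //; exact: measurable_cst.
have mae : measurable_fun setT (fun om => `|e0 om|) by exact: measurableT_comp.
have [M HM] : exists M : nat,
  ('E_P[fun om => (`|e0 om| * `|V om - Num.min (V om) M%:R|)%R] <= (kap / 4)%:E)%E.
  apply: (dominated_small (h := fun om => `|e0 om| * V om)) => //.
  - move=> M; apply: measurable_funM => //.
    by apply: measurableT_comp => //; exact: measurable_funB.
  - exact: measurable_funM.
  - move=> M om; rewrite mulr_ge0//= ler_wpM2l//.
    rewrite ger0_norm ?subr_ge0 ?ge_min ?lexx// lerBlDr lerDl.
    by rewrite le_min V0 ler0n.
  - move=> om; apply/cvgrPdist_le => eta eta0.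
    have : \forall n \near \oo, V om <= n%:R by exact: nbhs_infty_ger.
    apply: filterS => n h.
    by rewrite /= (min_idPl h) subrr normr0 mulr0 subrr normr0 ltW.
  - apply: le_lt_trans arch_resid_integrable; apply: expectation_le => //.
    + exact: measurable_funM.
    + exact: measurableT_comp.
    + by move=> om; rewrite mulr_ge0.
    apply: filterS arch_resid_ae => om ->.
    by rewrite normrM (ger0_norm (V0 om)).
have [k Hk] := vol_trunc_close M k40.
pose s := t0 - k.+1%:Z.
pose W om := Num.min (vol_ratio th thb
       (lags_of p (traj (m := ARCH) th (noise om) s k))) (M%:R : R).
have aW : adapted eps (past s k) W.
  apply: measurable_minr; last exact: measurable_cst.
  by apply: measurable_vol_ratio => i; exact: adapted_lags_traj.
have mW : measurable_fun setT W by exact: (adapted_measurable aW).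
have W0 om : 0 <= W om by rewrite le_min vol_ratio_ge0 ler0n.
have VM0 om : 0 <= Num.min (V om) M%:R by rewrite le_min V0 ler0n.
have [_ [indep _] _ _ _] := hX.
have gE (g1 : R -> R) : measurable_fun setT g1 -> (forall x, 0 <= g1 x <= `|x|) ->
    ('E_P[fun om => (g1 (e0 om) * W om)%R] = 'E_P[fun om => g1 (e0 om)] * 'E_P[W])%E.
  move=> mg1 hg1; rewrite (independent_expectation (I := [set t0]) (J := past s k) indep)//.
  - by move=> i -> []; rewrite /s; lia.
  - by apply: (measurableT_comp mg1); exact: adapted_eps.
  - by move=> om; case/andP: (hg1 (e0 om)).
apply: le_trans (expectation_mul_close mg hg mV (mVM M) V0 VM0 HM) _.
have H2 := expectation_mul_close mg hg (mVM M) mW VM0 W0 Hk.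
apply: le_trans (leeD2r _ H2) _.
rewrite gE// Egg' -gE//.
have Hk' : ('E_P[fun om => (`|e0 om| * `|W om - Num.min (V om) M%:R|)%R] <= (kap / 4)%:E)%E.
  by under eq_fun do rewrite distrC; exact: Hk.
have HM' : ('E_P[fun om => (`|e0 om| * `|Num.min (V om) M%:R - V om|)%R] <= (kap / 4)%:E)%E.
  by under eq_fun do rewrite distrC; exact: HM.
have H3 := expectation_mul_close mg' hg' mW (mVM M) W0 VM0 Hk'.
have H4 := expectation_mul_close mg' hg' (mVM M) mV VM0 V0 HM'.
apply: le_trans (leeD2r _ (leeD2r _ (le_trans H3 (leeD2r _ H4)))) _.
by rewrite -!addeA -!EFinD leeD2l// lee_fin; lra.
Qed.

Lemma arch_resid_mean :
  ('E_P[fun om => pos_part (res t0 om)] = 'E_P[fun om => neg_part (res t0 om)])%E.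
Proof.
have [_ _ mom _ _] := hX.
have mp := measurable_pos_part (R := R); have mn := measurable_neg_part (R := R).
have hp (x : R) : 0 <= pos_part x <= `|x| by rewrite pos_part_ge0 pos_part_le.
have hn (x : R) : 0 <= neg_part x <= `|x| by rewrite neg_part_ge0 neg_part_le.
have Ezero : ('E_P[fun om => pos_part (e0 om)] = 'E_P[fun om => neg_part (e0 om)])%E.
  apply: expectation_zero_parts => //.
    exact: innovation_integrable mom.
  by case: (mom t0).
have partE (g : R -> R) : measurable_fun setT g -> (forall x, 0 <= g x <= `|x|) ->
    (forall x c, 0 <= c -> g (x * c) = g x * c) ->
    ('E_P[fun om => g (res t0 om)] = 'E_P[fun om => (g (e0 om) * V om)%R])%E.
  move=> mg hg gM; rewrite unlock; apply: ae_eq_integral => //.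
  - by apply/measurable_EFinP; exact: (measurableT_comp mg).
  - apply/measurable_EFinP; apply: measurable_funM => //.
    by apply: (measurableT_comp mg).
  by apply: filterS arch_resid_ae => om -> _; rewrite gM.
have pM (x c : R) : 0 <= c -> pos_part (x * c) = pos_part x * c.
  by move=> c0; rewrite /pos_part maxr_pMl// mul0r.
have nM (x c : R) : 0 <= c -> neg_part (x * c) = neg_part x * c.
  by move=> c0; rewrite /neg_part maxr_pMl// mul0r mulNr.
rewrite (partE _ mp hp pM) (partE _ mn hn nM).
by apply/eqP; rewrite eq_le !arch_parts_le.
Qed.

End ArchMean.

(** * Perturbation of the parameter *)

Section Perturbation.
Context {R : realType}.

Lemma entry_le_norm (p : nat) (u : 'rV[R]_p) (i : 'I_p) : `|u 0 i| <= `|u|.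
Proof.
rewrite -[leRHS]/(mx_norm u) mx_normrE.
exact: (le_bigmax _ (fun j : 'I_1 * 'I_p => `|u j.1 j.2|) (0, i)).
Qed.

Lemma compact_entries (p : nat) (K : set 'rV[R]_p) : compact K ->
  exists2 B : R, 0 <= B & forall x, K x -> forall i, `|x 0 i| <= B.
Proof.
move=> /compact_bounded[M [_ HM]]; exists (`|M| + 1); first by rewrite addr_ge0.
move=> x Kx i; apply: le_trans (entry_le_norm x i) _.
by apply: HM Kx; rewrite ltr_pwDr// ler_norm.
Qed.

Lemma ar_mean_close (p : nat) (th th' z : 'rV[R]_p) :
  `|ar_mean th z - ar_mean th' z| <= `|th - th'| * \sum_(i < p) `|z 0 i|.
Proof.
rewrite /ar_mean -sumrB mulr_sumr; apply: le_trans (ler_norm_sum _ _ _) _.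
apply: ler_sum => i _; rewrite -mulrBl normrM ler_wpM2r//.
by have := entry_le_norm (th - th') i; rewrite !mxE.
Qed.

Lemma arch_vol_sqr_close (p : nat) (th th' : 'rV[R]_p.+1) (z : 'rV[R]_p) :
  param_domain ARCH p th -> param_domain ARCH p th' ->
  `|arch_vol th z ^+ 2 - arch_vol th' z ^+ 2| <=
     `|th - th'| * (1 + \sum_(i < p) z 0 i ^+ 2).
Proof.
move=> d d'; rewrite !arch_vol_sqr// opprD addrACA -sumrB mulrDr mulr1.
apply: le_trans (ler_normD _ _) _; apply: lerD.
  by have := entry_le_norm (th - th') ord0; rewrite !mxE.
rewrite mulr_sumr; apply: le_trans (ler_norm_sum _ _ _) _.
apply: ler_sum => i _; rewrite -mulrBl normrM (ger0_norm (sqr_ge0 _)) ler_wpM2r ?sqr_ge0//.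
by have := entry_le_norm (th - th') (lift ord0 i); rewrite !mxE.
Qed.

(** Near thetabar the coefficients of another parameter stay above half of those of
thetabar: automatically where thetabar vanishes, because parameters in the domain
are nonnegative. *)
Lemma arch_radius (p : nat) (thb : 'rV[R]_p.+1) : Theta ARCH p thb ->
  exists2 del0 : R, 0 < del0 & forall th', param_domain ARCH p th' ->
  `|th' - thb| <= del0 ->
  thb 0 ord0 / 2 <= th' 0 ord0 /\
  forall i : 'I_p, thb 0 (lift ord0 i) / 2 <= th' 0 (lift ord0 i).
Proof.
move=> [b0 bi _].
have [m m0 Hm] : exists2 m : R, 0 < m &
    forall i : 'I_p, 0 < thb 0 (lift ord0 i) -> m <= thb 0 (lift ord0 i).
  exists (\big[Num.min/1]_(i < p | 0 < thb 0 (lift ord0 i)) thb 0 (lift ord0 i)).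
    by apply: lt_bigmin.
  by move=> i h; apply: bigmin_le_cond.
exists (Num.min (thb 0 ord0 / 2) (m / 2)).
  by rewrite lt_min !divr_gt0.
move=> th' [t0 ti]; rewrite le_min => /andP[h1 h2].
have close j : `|th' 0 j - thb 0 j| <= `|th' - thb|.
  by have := entry_le_norm (th' - thb) j; rewrite !mxE.
split.
  have := le_trans (close ord0) h1; rewrite ler_norml => /andP[? _]; lra.
move=> i; have [h|h] := ltP 0 (thb 0 (lift ord0 i)).
  have := le_trans (close (lift ord0 i)) h2; rewrite ler_norml => /andP[? _].
  have := Hm i h; lra.
by have := ti i; lra.
Qed.

(** With y the ratio of the two volatilities, e' = e y.  The relative change y^2 - 1
is small of order [del], but with an unbounded factor; being also at most 1 in
modulus close to thetabar, it can be integrated against e^2 without moments of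
X beyond the second moment of e. *)
Lemma arch_resid_perturbation (p : nat) (thb : 'rV[R]_p.+1) : Theta ARCH p thb ->
  exists2 del0 : R, 0 < del0 & forall (th' : 'rV[R]_p.+1) (del : R),
  param_domain ARCH p th' -> `|th' - thb| <= del -> del <= del0 ->
  forall (x : int -> R) (t : int),
  let e := resid (m := ARCH) thb x t in let e' := resid (m := ARCH) th' x t in
  let r := (1 + e ^+ 2) *
    Num.min 1 (2 / thb 0 ord0 * del * (1 + \sum_(i < p) lags p x t 0 i ^+ 2)) in
  `|e' - e| <= r /\ `|e' ^+ 2 - e ^+ 2| <= r.
Proof.
move=> Hthb; have [del0 d0 Hd] := arch_radius Hthb.
exists del0 => // th' del dth' hdel hdel0 x t e e' r.
have [h0 hi] := Hd th' dth' (le_trans hdel hdel0).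
have dthb := Theta_domain Hthb.
have b0 : 0 < thb 0 ord0 by case: Hthb.
set z := lags p x t.
set vb := arch_vol thb z; set v := arch_vol th' z.
have vb0 : 0 < vb by exact: arch_vol_gt0.
have v0 : 0 < v by exact: arch_vol_gt0.
pose y := vb / v.
have y0 : 0 < y by rewrite divr_gt0.
have e'E : e' = e * y.
  by rewrite /e' /e /resid /= -/z -/vb -/v /y; field; rewrite !gt_eqF.
have v2 : vb ^+ 2 / 2 <= v ^+ 2.
  rewrite /vb /v !arch_vol_sqr// mulrDl lerD// mulr_suml.
  apply: ler_sum => i _; rewrite mulrAC ler_wpM2r ?sqr_ge0//.
have v2b : thb 0 ord0 / 2 <= v ^+ 2.
  rewrite /v arch_vol_sqr//; apply: le_trans h0 _.
  by rewrite lerDl sumr_ge0// => i _; rewrite mulr_ge0 ?sqr_ge0//; case: dth'.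
have y2 : y ^+ 2 - 1 = (vb ^+ 2 - v ^+ 2) / v ^+ 2.
  by rewrite /y; field; rewrite gt_eqF.
set S := 1 + \sum_(i < p) z 0 i ^+ 2.
have S0 : 0 <= S by rewrite addr_ge0// sumr_ge0// => i _; exact: sqr_ge0.
have rb : `|y ^+ 2 - 1| <= Num.min 1 (2 / thb 0 ord0 * del * S).
  rewrite le_min; apply/andP; split.
    (* The squared volatility at th' is at least half of that at thb. *)
    have : y ^+ 2 <= 2.
      rewrite /y expr_div_n ler_pdivrMr ?exprn_gt0//; lra.
    by have := sqr_ge0 y; rewrite ler_norml => *; apply/andP; split; lra.
  rewrite y2 normrM normfV (ger0_norm (sqr_ge0 v)) ler_pdivrMr ?exprn_gt0//.
  rewrite distrC; apply: le_trans (arch_vol_sqr_close z dth' dthb) _.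
  rewrite -/S; apply: (@le_trans _ _ (del * S)); first by rewrite ler_wpM2r.
  have dS : 0 <= del * S by rewrite mulr_ge0// (le_trans _ hdel).
  have -> : 2 / thb 0 ord0 * del * S * v ^+ 2 = del * S * (2 / thb 0 ord0 * v ^+ 2) by ring.
  rewrite ler_peMr//.
  have E1 : 2 / thb 0 ord0 * (thb 0 ord0 / 2) = 1 by field; rewrite gt_eqF.
  rewrite -[leLHS]E1.
  by rewrite ler_wpM2l// divr_ge0// ltW.
have y1 : `|y - 1| <= `|y ^+ 2 - 1|.
  rewrite -{2}(expr1n _ 2) subr_sqr normrM ler_peMr//.
  rewrite ger0_norm ?addr_ge0 ?(ltW y0)//; lra.
rewrite /r; split.
  rewrite e'E -{2}[e]mulr1 -mulrBr normrM.
  apply: ler_pM => //; last exact: le_trans y1 rb.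
  have := sqr_ge0 (`|e| - 1); rewrite sqrrB1 real_normK ?num_real//.
  by have := normr_ge0 e; lra.
rewrite e'E exprMn -{2}[e ^+ 2]mulr1 -mulrBr normrM.
apply: ler_pM => //; rewrite ger0_norm ?sqr_ge0// lerDr//.
Qed.

End Perturbation.

Section PerturbedResiduals.
Context {R : realType} {d : measure_display} {T : measurableType d}.
Variables (P : probability T R) (X : int -> {RV P >-> R}) (p : nat).
Local Notation path om := (fun t : int => X t om).
Variables (m : model) (thb : 'rV[R]_(pdim m p)).
Hypothesis stat : stationary X.
Variable that : nat -> T -> 'rV[R]_(pdim m p).
Hypothesis that_small : small P (fun n om => `|that n om - thb|).

(** A perturbation dominated by a stationary quantity whose mean tends to 0 with the
radius [del] is negligible on average. *)
Lemma perturbation_small (D : nat -> T -> nat -> R)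
    (pert : R -> p.+1.-tuple R -> R) (h : p.+1.-tuple R -> R) (del0 : R) :
  0 < del0 -> (forall del, measurable_fun setT (pert del)) ->
  measurable_fun setT h ->
  (forall del v, 0 <= del <= del0 -> 0 <= pert del v <= h v) ->
  (forall v, pert (del0 / n.+1%:R) v @[n --> \oo] --> 0) ->
  (exists t0, 'E_P[fun om => h (window p (path om) t0)] < +oo)%E ->
  (forall n om t del, `|that n om - thb| <= del -> del <= del0 ->
     D n om t <= pert del (window p (path om) t%:Z)) ->
  small P (fun n om => average n (D n om)).
Proof.
move=> d0 mpert mh perth pert0 [t0 Eh] HD; apply: small_dom => kap k0.
pose del n := del0 / n.+1%:R.
have del_01 n : 0 <= del n <= del0.
  by rewrite divr_ge0 ?(ltW d0)//= ler_pdivrMr ?ltr0n// ler_peMr ?(ltW d0)// ler1n.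
have [j Hj] : exists j, ('E_P[fun om => pert (del j) (window p (path om) t0)] <= kap%:E)%E.
  apply: (dominated_small (h := fun om => h (window p (path om) t0))) => //.
  - by move=> j; exact: (measurable_window_comp X t0 (mpert (del j))).
  - exact: measurable_window_comp.
  - by move=> j om; exact: perth.
pose pj (v : p.+1.-tuple R) := pert (del j) v.
have pj0 v : 0 <= pj v by case/andP: (perth (del j) v (del_01 j)).
exists (fun n om => `|that n om - thb|),
  (fun n om => average n (fun t => pj (window p (path om) t%:Z))), (del j).
have mw t : measurable_fun setT (fun om => pj (window p (path om) t)).
  exact: (measurable_window_comp X t (mpert (del j))).
split=> //.
- by rewrite divr_gt0.
- split=> [n|n om]; last exact: average_ge0.
  exact: (measurable_average n (f := fun t om => pj (window p (path om) t%:Z))).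
- near=> n; have n0 : (0 < n)%N by near: n; exists 1%N.
  apply: (expectation_average_le (f := fun t om => pj (window p (path om) t%:Z))) => //.
  by move=> t; rewrite (stationary_expectation stat t%:Z t0)//; exact: mpert.
near=> n => om hU; apply: (@le_trans _ _ (average n (fun t => pj (window p (path om) t%:Z)))).
  apply: average_le => t _; apply: HD => //.
  by case/andP: (del_01 j).
by rewrite lerDr ltW.
Unshelve. all: by end_near. Qed.

End PerturbedResiduals.

(** * Bootstrap residuals *)

Section BootstrapResiduals.
Context {R : realType}.

Lemma average_sqrB (n : nat) (u : nat -> R) (a : R) : (0 < n)%N ->
  average n (fun t => (u t - a) ^+ 2) =
  average n (fun t => u t ^+ 2) - 2 * a * average n u + a ^+ 2.
Proof.
move=> n0; rewrite -[X in _ = _ + X](average_cst _ n0) -averageZ -averageN -!averageD.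
by congr average; apply/funext => t; ring.
Qed.

Lemma eps_hat_close_AR (p n : nat) (th' thb : 'rV[R]_p) (x : int -> R) (tau : R) :
  (0 < n)%N ->
  average n (fun t => `|resid (m := AR) th' x t%:Z - resid (m := AR) thb x t%:Z|) <= tau ->
  `|average n (fun t => resid (m := AR) thb x t%:Z)| <= tau ->
  average n (fun t => `|eps_hat (m := AR) n th' x t - resid (m := AR) thb x t%:Z|) <= 24 * tau.
Proof.
move=> n0; set e := fun t : nat => resid (m := AR) thb x t%:Z.
set e' := fun t : nat => resid (m := AR) th' x t%:Z.
move=> h1 h2.
have tau0 : 0 <= tau by exact: le_trans h2.
have ae' : `|average n e'| <= 2 * tau.
  have -> : average n e' = average n (fun t => e' t - e t) + average n e.
    by rewrite -averageD; congr average; apply/funext => t; rewrite subrK.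
  apply: le_trans (ler_normD _ _) _.
  by have := ler_norm_average n (fun t => e' t - e t); lra.
apply: (@le_trans _ _ (average n (fun t => `|e' t - e t| + `|average n e'|))).
  apply: average_le => t _; rewrite /eps_hat /eps_check -/(e' t) -/(e t) addrAC.
  exact: ler_normB.
by rewrite averageD average_cst//; lra.
Qed.

(** The bound tau <= 1/8 keeps the empirical standard deviation above 1/2. *)
Lemma eps_hat_close_ARCH (p n : nat) (th' thb : 'rV[R]_p.+1) (x : int -> R) (tau : R) :
  (0 < n)%N -> tau <= 8^-1 ->
  average n (fun t => `|resid (m := ARCH) th' x t%:Z - resid (m := ARCH) thb x t%:Z|) <= tau ->
  average n (fun t => `|resid (m := ARCH) th' x t%:Z ^+ 2 -
                        resid (m := ARCH) thb x t%:Z ^+ 2|) <= tau ->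
  `|average n (fun t => resid (m := ARCH) thb x t%:Z)| <= tau ->
  `|average n (fun t => resid (m := ARCH) thb x t%:Z ^+ 2) - 1| <= tau ->
  average n (fun t => `|eps_hat (m := ARCH) n th' x t - resid (m := ARCH) thb x t%:Z|) <= 24 * tau.
Proof.
move=> n0 tau8; set e := fun t : nat => resid (m := ARCH) thb x t%:Z.
set e' := fun t : nat => resid (m := ARCH) th' x t%:Z.
move=> h1 h2 h3 h4.
have tau0 : 0 <= tau by exact: le_trans h3.
set a := average n e'.
have aB : `|a| <= 2 * tau.
  have -> : a = average n (fun t => e' t - e t) + average n e.
    by rewrite -averageD; congr average; apply/funext => t; rewrite subrK.
  apply: le_trans (ler_normD _ _) _.
  by have := ler_norm_average n (fun t => e' t - e t); lra.
have a2 : a ^+ 2 <= tau.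
  rewrite -(real_normK (num_real a)).
  apply: (@le_trans _ _ ((2 * tau) ^+ 2)); first by rewrite ler_pXn2r ?nnegrE// mulr_ge0.
  by rewrite exprMn expr2 [tau ^+ 2]expr2; nra.
set s2 := average n (fun t => (e' t - a) ^+ 2).
have s2E : s2 = average n (fun t => e' t ^+ 2) - a ^+ 2.
  by rewrite /s2 average_sqrB// -/a; ring.
have s21 : `|s2 - 1| <= 3 * tau.
  have -> : s2 - 1 = average n (fun t => e' t ^+ 2 - e t ^+ 2) +
      (average n (fun t => e t ^+ 2) - 1) - a ^+ 2.
    by rewrite s2E averageD averageN; ring.
  apply: le_trans (ler_normB _ _) _; rewrite (ger0_norm (sqr_ge0 a)).
  apply: le_trans (lerD (ler_normD _ _) a2) _.
  by have := ler_norm_average n (fun t => e' t ^+ 2 - e t ^+ 2); lra.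
pose s := Num.sqrt s2.
have s20 : 4^-1 <= s2 by move: s21; rewrite ler_norml => /andP[? ?]; lra.
have s_2 : s ^+ 2 = s2 by rewrite sqr_sqrtr//; apply: le_trans s20.
have s0 : 0 <= s by exact: sqrtr_ge0.
have s12 : 2^-1 <= s by rewrite -s_2 in s20; nra.
have s1 : `|1 - s| <= 3 * tau.
  rewrite distrC; apply: le_trans s21; rewrite -s_2 -{2}(expr1n _ 2) subr_sqr normrM.
  rewrite ler_peMr// ger0_norm; lra.
have abse : average n (fun t => `|e t|) <= 3.
  apply: (@le_trans _ _ (average n (fun t => 1 + e t ^+ 2))).
    apply: average_le => t _; have := sqr_ge0 (`|e t| - 1).
    by rewrite sqrrB1 real_normK ?num_real//; have := normr_ge0 (e t); lra.
  rewrite averageD average_cst//; move: h4; rewrite ler_norml => /andP[_]; lra.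
have term t : `|eps_hat (m := ARCH) n th' x t - e t| <=
    2 * (`|e' t - e t| + `|a| + `|1 - s| * `|e t|).
  rewrite /eps_hat /eps_check -/(e' t) -/e' -/a -/s2 -/s.
  have -> : (e' t - a) / s - e t = ((e' t - e t) - a + (1 - s) * e t) / s.
    by field; rewrite gt_eqF//; lra.
  rewrite normrM normfV mulrC.
  apply: ler_pM => //.
    by rewrite ger0_norm// -[leRHS]invrK lef_pV2 ?posrE//; lra.
  apply: le_trans (ler_normD _ _) _; rewrite normrM lerD2r; exact: ler_normB.
apply: le_trans (average_le (v := _) (fun t _ => term t)) _.
(* 24 = 2 (1 + 2 + 3 * 3): perturbation, recentring and rescaling. *)
rewrite averageZ !averageD average_cst// averageZ.
have : `|1 - s| * average n (fun t => `|e t|) <= 3 * tau * 3.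
  by apply: ler_pM => //; exact: average_ge0.
lra.
Qed.

End BootstrapResiduals.

Section ResidualAverages.
Context {R : realType} {d : measure_display} {T : measurableType d}.
Variables (P : probability T R) (X eps : int -> {RV P >-> R}) (p : nat).
Local Notation path om := (fun t : int => X t om).

Lemma ar_perturbation_small (th thb : 'rV[R]_p) (that : nat -> T -> 'rV[R]_p) :
  model_condition (m := AR) X eps th ->
  small P (fun n om => `|that n om - thb|) ->
  small P (fun n om => average n (fun t =>
    `|resid (m := AR) (that n om) (path om) t%:Z - resid (m := AR) thb (path om) t%:Z|)).
Proof.
move=> hX that_small; have [stat _ _ _ _] := hX.
pose h (v : p.+1.-tuple R) := \sum_(i < p) `|window_lags v 0 i|.
have mh : measurable_fun setT h.
  by apply: measurable_sum => i; apply: measurableT_comp => //; exact: measurable_window_lags.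
have h0 v : 0 <= h v by rewrite sumr_ge0.
apply: (perturbation_small (m := AR) stat that_small (del0 := 1) (pert := fun del v => del * h v) (h := h)) => //.
- by move=> del; apply: measurable_funM => //; exact: measurable_cst.
- by move=> del v /andP[d0 d1]; rewrite mulr_ge0//= ler_piMl.
- move=> v; rewrite -[X in _ --> X](mul0r (h v)); apply: cvgM; last exact: cvg_cst.
  rewrite -[X in _ --> X](mulr0 1); apply: cvgM; first exact: cvg_cst.
  exact: cvg_harmonic.
- exists 0; rewrite ge0_expectation_sum//; last first.
    move=> i; apply: measurableT_comp => //.
    exact: (measurable_window_comp X 0 (@measurable_window_lags _ p i)).
  apply: lte_sum_pinfty => i _; rewrite (_ : (fun om => _) = (fun om => `|X (0 - i.+1%:Z) om|)).
    exact: (ar_integrable hX).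
  by apply/funext => om; rewrite -lags_window mxE.
move=> n om t del hdel _; rewrite /resid /= opprB addrC subrKA distrC.
apply: le_trans (ar_mean_close _ _ _) _.
by rewrite /h -lags_window ler_wpM2r// sumr_ge0.
Qed.

Lemma arch_perturbation_small (thb : 'rV[R]_p.+1) (that : nat -> T -> 'rV[R]_p.+1) (t0 : int) :
  stationary X -> Theta ARCH p thb -> (forall n om, param_domain ARCH p (that n om)) ->
  small P (fun n om => `|that n om - thb|) ->
  ('E_P[fun om => (resid (m := ARCH) thb (path om) t0 ^+ 2)%R] = 1)%E ->
  small P (fun n om => average n (fun t =>
    `|resid (m := ARCH) (that n om) (path om) t%:Z - resid (m := ARCH) thb (path om) t%:Z|)) /\
  small P (fun n om => average n (fun t =>
    `|resid (m := ARCH) (that n om) (path om) t%:Z ^+ 2 -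
      resid (m := ARCH) thb (path om) t%:Z ^+ 2|)).
Proof.
move=> stat Hthb dthat that_small var1.
have [del0 d0 Hd] := arch_resid_perturbation Hthb.
have b0 : 0 < thb 0 ord0 by case: Hthb.
pose h (v : p.+1.-tuple R) := 1 + window_resid (m := ARCH) thb v ^+ 2.
pose S (v : p.+1.-tuple R) := 1 + \sum_(i < p) window_lags v 0 i ^+ 2.
pose pert del v := h v * Num.min 1 (2 / thb 0 ord0 * del * S v).
have mr := measurable_window_resid (m := ARCH) thb.
have mh : measurable_fun setT h.
  by apply: measurable_funD; [exact: measurable_cst|exact: measurable_funX].
have mS : measurable_fun setT S.
  apply: measurable_funD; first exact: measurable_cst.
  by apply: measurable_sum => i; apply: measurable_funX; exact: measurable_window_lags.
have h0 v : 0 <= h v by rewrite addr_ge0 ?sqr_ge0.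
have S0 v : 0 <= S v by rewrite addr_ge0// sumr_ge0// => i _; exact: sqr_ge0.
have mpert del : measurable_fun setT (pert del).
  apply: measurable_funM => //; apply: measurable_minr; first exact: measurable_cst.
  by apply: measurable_funM => //; exact: measurable_cst.
have perth del v : 0 <= del <= del0 -> 0 <= pert del v <= h v.
  move=> /andP[dd0 _]; rewrite mulr_ge0//=; last first.
    by rewrite le_min ler01 !mulr_ge0 ?invr_ge0// ltW.
  by rewrite ler_piMr// ge_min lexx.
have pert0 v : pert (del0 / n.+1%:R) v @[n --> \oo] --> 0.
  rewrite -(mulr0 (h v)); apply: cvgM; first exact: cvg_cst.
  have cv : 2 / thb 0 ord0 * (del0 / n.+1%:R) * S v @[n --> \oo] --> (0 : R).
    rewrite -[X in _ --> X](mul0r (S v)); apply: cvgM; last exact: cvg_cst.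
    rewrite -[X in _ --> X](mulr0 (2 / thb 0 ord0)); apply: cvgM; first exact: cvg_cst.
    rewrite -[X in _ --> X](mulr0 del0); apply: cvgM; first exact: cvg_cst.
    exact: cvg_harmonic.
  have c0 n : 0 <= 2 / thb 0 ord0 * (del0 / n.+1%:R) * S v.
    by rewrite !mulr_ge0 ?invr_ge0 ?ler0n// ltW.
  apply: (@squeeze_cvgr _ _ _ _ (cst 0) (fun n => 2 / thb 0 ord0 * (del0 / n.+1%:R) * S v)) => //.
    by apply: nearW => n; rewrite le_min ler01 c0 /= ge_min lexx orbT.
  exact: cvg_cst.
have Eh : (exists t0, 'E_P[fun om => h (window p (path om) t0)] < +oo)%E.
  exists t0; rewrite (_ : (fun om => _) = (fun om => 1 + resid (m := ARCH) thb (path om) t0 ^+ 2)).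
    rewrite ge0_expectationD//; last 2 first.
    - by apply: measurable_funX; exact: measurable_resid.
    - by move=> om; exact: sqr_ge0.
    by rewrite expectation_cst var1 -EFinD ltry.
  by apply/funext => om; rewrite /h -resid_window.
have bound n om t del : `|that n om - thb| <= del -> del <= del0 ->
   `|resid (m := ARCH) (that n om) (path om) t%:Z - resid (m := ARCH) thb (path om) t%:Z|
      <= pert del (window p (path om) t%:Z) /\
   `|resid (m := ARCH) (that n om) (path om) t%:Z ^+ 2 - resid (m := ARCH) thb (path om) t%:Z ^+ 2|
      <= pert del (window p (path om) t%:Z).
  move=> h1 h2; have := Hd _ _ (dthat n om) h1 h2 (path om) t%:Z.
  by rewrite /pert /h /S -resid_window -lags_window.
split; apply: (perturbation_small (m := ARCH) stat that_small d0 mpert mh perth pert0 Eh).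
- by move=> n om t del h1 h2; case: (bound n om t del h1 h2).
- by move=> n om t del h1 h2; case: (bound n om t del h1 h2).
Qed.

End ResidualAverages.

(** * Distance of the conditional laws *)

Section LawDistance.
Context {R : realType}.

Lemma is_norm_scale (N : R -> R) : is_norm N -> 0 <= N 1 /\ forall x, N x = N 1 * `|x|.
Proof.
move=> [Nadd Nscale _].
have NE x : N x = N 1 * `|x| by rewrite mulrC -Nscale mulr1.
split=> //; have := Nadd 1 (-1); rewrite subrr [N 0]NE [N (-1)]NE normr0 normrN normr1.
by rewrite mulr0 mulr1; lra.
Qed.

(** The transition map is Lipschitz in the parameter and in the innovation, uniformly
over bounded lags; in the ARCH case the parameter is multiplied by the
innovation, hence the factor 1 + |b|. *)
Lemma G_close (m : model) (p : nat) (thb : 'rV[R]_(pdim m p)) (B : R) :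
  Theta m p thb -> 0 <= B -> exists2 L : R, 0 <= L &
  forall (z : 'rV[R]_p) (th' : 'rV[R]_(pdim m p)), (forall i, `|z 0 i| <= B) ->
    param_domain m p th' -> `|th' - thb| <= 1 -> forall a b : R,
    `|G z th' a - G z thb b| <= L * (`|th' - thb| * (1 + `|b|) + `|a - b|).
Proof.
case: m thb => thb Hthb B0.
  exists (p%:R * B + 1); first by rewrite addr_ge0// mulr_ge0.
  move=> z th' zB _ _ a b /=; rewrite opprD addrACA.
  apply: le_trans (ler_normD _ _) _.
  have h := ar_mean_close th' thb z.
  have hS : \sum_(i < p) `|z 0 i| <= p%:R * B.
    apply: (@le_trans _ _ (\sum_(i < p) B)); first exact: ler_sum.
    by rewrite sumr_const card_ord mulr_natl.
  have D0 : 0 <= `|th' - thb| by [].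
  have h2 : `|th' - thb| * \sum_(i < p) `|z 0 i| <= `|th' - thb| * (p%:R * B).
    by rewrite ler_wpM2l.
  have pB0 : 0 <= p%:R * B by rewrite mulr_ge0.
  have hDu : 0 <= `|th' - thb| * `|b| by rewrite mulr_ge0.
  have hCDu := mulr_ge0 pB0 hDu.
  have hCv := mulr_ge0 pB0 (normr_ge0 (a - b)).
  rewrite (_ : (p%:R * B + 1) * _ = `|th' - thb| * (p%:R * B) + `|a - b| +
    (`|th' - thb| + `|th' - thb| * `|b| + p%:R * B * (`|th' - thb| * `|b|) +
     p%:R * B * `|a - b|)); last by ring.
  apply: (@le_trans _ _ (`|th' - thb| * (p%:R * B) + `|a - b|)).
    by rewrite lerD2r (le_trans h).
  by rewrite lerDl !addr_ge0.
have dthb := Theta_domain Hthb.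
have b0 : 0 < thb 0 ord0 by case: Hthb.
pose VB := Num.sqrt (thb 0 ord0 + \sum_(i < p) thb 0 (lift ord0 i) * B ^+ 2).
pose C := (1 + p%:R * B ^+ 2) / Num.sqrt (thb 0 ord0).
have sb0 : 0 < Num.sqrt (thb 0 ord0) by rewrite sqrtr_gt0.
have C0 : 0 <= C by rewrite divr_ge0 ?addr_ge0 ?mulr_ge0 ?sqr_ge0// ltW.
exists (VB + C); first by rewrite addr_ge0 ?sqrtr_ge0.
move=> z th' zB dth' D1 a b /=.
set v' := arch_vol th' z; set v := arch_vol thb z.
have z2 i : z 0 i ^+ 2 <= B ^+ 2.
  by rewrite -(real_normK (num_real (z 0 i))) ler_pXn2r ?nnegrE.
have vVB : v <= VB.
  rewrite /v /VB /arch_vol ler_wsqrtr// lerD2l; apply: ler_sum => i _.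
  by rewrite ler_wpM2l//; case: Hthb.
have vsb : Num.sqrt (thb 0 ord0) <= v.
  rewrite /v /arch_vol ler_wsqrtr// lerDl sumr_ge0// => i _.
  by rewrite mulr_ge0 ?sqr_ge0//; case: Hthb.
have v0 : 0 < v by exact: arch_vol_gt0.
have v'0 : 0 < v' by exact: arch_vol_gt0.
have D0 : 0 <= `|th' - thb| by [].
have vv : `|v' - v| <= `|th' - thb| * C.
  have h := arch_vol_sqr_close z dth' dthb.
  rewrite -/v -/v' subr_sqr normrM in h.
  rewrite /C mulrA ler_pdivlMr//.
  apply: (@le_trans _ _ (`|v' - v| * `|v' + v|)).
    rewrite ler_wpM2l// ger0_norm; last by rewrite addr_ge0// ltW.
    by rewrite (le_trans vsb)// lerDr ltW.
  apply: (le_trans h); rewrite ler_wpM2l// lerD2l.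
  apply: (@le_trans _ _ (\sum_(i < p) B ^+ 2)); first exact: ler_sum.
  by rewrite sumr_const card_ord mulr_natl.
have v'L : v' <= VB + C.
  have : `|v' - v| <= C by apply: le_trans vv _; rewrite ler_piMl.
  by rewrite ler_norml => /andP[_]; lra.
have -> : v' * a - v * b = v' * (a - b) + (v' - v) * b by ring.
apply: le_trans (ler_normD _ _) _; rewrite !normrM (ger0_norm (ltW v'0)).
have VB0 : 0 <= VB by exact: sqrtr_ge0.
have h1 : v' * `|a - b| <= (VB + C) * `|a - b| by rewrite ler_wpM2r.
have h2 : `|v' - v| * `|b| <= `|th' - thb| * C * `|b| by rewrite ler_wpM2r.
have h3 : 0 <= `|th' - thb| * (VB + C) by rewrite mulr_ge0// addr_ge0.
have h4 : 0 <= `|th' - thb| * VB * `|b| by rewrite !mulr_ge0.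
rewrite mulrDr [leRHS]addrC; apply: lerD => //.
apply: (le_trans h2).
rewrite (_ : (VB + C) * _ = `|th' - thb| * (VB + C) +
  (`|th' - thb| * VB * `|b| + `|th' - thb| * C * `|b|)); last by ring.
lra.
Qed.

Context {d : measure_display} {T : measurableType d}.
Variables (P : probability T R) (e : T -> R).
Hypothesis me : measurable_fun setT e.
Variables (n : nat) (k : T -> nat).
Hypothesis Hk : quantile_index P e n k.

(** Since the index is uniform and ranks permute the sample, any second labelling
[vh] of the times acquires its own empirical law. *)
Lemma emp_law_index (v vh : nat -> R) (A : set R) :
  P [set om | A (vh (rank v n (k om)))] = emp_law n vh A.
Proof.
pose g (j : nat) : R := \1_[set j' | A (vh (rank v n j'))] j.
have mB : measurable [set om | A (vh (rank v n (k om)))].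
  have mk := measurable_index_comp Hk g.
  have := mk measurableT [set 1%R] (measurable_set1 _); rewrite setTI.
  rewrite (_ : _ @^-1` _ = [set om | A (vh (rank v n (k om)))])//.
  apply/seteqP; split=> om /=; rewrite /g indicE.
    have [/set_mem//|_ /eqP] := boolP (_ \in _).
    by rewrite /= eq_sym oner_eq0.
  by move=> h; rewrite mem_set.
rewrite -(expectation_indic P)//.
rewrite (_ : (\1_ _ : T -> R) = fun om => g (k om)); last first.
  by apply/funext => om; rewrite /g !indicE; congr (nat_of_bool _)%:R.
rewrite (expectation_index Hk); last by move=> j; rewrite /g.
rewrite /emp_law EFinM; congr (_ * _)%E.
have -> : \sum_(0 <= j < n) g j = \sum_(1 <= t < n.+1) \1_A (vh t).
  rewrite -(rank_sum v n (fun t => \1_A (vh t) : R)); apply: eq_bigr => j _.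
  by rewrite /g !indicE; congr (nat_of_bool _)%:R.
by rewrite -sumEFin; apply: eq_bigr => t _; rewrite diracE indicE.
Qed.

Lemma law_dist_coupling (N : R -> R) (m : model) (p : nat)
    (th' thb : 'rV[R]_(pdim m p)) (z : 'rV[R]_p) (v vh : nat -> R) :
  (law_dist N (pushforward (emp_law n vh) (G z th'))
     (pushforward (pushforward P e) (G z thb)) <=
   'E_P[fun om => Num.min (N (G z th' (vh (rank v n (k om))) - G z thb (e om))%R) 1%R])%E.
Proof.
have mY : measurable_fun setT (fun om => G z thb (e om)).
  by apply: measurable_G => // i; exact: measurable_cst.
have mX := measurable_index_comp Hk (fun j => G z th' (vh (rank v n j))).
pose Xc : {mfun T >-> R} := HB.pack (fun om => G z th' (vh (rank v n (k om))))
  (isMeasurableFun.Build _ _ _ _ _ mX).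
pose Y : {mfun T >-> R} := HB.pack (fun om => G z thb (e om))
  (isMeasurableFun.Build _ _ _ _ _ mY).
apply: ereal_inf_lbound; exists d, T, P, Xc, Y; split=> // A mA.
exact: (emp_law_index v vh (G z th' @^-1` A)).
Qed.

(** min(c g, 1) splits into the parameter error, the distance of the two labellings at
the same time, and the coupling gap. *)
Lemma coupling_distance (c L D Ee : R) (v vh : nat -> R) (g : T -> R) :
  0 <= c -> 0 <= L -> 0 <= D ->
  measurable_fun setT g ->
  ('E_P[fun om => `|e om|%R] = Ee%:E)%E ->
  (forall om, 0 <= g om) ->
  (forall om, g om <= L * (D * (1 + `|e om|) + `|vh (rank v n (k om)) - e om|)) ->
  ('E_P[fun om => Num.min (c * g om)%R 1%R] <=
   (c * L * D * (1 + Ee) + (c * L + 1) *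
      (average n (fun t => `|vh t - v t|) +
       fine 'E_P[coupling_gap e v n k]))%:E)%E.
Proof.
move=> c0 L0 D0 mg EeE g0 gL.
have cL0 : 0 <= c * L by rewrite mulr_ge0.
have mgap : measurable_fun setT (coupling_gap e v n k).
  apply: measurable_minr; last exact: measurable_cst.
  apply: measurableT_comp => //; apply: measurable_funB => //.
  exact: (measurable_index_comp Hk (fun j => v (rank v n j))).
have gap01 om : 0 <= coupling_gap e v n k om <= 1.
  by rewrite /coupling_gap le_min normr_ge0 ler01 ge_min lexx orbT.
have gap0 om : 0 <= coupling_gap e v n k om by case/andP: (gap01 om).
have Egap : ('E_P[coupling_gap e v n k] = (fine 'E_P[coupling_gap e v n k])%:E)%E.
  rewrite fineK// ge0_fin_numE; last exact: expectation_ge0.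
  by apply: le_lt_trans (expectation_le_cst P mgap gap01) _; exact: ltry.
pose q j := `|vh (rank v n j) - v (rank v n j)|.
have mq := measurable_index_comp Hk q.
have Eq : ('E_P[fun om => q (k om)] = (average n (fun t => `|vh t - v t|))%:E)%E.
  rewrite (expectation_index Hk); last by move=> j; exact: normr_ge0.
  by rewrite /q (rank_sum v n (fun t => `|vh t - v t|)).
have mae : measurable_fun setT (fun om => `|e om|) by exact: measurableT_comp.
have mc (r : R) : measurable_fun setT (cst r : T -> R) by exact: measurable_cst.
have m1 : measurable_fun setT (fun om => 1 + `|e om|) by exact: measurable_funD.
have m2 : measurable_fun setT (fun om => c * L * D * (1 + `|e om|)).
  exact: measurable_funM.
have m3 : measurable_fun setT (fun om => q (k om) + coupling_gap e v n k om).
  exact: measurable_funD.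
have m4 : measurable_fun setT (fun om => (c * L + 1) * (q (k om) + coupling_gap e v n k om)).
  exact: measurable_funM.
have q0 j : 0 <= q j by exact: normr_ge0.
have s0 om : 0 <= q (k om) + coupling_gap e v n k om by rewrite addr_ge0.
have t1 om : 0 <= 1 + `|e om| by rewrite addr_ge0.
apply: (@le_trans _ _ ('E_P[fun om => (c * L * D * (1 + `|e om|) +
    (c * L + 1) * (q (k om) + coupling_gap e v n k om))%R])%E).
  apply: ge0_expectation_le => //.
  - by apply: measurable_minr => //; apply: measurable_funM.
  - exact: measurable_funD.
  - by move=> om; rewrite le_min ler01 mulr_ge0.
  move=> om; set w := `|vh (rank v n (k om)) - e om|.
  have w0 : 0 <= w by exact: normr_ge0.
  have hw : Num.min w 1 <= q (k om) + coupling_gap e v n k om.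
    rewrite /coupling_gap /q /w; set u := rank v n (k om).
    have tri : `|vh u - e om| <= `|vh u - v u| + `|v u - e om|.
      by rewrite -[vh u - e om](subrKA (v u)) ler_normD.
    rewrite /Num.min; case: ifP => h1; case: ifP => h2 //.
    - by have := normr_ge0 (vh u - v u); lra.
    - by move/negbT: h1; rewrite -leNgt => h1; lra.
    - by have := normr_ge0 (vh u - v u); lra.
  have cg : c * g om <= c * L * D * (1 + `|e om|) + c * L * w.
    rewrite (_ : _ + _ = c * (L * (D * (1 + `|e om|) + w))); last by ring.
    by rewrite ler_wpM2l.
  have hmin : Num.min (c * L * w) 1 <= (c * L + 1) * Num.min w 1.
    rewrite /Num.min; case: (ltP w 1) => h1; case: ifP => h2; nra.
  apply: (@le_trans _ _ (c * L * D * (1 + `|e om|) + Num.min (c * L * w) 1)).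
    have h0 : 0 <= c * L * D * (1 + `|e om|) by rewrite !mulr_ge0.
    rewrite /Num.min; case: ifP => h1; case: ifP => h2 //; first by lra.
    - by move/negbT: h1; rewrite -leNgt => h1; lra.
    - by lra.
  rewrite lerD2l; apply: (le_trans hmin); rewrite ler_wpM2l// addr_ge0//.
rewrite ge0_expectationD//; last 2 first.
- by move=> om; rewrite !mulr_ge0.
- by move=> om; rewrite mulr_ge0// addr_ge0.
rewrite ge0_expectationZl ?mulr_ge0// ge0_expectationZl ?addr_ge0//.
rewrite ge0_expectationD// ge0_expectationD//.
by rewrite expectation_cst EeE Eq Egap -!(EFinM, EFinD).
Qed.

End LawDistance.

(** * The theorem *)

Section ResidualMeans.
Context {R : realType} {d : measure_display} {T : measurableType d}.
Variables (P : probability T R) (X eps : int -> {RV P >-> R}) (p : nat).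
Local Notation path om := (fun t : int => X t om).

Lemma model_residual_facts (m : model) (th thb : 'rV[R]_(pdim m p)) (t0 : int) :
  (0 < p)%N -> model_condition X eps th -> Theta m p thb ->
  (m = ARCH -> 'E_P[fun om => (resid thb (path om) t0 ^+ 2)%R] = 1)%E ->
  [/\ approximable X eps th thb,
      ('E_P[fun om => `|resid thb (path om) t0|%R] < +oo)%E
    & ('E_P[fun om => pos_part (resid thb (path om) t0)] =
       'E_P[fun om => neg_part (resid thb (path om) t0)])%E].
Proof.
case: m th thb => th thb p0 hX Hthb var1.
  by have [? ?] := ar_resid_mean hX thb t0; split=> //; exact: ar_approximable.
split; first exact: arch_approximable.
  by apply: arch_resid_integrable; exact: var1.
exact: (arch_resid_mean p0 hX Hthb (var1 erefl)).
Qed.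

Lemma clamp_norm_le (M x : R) : 0 <= M -> `|clamp M x| <= `|x|.
Proof.
move=> M0; rewrite /clamp /Num.max /Num.min.
have h1 := ler_norm x; have h2 := ler_norm (- x); rewrite normrN in h2.
by rewrite ler_norml; apply/andP; split; case: (ltP x M) => *; case: ltP => *; lra.
Qed.

Section FixedModel.
Variables (m : model) (th thb : 'rV[R]_(pdim m p)) (t0 : int).
Hypotheses (p0 : (0 < p)%N) (hX : model_condition X eps th) (Hthb : Theta m p thb).
Hypothesis dens : has_bounded_density P (fun om => resid thb (path om) t0).
Hypothesis var1 : m = ARCH ->
  ('E_P[fun om => (resid thb (path om) t0 ^+ 2)%R] = 1)%E.

Lemma residual_means_small :
  small P (fun n om => `|average n (fun t => resid thb (path om) t%:Z)|) /\
  (m = ARCH ->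
   small P (fun n om => `|average n (fun t => resid thb (path om) t%:Z ^+ 2) - 1|)).
Proof.
have [approx Eabs Epn] := model_residual_facts p0 hX Hthb var1.
have [stat [indep _] _ _ _] := hX.
have [k Hk] := exists_quantile_indices dens.
have mres : measurable_fun setT (fun om => resid thb (path om) t0).
  exact: measurable_resid.
have lln psi := residual_lln stat indep approx dens Hk (psi := psi).
have partL (g : R -> R) : (g = pos_part \/ g = neg_part) ->
    forall x y, `|g x - g y| <= `|x - y|.
  have h1 (x y : R) := ler_norm (x - y).
  have h2 (x y : R) : y - x <= `|x - y| by rewrite distrC ler_norm.
  case=> -> x y; rewrite /pos_part /neg_part /Num.max ler_norml;
    have := h1 x y; have := h2 x y => *; apply/andP; split;
    case: ifP => a; case: ifP => b;
    try (move/negbT: a; rewrite -leNgt => a);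
    try (move/negbT: b; rewrite -leNgt => b); lra.
have partM (g : R -> R) : (g = pos_part \/ g = neg_part) ->
    forall M x, 0 <= M -> g (clamp M x) <= g x.
  case=> -> M x M0; rewrite ge_max ?pos_part_ge0 ?neg_part_ge0 andbT.
    by rewrite /pos_part /clamp ge_max !le_max !ge_min lexx oppr_le0 M0 !orbT.
  rewrite /neg_part le_max; have [xM|Mx] := leP x M; apply/orP; [left|right].
    by rewrite lerN2 /clamp (min_idPl xM) le_max lexx orbT.
  by rewrite oppr_le0 /clamp (min_idPr (ltW Mx)) le_max M0 orbT.
have smallpart (g : R -> R) : (g = pos_part \/ g = neg_part) ->
    measurable_fun setT g -> (forall x, 0 <= g x) -> (forall x, g x <= `|x|) ->
    small P (fun n om => `|average n (fun t => g (resid thb (path om) t%:Z)) -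
      fine ('E_P[fun om => g (resid thb (path om) t0)])|).
  move=> hg mg g0 gle; apply: lln => //.
  - by move=> M _; exists 1 => // x y _ _; rewrite mul1r; exact: partL.
  - exact: partM.
  apply: le_lt_trans Eabs; apply: ge0_expectation_le => //.
  - exact: (measurableT_comp mg).
  - exact: measurableT_comp.
split.
  have sp := smallpart _ (or_introl erefl) measurable_pos_part pos_part_ge0 pos_part_le.
  have sn := smallpart _ (or_intror erefl) measurable_neg_part neg_part_ge0 neg_part_le.
  apply: small_le (smallD sp sn) _; apply: nearW => n om; rewrite Epn.
  set c := fine _.
  have -> : average n (fun t => resid thb (path om) t%:Z) =
      (average n (fun t => pos_part (resid thb (path om) t%:Z)) - c) -
      (average n (fun t => neg_part (resid thb (path om) t%:Z)) - c).
    rewrite opprB addrA subrK -averageN -averageD; congr average.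
    by apply/funext => t; rewrite pos_partB.
  exact: ler_normB.
move=> /var1 v1; have := lln (fun x => x ^+ 2).
rewrite v1 /= => H; apply: H => //.
- by move=> x; exact: sqr_ge0.
- move=> M M0; exists (2 * M); first by rewrite mulr_ge0.
  move=> x y /andP[x1 x2] /andP[y1 y2]; rewrite subr_sqr normrM mulrC ler_wpM2r//.
  by rewrite ler_norml; apply/andP; split; lra.
- move=> M x M0; rewrite -(real_normK (num_real x)) -(real_normK (num_real (clamp M x))).
  by rewrite ler_pXn2r ?nnegrE// clamp_norm_le.
- by rewrite ltry.
Qed.

End FixedModel.

Lemma model_perturbation_small (m : model) (th thb : 'rV[R]_(pdim m p))
    (that : nat -> T -> 'rV[R]_(pdim m p)) (t0 : int) :
  model_condition X eps th -> Theta m p thb ->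
  (forall n om, param_domain m p (that n om)) ->
  small P (fun n om => `|that n om - thb|) ->
  (m = ARCH -> 'E_P[fun om => (resid thb (path om) t0 ^+ 2)%R] = 1)%E ->
  small P (fun n om => average n (fun t =>
    `|resid (that n om) (path om) t%:Z - resid thb (path om) t%:Z|)) /\
  (m = ARCH -> small P (fun n om => average n (fun t =>
    `|resid (that n om) (path om) t%:Z ^+ 2 - resid thb (path om) t%:Z ^+ 2|))).
Proof.
case: m th thb that => th thb that hX Hthb dthat ts v1.
  by split=> //; exact: (ar_perturbation_small hX).
have [stat _ _ _ _] := hX.
by have [? ?] := arch_perturbation_small stat Hthb dthat ts (v1 erefl); split.
Qed.

End ResidualMeans.

Lemma eps_hat_close (R : realType) (m : model) (p n : nat)
    (th' thb : 'rV[R]_(pdim m p)) (x : int -> R) (tau : R) :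
  (0 < n)%N -> tau <= 8^-1 ->
  average n (fun t => `|resid th' x t%:Z - resid thb x t%:Z|) <= tau ->
  `|average n (fun t => resid thb x t%:Z)| <= tau ->
  (m = ARCH ->
    average n (fun t => `|resid th' x t%:Z ^+ 2 - resid thb x t%:Z ^+ 2|) <= tau /\
    `|average n (fun t => resid thb x t%:Z ^+ 2) - 1| <= tau) ->
  average n (fun t => `|eps_hat n th' x t - resid thb x t%:Z|) <= 24 * tau.
Proof.
case: m th' thb => th' thb n0 t8 h1 h2 h3; first exact: eps_hat_close_AR.
by have [? ?] := h3 erefl; exact: eps_hat_close_ARCH.
Qed.

Theorem lemma4p1 (R : realType) (d : measure_display) (T : measurableType d)
    (P : probability T R) (m : model) (p : nat) (p_gt0 : (0 < p)%N)
    (X eps : int -> {RV P >-> R}) (theta : 'rV[R]_(pdim m p))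
    (hX : model_condition X eps theta)
    (that : forall n : nat, (n + p).-tuple R -> 'rV[R]_(pdim m p))
    (that_meas : forall n i, measurable_fun setT (fun s => that n s 0 i))
    (that_dom : forall n s, param_domain m p (that n s))
    (thetabar : 'rV[R]_(pdim m p)) (thetabar_in : Theta m p thetabar)
    (that_cvg : cvg_to0_in_prob P
      (fun n om => `|that n (sample n p (X^~ om)) - thetabar|%:E))
    (e : int -> T -> R)
    (eE : forall t om, e t om = resid thetabar (X^~ om) t)
    (t0 : int)
    (e_density : has_bounded_density P (e t0))
    (* automatic when thetabar = theta; the ARCH case is false without it, since
       the bootstrap innovations are rescaled to variance 1 and e is not *)
    (e_var : m = ARCH -> ('E_P[fun om => (e t0 om ^+ 2)%R] = 1)%E)
    (N : R -> R) (N_norm : is_norm N)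
    (K : set 'rV[R]_p) (K_compact : compact K) :
  cvg_to0_in_prob P (fun n om =>
    ereal_sup [set law_dist N
                 (boot_law n (that n (sample n p (X^~ om))) (X^~ om) x)
                 (model_law P thetabar (e t0) x) | x in K]).
Proof.
have e0E : e t0 = (fun om => resid thetabar (X^~ om) t0) by apply/funext => om; exact: eE.
rewrite e0E in e_density e_var *.
have [approx Eabs _] := model_residual_facts p_gt0 hX thetabar_in e_var.
have [stat [indep _] _ _ _] := hX.
have [k Hk] := exists_quantile_indices e_density.
have [c0 NE] := is_norm_scale N_norm.
have [B B0 KB] := compact_entries K_compact.
have [L L0 HL] := G_close thetabar_in B0.
pose hth n om := that n (sample n p (X^~ om)).
have s_th := cvg_to0_small that_cvg.
have [s_mean s_var] := residual_means_small p_gt0 hX thetabar_in e_density e_var.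
have [s_pert s_pert2] := model_perturbation_small hX thetabar_in
  (fun n om => that_dom n _) s_th e_var.
have s_gap := gap_mean_small stat indep approx e_density Hk.
pose res n (om : T) (t : nat) := resid (hth n om) (X^~ om) t%:Z.
pose obs (om : T) (t : nat) := resid thetabar (X^~ om) t%:Z.
(* Second moments of the residuals enter only through the ARCH rescaling. *)
pose arch : R := if m is ARCH then 1 else 0.
have mE : m = AR \/ m = ARCH by case: (m); [left|right].
pose Z2 n om : R := arch *
  (average n (fun t => `|res n om t ^+ 2 - obs om t ^+ 2|) +
   `|average n (fun t => obs om t ^+ 2) - 1|).
have arch0 : 0 <= arch by rewrite /arch; case: (m).
have Z20 n om : 0 <= Z2 n om.
  by rewrite mulr_ge0// addr_ge0// average_ge0.
have s_Z2 : small P Z2.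
  case: mE => E.
    apply: small_le (small0 P) _; apply: nearW => n om.
    by rewrite /Z2 (_ : arch = 0) ?mul0r// /arch E.
  apply: smallZl => //; exact: (smallD (s_pert2 E) (s_var E)).
pose Z n om := `|hth n om - thetabar| +
  (average n (fun t => `|res n om t - obs om t|) +
  (`|average n (obs om)| + (gap_mean X thetabar t0 k n om + Z2 n om))).
have s_Z : small P Z.
  apply: smallD => //; apply: smallD => //; apply: smallD => //; exact: smallD.
apply: small_cvg_to0 s_Z _ => del del0.
pose Ee := fine ('E_P[fun om => `|resid thetabar (X^~ om) t0|%R])%E.
have EeE : ('E_P[fun om => `|resid thetabar (X^~ om) t0|%R] = Ee%:E)%E.
  by rewrite fineK// ge0_fin_numE//; exact: expectation_ge0.
have Ee0 : 0 <= Ee by apply/fine_ge0/expectation_ge0.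
pose c := N 1.
(* 25 = 24 for the bootstrap residuals plus 1 for the coupling gap. *)
pose C := c * L * (1 + Ee) + (c * L + 1) * 25.
have cL0 : 0 <= c * L by rewrite mulr_ge0.
have C0 : 0 < C by rewrite ltr_wpDl ?mulr_ge0 ?addr_ge0// mulr_gt0// ltr_wpDl.
exists (Num.min 8^-1 (del / C)); first by rewrite lt_min invr_gt0 ltr0n divr_gt0.
have me : measurable_fun setT (fun om => resid thetabar (X^~ om) t0).
  exact: measurable_resid.
near=> n => om; rewrite le_min => /andP[Z8 ZC].
have n0 : (0 < n)%N by near: n; exists 1%N.
set tau := Z n om in Z8 ZC.
have a0 : 0 <= average n (fun t => `|res n om t - obs om t|) by exact: average_ge0.
have g0 := gap_mean_ge0 X thetabar t0 k n om.
have D0 : 0 <= `|hth n om - thetabar| by [].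
have m0 : 0 <= `|average n (obs om)| by [].
have tauE : tau = `|hth n om - thetabar| +
  (average n (fun t => `|res n om t - obs om t|) +
  (`|average n (obs om)| + (gap_mean X thetabar t0 k n om + Z2 n om))) by [].
have z0 := Z20 n om.
have close : average n (fun t => `|eps_hat n (hth n om) (X^~ om) t - obs om t|) <= 24 * tau.
  apply: eps_hat_close => //; [lra|lra|move=> E].
  have aE : arch = 1 by rewrite /arch E.
  have : average n (fun t => `|res n om t ^+ 2 - obs om t ^+ 2|) +
     `|average n (fun t => obs om t ^+ 2) - 1| <= tau.
    by have := tauE; rewrite /Z2 aE mul1r; lra.
  have := normr_ge0 (average n (fun t => obs om t ^+ 2) - 1).
  have : 0 <= average n (fun t => `|res n om t ^+ 2 - obs om t ^+ 2|) by exact: average_ge0.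
  by move=> *; split; lra.
apply: ge_ereal_sup => _ [z Kz <-].
apply: le_trans (law_dist_coupling me (Hk n n0) N (hth n om) thetabar z (obs om) _) _.
pose vh := eps_hat n (hth n om) (X^~ om).
pose g om' := `|G z (hth n om) (vh (rank (obs om) n (k n om'))) -
  G z thetabar (resid thetabar (X^~ om') t0)|.
under eq_fun do rewrite NE.
have mg : measurable_fun setT g.
  apply: measurableT_comp => //; apply: measurable_funB.
    exact: (measurable_index_comp (Hk n n0) (fun j => G z (hth n om) (vh (rank (obs om) n j)))).
  by apply: measurable_G => // i; exact: measurable_cst.
apply: le_trans (coupling_distance me (Hk n n0) (v := obs om) (vh := vh) (g := g) c0 L0 D0 mg EeE _ _) _.
- by move=> om'; exact: normr_ge0.
- by move=> om'; apply: HL; [exact: KB|exact: that_dom|lra].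
rewrite lee_fin.
apply: (@le_trans _ _ (C * tau)); last by rewrite mulrC -ler_pdivlMr.
have DT : `|hth n om - thetabar| <= tau by lra.
have gT : gap_mean X thetabar t0 k n om <= tau by lra.
rewrite /C [leRHS]mulrDl; apply: lerD.
  by rewrite -[leLHS]mulrA [leRHS]mulrAC -[leRHS]mulrA ler_wpM2l// ler_wpM2r// addr_ge0.
rewrite -[leRHS]mulrA ler_wpM2l ?addr_ge0//.
rewrite -/(gap_mean X thetabar t0 k n om) (_ : 25 = 24 + 1); last by ring.
by rewrite [leRHS]mulrDl mul1r lerD.
Unshelve. all: by end_near. Qed.
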